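(* Let $\mathbb R^{m+k}=\mathbb R^m\times\mathbb R^k$ ($k\ge1$) carry the canonical Euclidean metric $g_{can}$ and the foliation with leaves $\{x\}\times\mathbb R^k$, and let $f:(\mathbb R^{m+k},\mathbb R^k,g_{can})\to(N,\widetilde{\mathcal F},\widetilde g)$ be a horizontally harmonic map into a Riemannian foliation. Assume that $m>2$ and fix $(x_0,y_0)\in\mathbb R^{m+k}$. If $$\int_{D_{\rho,\delta}(x_0,y_0)}|df_{\mathcal H,\widetilde{\mathcal H}}|^2\,dV_g=o(\rho^{m-2})\qquad\text{as }\rho\to\infty$$ for any $\delta>0$, where $g=g_{can}$ and $D_{\rho,\delta}(x_0,y_0)=\{(x,y):|x-x_0|\le\rho,\ |y-y_0|\le\delta\}$, then $df_{\mathcal H,\widetilde{\mathcal H}}\equiv0$, that is, $f(\mathbb R^m\times\{p\})$ is contained in a single leaf of $\widetilde{\mathcal F}$ for any $p\in\mathbb R^k$.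
   Context: A foliation on a smooth manifold $M$ is given by an integrable distribution $\mathcal V\subset TM$; its leaves are the maximal connected integral submanifolds. Given a Riemannian metric $g$, put $\mathcal H=\mathcal V^\perp$ with orthogonal projections $\pi_{\mathcal H},\pi_{\mathcal V}$ and $g_{\mathcal H}=g(\pi_{\mathcal H}\cdot,\pi_{\mathcal H}\cdot)$. $(M,\mathcal F,g)$ is a Riemannian foliation if $\mathcal L_Ug_{\mathcal H}=0$ for every section $U$ of $\mathcal V$. Let $\nabla$ be the Levi-Civita connection of $g$. For $X,Y$ horizontal, $U$ vertical: $\mathcal W_XU=-\pi_{\mathcal V}(\nabla_UX)$, $\mathcal T_XY=\pi_{\mathcal V}(\nabla_XY)=\frac12\pi_{\mathcal V}([X,Y])$, extended to $TM$ by first projecting the arguments; $\mathcal T^*$ is defined by $g(\mathcal T_X^*Y,Z)=g(Y,\mathcal T_XZ)$. Objects on $N$ carry a tilde. For a smooth map $f:M\to N$: $df_{\mathcal H,\widetilde{\mathcal H}}=\pi_{\widetilde{\mathcal H}}\circ df\circ\pi_{\mathcal H}$, $df_{\mathcal H,\widetilde{\mathcal V}}=\pi_{\widetilde{\mathcal V}}\circ df\circ\pi_{\mathcal H}$; $|df_{\mathcal H,\widetilde{\mathcal H}}|^2=\sum_i|df_{\mathcal H,\widetilde{\mathcal H}}(e_i)|^2$ for a local orthonormal frame $\{e_i\}$ of $\mathcal H$. With $\widetilde\nabla$ also the pull-back connection on $f^{-1}TN$, $\beta_{\mathcal H,\widetilde{\mathcal H}}(X,Y)=\widetilde\nabla_X(df_{\mathcal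 H,\widetilde{\mathcal H}}(Y))-df_{\mathcal H,\widetilde{\mathcal H}}(\nabla_XY)$. The map $f$ is horizontally harmonic if it is a critical point of $E_{\mathcal H,\widetilde{\mathcal H}}(f)=\frac12\int_M|df_{\mathcal H,\widetilde{\mathcal H}}|^2dV_g$, that is, $\operatorname{tr}_g\beta_{\mathcal H,\widetilde{\mathcal H}}+\sum_i\big(\widetilde{\mathcal T}^*_{df_{\mathcal H,\widetilde{\mathcal H}}(e_i)}df_{\mathcal H,\widetilde{\mathcal V}}(e_i)+\widetilde{\mathcal W}_{df_{\mathcal H,\widetilde{\mathcal H}}(e_i)}df_{\mathcal H,\widetilde{\mathcal V}}(e_i)\big)=0$. *)

(* Defs.v *)
From HB Require Import structures.
From mathcomp Require Import all_boot all_order all_algebra.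
From mathcomp Require Import all_classical all_reals all_analysis.
Set Implicit Arguments.
Unset Strict Implicit.
Unset Printing Implicit Defensive.
Import Order.TTheory GRing.Theory Num.Theory.
Import numFieldNormedType.Exports.
Local Open Scope classical_set_scope.
Local Open Scope ring_scope.

Section cons_measure.
Context d (T : measurableType d) (R : realType) (n : nat).
Variables (m1 : {sigma_finite_measure set T -> \bar R})
  (m2 : {sigma_finite_measure set (n.-tuple T) -> \bar R}).

Definition tcons (x : T * n.-tuple T) : n.+1.-tuple T := [tuple of x.1 :: x.2].

Definition cons_measure : set (n.+1.-tuple T) -> \bar R :=
  pushforward (m1 \x m2)%E tcons.

Let measurable_tcons : measurable_fun [set: T * n.-tuple T] tcons.
Proof. exact: measurable_cons. Qed.

Let mcons : {measure set (n.+1.-tuple T) -> \bar R} :=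
  measure_function_pushforward__canonical__measure_function_Measure
    (m1 \x m2)%E measurable_tcons.

Let cons_measure0 : cons_measure set0 = 0%E.
Proof. exact: (measure0 mcons). Qed.

Let cons_measure_ge0 A : (0 <= cons_measure A)%E.
Proof. exact: (measure_ge0 mcons). Qed.

Let cons_measure_sigma_additive : semi_sigma_additive cons_measure.
Proof. exact: (@measure_semi_sigma_additive _ _ _ mcons). Qed.

HB.instance Definition _ := isMeasure.Build _ _ _ cons_measure
  cons_measure0 cons_measure_ge0 cons_measure_sigma_additive.

Let cons_measure_sigma_finite : sigma_finite setT cons_measure.
Proof.
have /sigma_finiteP[F [TF ndF Foo]] := sigma_finiteT m1.
have /sigma_finiteP[G [TG ndG Goo]] := sigma_finiteT m2.
pose uncons (t : n.+1.-tuple T) : T * n.-tuple T := (thead t, [tuple of behead t]).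
have unconsK : cancel tcons uncons.
  by case=> x t; congr pair; exact/val_inj.
have consK : cancel uncons tcons by move=> t; rewrite [RHS]tuple_eta.
have muncons : measurable_fun [set: _] uncons.
  apply/measurable_fun_pairP; split; [exact: measurable_tnth|].
  exact: measurable_behead.
exists (fun i => uncons @^-1` (F i `*` G i)).
  rewrite -preimage_bigcup (_ : \bigcup_i _ = setT) ?preimage_setT//.
  apply/seteqP; split=> // -[x t] _.
  have [i _ Fix] : (\bigcup_i F i) x by rewrite -TF.
  have [j _ Gjt] : (\bigcup_i G i) t by rewrite -TG.
  exists (maxn i j) => //; split.
  - by move: x Fix; exact/subsetPset/ndF/leq_maxl.
  - by move: t Gjt; exact/subsetPset/ndG/leq_maxr.
move=> i; have [mF Fi] := Foo i; have [mG Gi] := Goo i; split.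
  by rewrite -[X in measurable X]setTI; apply: muncons => //; exact: measurableX.
rewrite /cons_measure /pushforward -comp_preimage.
rewrite (_ : uncons \o tcons = id); last exact/funext.
by rewrite preimage_id product_measure1E// lte_mul_pinfty// ge0_fin_numE.
Qed.

HB.instance Definition _ := Measure_isSigmaFinite.Build _ _ _ cons_measure
  cons_measure_sigma_finite.

End cons_measure.

(* Lebesgue measure on R^n, as an iterated product measure. *)
Fixpoint lebesgue_tuple (R : realType) (n : nat) :
    {sigma_finite_measure set (n.-tuple (measurableTypeR R)) -> \bar R} :=
  match n with
  | 0 => (dirac [tuple] : {sigma_finite_measure set _ -> \bar R})
  | n'.+1 => cons_measure (@lebesgue_measure R) (lebesgue_tuple R n')
  end.

Fixpoint ndifferentiable_on (R : realType) (E F : normedModType R) (j : nat)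
    (U : set E) (h : E -> F) : Prop :=
  match j with
  | 0 => True
  | j'.+1 => (forall x, U x -> differentiable h x) /\
             forall v, ndifferentiable_on j' U (fun x => 'D_v h x)
  end.

Definition smooth_on (R : realType) (E F : normedModType R)
    (U : set E) (h : E -> F) : Prop :=
  forall j, ndifferentiable_on j U h.

(* [cmap] is only meaningful on [cdom], and [cinv] on the image [cimg]. *)
Record chart (R : realType) (N : topologicalType) (n : nat) := Chart {
  cdom : set N;
  cmap : N -> 'rV[R]_n;
  cinv : 'rV[R]_n -> N }.

Section charts.
Context {R : realType} {N : topologicalType} {n : nat}.
Implicit Types c : chart R N n.

Definition cimg c : set 'rV[R]_n := cmap c @` cdom c.

Definition is_chart c : Prop :=
  [/\ open (cdom c), open (cimg c),
      forall p, cdom c p -> cinv c (cmap c p) = p,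
      forall p, cdom c p -> {for p, continuous (cmap c)} &
      forall u, cimg c u -> {for u, continuous (cinv c)}].

Definition transition c c' : 'rV[R]_n -> 'rV[R]_n := cmap c' \o cinv c.

Definition overlap c c' : set 'rV[R]_n :=
  cimg c `&` [set u | cdom c' (cinv c u)].

Definition compatible c c' : Prop :=
  smooth_on (overlap c c') (transition c c') /\
  smooth_on (overlap c' c) (transition c' c).

End charts.

Record smooth_manifold (R : realType) (n : nat) := SmoothManifold {
  carrier :> topologicalType;
  atlas : set (chart R carrier n);
  manifold_hausdorff : hausdorff_space carrier;
  manifold_second_countable : @second_countable carrier;
  atlas_chart : forall c, atlas c -> is_chart c;
  atlas_cover : forall p, exists c, atlas c /\ cdom c p;
  atlas_compatible : forall c c', atlas c -> atlas c' -> compatible c c';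
  atlas_maximal : forall c, is_chart c ->
    (forall c', atlas c' -> compatible c c') -> atlas c }.

Definition chart_at (R : realType) (n : nat) (N : smooth_manifold R n) (p : N) :
    chart R N n :=
  sval (cid (atlas_cover p)).

Definition smooth_to (R : realType) (E : normedModType R) (n : nat)
    (N : smooth_manifold R n) (U : set E) (f : E -> N) : Prop :=
  (forall z, U z -> {for z, continuous f}) /\
  forall c, atlas c -> smooth_on (U `&` f @^-1` cdom c) (cmap c \o f).

Definition smooth_map (R : realType) (n' n : nat) (S : smooth_manifold R n')
    (N : smooth_manifold R n) (i : S -> N) : Prop :=
  forall a, atlas a -> smooth_to (cimg a) (i \o cinv a).

(* Tangent vectors in a chart are row vectors [v : 'rV_n]; the differential of
   [h] at [u] maps [v] to [v *m 'J h u].  A metric is given in every chart [c]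
   by its Gram matrix [g c u], a distribution by a matrix [V c u] whose row
   space is the fibre over the point with coordinates [u]. *)

Definition chart_field (R : realType) (n : nat) (N : smooth_manifold R n) :=
  chart R N n -> 'rV[R]_n -> 'M[R]_n.

Definition ip (R : realType) (n : nat) (G : 'rV[R]_n -> 'M[R]_n)
    (u v w : 'rV[R]_n) : R :=
  (v *m G u *m w^T) 0 0.

Definition riemannian_metric (R : realType) (n : nat) (N : smooth_manifold R n)
    (g : chart_field N) : Prop :=
  [/\ forall c, atlas c -> smooth_on (cimg c) (g c),
      forall c u, atlas c -> cimg c u -> (g c u)^T = g c u,
      forall c u v, atlas c -> cimg c u -> v != 0 -> 0 < ip (g c) u v v &
      forall c c' u, atlas c -> atlas c' -> overlap c c' u ->
        let J := 'J (transition c c') u in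
        g c u = J *m g c' (transition c c' u) *m J^T].

Section foliations.
Context {R : realType} {q r : nat} (N : smooth_manifold R (q + r)).
Implicit Types V : chart_field N.

Definition distribution V : Prop :=
  (forall c u, atlas c -> cimg c u -> \rank (V c u) = r) /\
  forall c c' u, atlas c -> atlas c' -> overlap c c' u ->
    (V c u *m 'J (transition c c') u == V c' (transition c c' u))%MS.

(* In a flat chart the distribution is spanned by the last [r] coordinate
   vectors. *)
Definition flat_chart V (c : chart R N (q + r)) : Prop :=
  forall u, cimg c u -> (V c u == row_mx (0 : 'M[R]_(r, q)) 1%:M)%MS.

(* Integrable distributions of rank [r]: every point lies in a flat chart.  In
   particular [V] is smooth. *)
Definition foliation V : Prop :=
  distribution V /\
  forall p : N, exists c, [/\ atlas c, cdom c p & flat_chart V c].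

(* As a subset of [N]: the image of an injective immersion [i] of a connected
   manifold [S] with [di (T_s S) = V_(i s)]. *)
Definition connected_integral_submanifold V (L : set N) : Prop :=
  exists (S : smooth_manifold R r) (i : S -> N),
    [/\ connected [set: S], smooth_map i, injective i, range i = L &
        forall s a c, atlas a -> cdom a s -> atlas c -> cdom c (i s) ->
          let J := 'J (cmap c \o i \o cinv a) (cmap a s) in
          row_free J /\ (J == V c (cmap c (i s)))%MS].

Definition leaf V (L : set N) : Prop :=
  connected_integral_submanifold V L /\
  forall L', connected_integral_submanifold V L' -> L `<=` L' -> L' = L.

End foliations.

Section coordinates.
Context {R : realType} {n : nat}.
Variables (G V : 'rV[R]_n -> 'M[R]_n).
Implicit Types u a b : 'rV[R]_n.

(* [v *m projV u] is the [G u]-orthogonal projection of [v] to [V u]; the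
   formula does not depend on the basis [B] of [V u]. *)
Definition projV u : 'M[R]_n :=
  let B := row_base (V u) in
  G u *m B^T *m invmx (B *m G u *m B^T) *m B.

Lemma projV_sub u a : (a *m projV u <= V u)%MS.
Proof. by rewrite /projV mulmxA (submx_trans (submxMl _ _))// eq_row_base. Qed.

Lemma gram_unit u : (forall v, v != 0 -> 0 < ip G u v v) ->
  row_base (V u) *m G u *m (row_base (V u))^T \in unitmx.
Proof.
move=> Gpos; rewrite -row_free_unit -kermx_eq0.
apply/eqP/row_matrixP => i; rewrite row0.
set v := row i _.
have vB : v *m (row_base (V u) *m G u *m (row_base (V u))^T) = 0.
  by apply/sub_kermxP; exact: row_sub.
have wB : v *m row_base (V u) = 0.
  apply/eqP/negP => /negP /Gpos.
  rewrite /ip (_ : _ *m _ *m _^T =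
    v *m (row_base (V u) *m G u *m (row_base (V u))^T) *m v^T).
    by rewrite vB mul0mx mxE ltxx.
  by rewrite trmx_mul !mulmxA.
by apply: (row_free_inj (row_base_free (V u))); rewrite wB mul0mx.
Qed.

Lemma projV_id u a : (forall v, v != 0 -> 0 < ip G u v v) ->
  (a <= V u)%MS -> a *m projV u = a.
Proof.
move=> Gpos aV.
have /submxP[b ->] : (a <= row_base (V u))%MS by rewrite eq_row_base.
rewrite /projV; set B := row_base _.
have -> : b *m B *m (G u *m B^T *m invmx (B *m G u *m B^T) *m B) =
    b *m (B *m G u *m B^T) *m invmx (B *m G u *m B^T) *m B.
  by rewrite !mulmxA.
by rewrite mulmxK// gram_unit.
Qed.

Lemma projV_orth u a b : (forall v, v != 0 -> 0 < ip G u v v) ->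
  (b <= V u)%MS -> ip G u (a *m projV u) b = ip G u a b.
Proof.
move=> Gpos bV.
have /submxP[c ->] : (b <= row_base (V u))%MS by rewrite eq_row_base.
have := gram_unit Gpos; rewrite /ip /projV.
move: (row_base (V u)) => B uB.
have -> : a *m (G u *m B^T *m invmx (B *m G u *m B^T) *m B) *m G u *m (c *m B)^T
    = a *m G u *m B^T *m invmx (B *m G u *m B^T) *m (B *m G u *m B^T) *m c^T.
  by rewrite trmx_mul !mulmxA.
by rewrite mulmxKV// trmx_mul !mulmxA.
Qed.

Definition projH u : 'M[R]_n := 1%:M - projV u.

Definition ipH u a b : R := ip G u (a *m projH u) (b *m projH u).

(* (L_U g_H)(a, b) = U (g_H (a, b)) - g_H ([U, a], b) - g_H (a, [U, b]) for
   constant fields a, b, where [U, a] = - D_a U. *)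
Definition lie_ipH (U : 'rV[R]_n -> 'rV[R]_n) u a b : R :=
  'D_(U u) (fun u' => ipH u' a b) u + ipH u ('D_a U u) b + ipH u a ('D_b U u).

(* Levi-Civita connection: [christoffel u a b] is the vector Gamma(a, b), i.e.
   2 g (Gamma(a, b), w) = D_a (g (b, w)) + D_b (g (a, w)) - D_w (g (a, b)). *)
Definition christoffel u a b : 'rV[R]_n :=
  (\row_l (2^-1 * ('D_a (fun u' => ip G u' b (delta_mx 0 l)) u
                   + 'D_b (fun u' => ip G u' a (delta_mx 0 l)) u
                   - 'D_(delta_mx 0 l) (fun u' => ip G u' a b) u)))
  *m invmx (G u).

Definition nabla a (Y : 'rV[R]_n -> 'rV[R]_n) u : 'rV[R]_n :=
  'D_a Y u + christoffel u a (Y u).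

Definition tensorT u a b : 'rV[R]_n :=
  nabla (a *m projH u) (fun u' => b *m projH u') u *m projV u.

Definition tensorW u a b : 'rV[R]_n :=
  - (nabla (b *m projV u) (fun u' => a *m projH u') u *m projV u).

(* g (T*_a b, w) = g (b, T_a w) *)
Definition tensorTadj u a b : 'rV[R]_n :=
  b *m G u *m (lin1_mx (tensorT u a))^T *m invmx (G u).

End coordinates.

(* Sections of [V] over the chart domains suffice, the condition being local. *)
Definition riemannian_foliation (R : realType) (n : nat)
    (N : smooth_manifold R n) (g V : chart_field N) : Prop :=
  forall c (U : 'rV[R]_n -> 'rV[R]_n), atlas c -> smooth_on (cimg c) U ->
    (forall u, cimg c u -> (U u <= V c u)%MS) ->
    forall u a b, cimg c u -> lie_ipH (g c) (V c) U u a b = 0.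

(* R^m x R^k has the Euclidean metric and the leaves {x} x R^k: horizontal
   vectors are the (v, 0), and the [hframe i] and [vframe j] form an orthonormal
   frame. *)

Section maps.
Context {R : realType} {m k : nat}.
Local Notation E := ('rV[R]_m * 'rV[R]_k)%type.

Definition pH (X : E) : E := (X.1, 0).
Definition hframe (i : 'I_m) : E := (delta_mx 0 i, 0).
Definition vframe (j : 'I_k) : E := (0, delta_mx 0 j).

Section coordinate_maps.
Context {n : nat}.
Variables (G V : 'rV[R]_n -> 'M[R]_n) (h : E -> 'rV[R]_n).

Definition dHH (z X : E) : 'rV[R]_n := 'D_(pH X) h z *m projH G V (h z).
Definition dHV (z X : E) : 'rV[R]_n := 'D_(pH X) h z *m projV G V (h z).

(* pull-back connection on sections of h^-1 TN *)
Definition pullback_nabla (X : E) (s : E -> 'rV[R]_n) (z : E) : 'rV[R]_n :=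
  'D_X s z + christoffel G (h z) ('D_X h z) (s z).

(* On vector fields X, Y; the Levi-Civita connection of E is 'D. *)
Definition betaHH (X Y : E -> E) (z : E) : 'rV[R]_n :=
  pullback_nabla (X z) (fun z' => dHH z' (Y z')) z - dHH z ('D_(X z) Y z).

Definition horizontal_tension (z : E) : 'rV[R]_n :=
  \sum_(i < m) betaHH (cst (hframe i)) (cst (hframe i)) z
  + \sum_(j < k) betaHH (cst (vframe j)) (cst (vframe j)) z
  + \sum_(i < m)
      (tensorTadj G V (h z) (dHH z (hframe i)) (dHV z (hframe i))
       + tensorW G V (h z) (dHH z (hframe i)) (dHV z (hframe i))).

Definition dHH_norm2 (z : E) : R :=
  \sum_(i < m) ip G (h z) (dHH z (hframe i)) (dHH z (hframe i)).

End coordinate_maps.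

Section maps_to_manifolds.
Context {n : nat} {N : smooth_manifold R n}.
Variables (g V : chart_field N) (f : E -> N).

Definition horizontally_harmonic : Prop :=
  forall z c, atlas c -> cdom c (f z) ->
    horizontal_tension (g c) (V c) (cmap c \o f) z = 0.

(* |df_HH|^2, which does not depend on the chart around [f z] *)
Definition energy_density (z : E) : R :=
  let c := chart_at (f z) in dHH_norm2 (g c) (V c) (cmap c \o f) z.

Definition dHH_eq0 : Prop :=
  forall z X c, atlas c -> cdom c (f z) -> dHH (g c) (V c) (cmap c \o f) z X = 0.

End maps_to_manifolds.
End maps.

Definition row_of_tuple (R : realType) (n : nat)
    (t : n.-tuple (measurableTypeR R)) : 'rV[R]_n :=
  \row_i tnth t i.

Definition enorm (R : realType) (n : nat) (v : 'rV[R]_n) : R :=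
  Num.sqrt (\sum_i v 0 i ^+ 2).

Definition cylinder (R : realType) (m k : nat) (x0 : 'rV[R]_m) (y0 : 'rV[R]_k)
    (rho delta : R) : set ('rV[R]_m * 'rV[R]_k) :=
  [set z | enorm (z.1 - x0) <= rho /\ enorm (z.2 - y0) <= delta].

Definition euclidean_integral (R : realType) (m k : nat)
    (D : set ('rV[R]_m * 'rV[R]_k)) (e : 'rV[R]_m * 'rV[R]_k -> R) : R :=
  let pt t := (row_of_tuple t.1, row_of_tuple t.2) in
  \int[(lebesgue_tuple R m \x lebesgue_tuple R k)%E]_(t in pt @^-1` D) e (pt t).

(* Main.v *)
From HB Require Import structures.
Require Import Defs.
From mathcomp Require Import all_boot all_order all_algebra.
From mathcomp Require Import all_classical all_reals all_analysis.
From mathcomp Require Import measurable_realfun lra ring.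
Import Order.TTheory GRing.Theory Num.Theory.
Import numFieldNormedType.Exports.
Local Open Scope classical_set_scope.
Local Open Scope ring_scope.
Set Implicit Arguments.
Unset Strict Implicit.
Unset Printing Implicit Defensive.

(** Locally [N] submerges onto the local leaf space of its foliation.  That the
    foliation is Riemannian means that [g_H] descends to a metric there, and in a
    flat chart this metric is the matrix field [transverse_metric].  The horizontal
    component of the horizontal tension of [f] is the tension along [R^m] of [f]
    followed by this submersion ([tension_pairing]): the term with [T*] cancels the
    contribution of the vertical part of [df] to the Levi-Civita connection, and the
    term with [W] is vertical.  So [f] is, on each slice [R^m x {y}], a harmonic map
    into the local leaf space, and the growth condition leads to a Liouville theorem.

    The local leaf spaces do not fit together into a manifold, but the pulled-back
    symmetric forms [a i j = g(dHH e_i, dHH e_j)] on [R^m x R^k] are globally defined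
    and smooth ([transverse_pullback]).  They are positive, their trace [e] is the
    energy density, and the stress-energy tensor [S = e / 2 - a] is divergence free
    in the directions of [R^m] ([stress_energy_conservation],
    [transverse_pullback_conservation]).  The rest of the vanishing proof only uses
    these facts.  Contract [S] with the position vector of [R^m]; the divergence of
    the result is [(m / 2 - 1) e].  Multiply by a radial weight, which is a truncated
    and regularized version of the fundamental solution [|x|^(2 - m)], and by a cutoff
    function of [y].  Integrating the divergence gives zero ([integral_compare]).
    Because the weight is radially decreasing and [a] is positive, what remains is
    a monotonicity inequality: the energy near any given point is at most a constant
    times [b^(2 - m)] times the energy of the cylinder of radius [b]
    ([energy_box_le]).  By assumption this bound tends to zero ([energy_vanishes]).

    Once [dHH] vanishes, the derivative of [f] along [R^m] is tangent to the leaves.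
    To get the leaf itself, cover [N] by countably many cubes in flat charts and link
    points by chains of plaques.  The set of points linked to [p0] is a manifold in
    the topology generated by the plaques, where second countability holds because
    chains can be followed through points with rational coordinates
    ([rational_walk_plaque]).  Any connected integral submanifold consists of linked
    points, so this set is a leaf ([linked_leaf]).  A curve tangent to the foliation
    stays locally in one plaque ([tangent_map_local]), so the image of a slice
    [R^m x {p}] consists of linked points as well ([horizontal_slice_linked]). *)

(** * Differentiability of matrix-valued maps *)

Section first_order.
Context {R : realType} {E : normedModType R}.

(** The difference of [f] and [g] vanishes near [x], so its differential there is
    zero. *)
Lemma differentiable_near_eq (F : normedModType R) (f g : E -> F) x :
  (\near x, f x = g x) -> differentiable f x -> differentiable g x.
Proof.
move=> fg df.
have z0 : (g \- f) \o shift x = cst ((g \- f) x) + \0 +o_ 0 id.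
  apply/eqaddoP => e e0; near=> h => /=.
  have -> : (((g \- f) \o shift x) - (cst ((g \- f) x) + \0)) h = 0.
    rewrite !fctE /= (nbhs_singleton fg) subrr addr0 subr0.
    suff -> : f (h + x) = g (h + x) by rewrite subrr.
    by near: h; move: fg; rewrite (near_shift 0 x)/= subr0.
  by rewrite normr0 mulr_ge0// ltW.
have dk : differentiable (g \- f) x.
  apply/diff_locallyP.
  rewrite (@diff_unique _ _ _ _ (\0 : {linear E -> F}) x _ z0)//=.
  + by split => //; exact: cst_continuous.
  + exact: cst_continuous.
rewrite (_ : g = f + (g \- f)); first exact: differentiableD.
by apply/funext => y; rewrite !fctE addrC subrK.
Unshelve. all: by end_near. Qed.

Lemma derive_comp (F G : normedModType R) (h : E -> F) (g : F -> G) x v :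
  differentiable h x -> differentiable g (h x) ->
  'D_v (g \o h) x = 'D_('D_v h x) g (h x).
Proof.
move=> dh dg; rewrite !deriveE//; last exact: differentiable_comp.
by rewrite diff_comp.
Qed.

Lemma derive_linear (F : normedModType R) (f : E -> F) x (a b : E) (k : R) :
  differentiable f x -> 'D_(k *: a + b) f x = k *: 'D_a f x + 'D_b f x.
Proof. by move=> df; rewrite !deriveE// linearP. Qed.

Lemma derive_sum_dir (F : normedModType R) (f : E -> F) x (I : Type) (s : seq I)
    (P : pred I) (a : I -> R) (v : I -> E) :
  differentiable f x ->
  'D_(\sum_(i <- s | P i) a i *: v i) f x =
    \sum_(i <- s | P i) a i *: 'D_(v i) f x.
Proof.
move=> df; rewrite deriveE// linear_sum; apply: eq_bigr => i _.
by rewrite linearZ/= deriveE.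
Qed.

Section matrix_valued.
Context {m n : nat}.
Implicit Types M : E -> 'M[R]_(m, n).

Lemma differentiable_mx M x :
  (forall i j, differentiable (fun y => M y i j) x) -> differentiable M x.
Proof.
move=> dM.
have -> : M = \sum_i \sum_j (fun y => M y i j *: delta_mx i j).
  apply/funext => y; rewrite {1}(matrix_sum_delta (M y)) fct_sumE.
  by apply: eq_bigr => i _; rewrite fct_sumE.
apply: differentiable_sum => i; apply: differentiable_sum => j.
exact: differentiableZl.
Qed.

Lemma differentiable_entry M x i j :
  differentiable M x -> differentiable (fun y => M y i j) x.
Proof.
move=> dM; apply: (@differentiable_comp _ _ _ _ M (fun N => N i j)) => //.
exact: differentiable_coord.
Qed.

Lemma derive_entry M x v i j : differentiable M x ->
  ('D_v M x) i j = 'D_v (fun y => M y i j) x.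
Proof. by move=> /diff_derivable dM; rewrite derive_mx// mxE. Qed.

End matrix_valued.

Lemma differentiable_mulmx m n p (A : E -> 'M[R]_(m, n)) (B : E -> 'M[R]_(n, p)) x :
  differentiable A x -> differentiable B x ->
  differentiable (fun y => A y *m B y) x.
Proof.
move=> dA dB; apply: differentiable_mx => i j.
rewrite (_ : (fun _ => _) =
    \sum_k ((fun y => A y i k) * (fun y => B y k j))); last first.
  by apply/funext => y; rewrite mxE fct_sumE.
by apply: differentiable_sum => k; apply: differentiableM;
   exact: differentiable_entry.
Qed.

Lemma derive_mulmx m n p (A : E -> 'M[R]_(m, n)) (B : E -> 'M[R]_(n, p)) x v :
  differentiable A x -> differentiable B x ->
  'D_v (fun y => A y *m B y) x = 'D_v A x *m B x + A x *m 'D_v B x.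
Proof.
move=> dA dB; apply/matrixP => i j.
rewrite derive_entry; last exact: differentiable_mulmx.
rewrite (_ : (fun _ => _) =
    \sum_k ((fun y => A y i k) * (fun y => B y k j))); last first.
  by apply/funext => y; rewrite mxE fct_sumE.
rewrite derive_sum; last first.
  move=> k; apply: diff_derivable.
  by apply: differentiableM; exact: differentiable_entry.
rewrite !mxE -big_split; apply: eq_bigr => k _ /=.
have dAk := differentiable_entry i k dA; have dBk := differentiable_entry k j dB.
have pA : derivable (fun y => A y i k) x v by exact: diff_derivable.
have pB : derivable (fun y => B y k j) x v by exact: diff_derivable.
rewrite (deriveM pA pB).
rewrite (derive_entry v i k dA) (derive_entry v k j dB) addrC; congr (_ + _).
exact: mulrC.
Qed.

Lemma differentiable_trmx m n (A : E -> 'M[R]_(m, n)) x :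
  differentiable A x -> differentiable (fun y => (A y)^T) x.
Proof.
move=> dA; apply: differentiable_mx => i j.
rewrite (_ : (fun _ => _) = (fun y => A y j i)); first exact: differentiable_entry.
by apply/funext => y; rewrite mxE.
Qed.

Lemma derive_trmx m n (A : E -> 'M[R]_(m, n)) x v :
  differentiable A x -> 'D_v (fun y => (A y)^T) x = ('D_v A x)^T.
Proof.
move=> dA; apply/matrixP => i j; rewrite derive_entry; last exact: differentiable_trmx.
rewrite mxE derive_entry//; congr ('D_v _ x).
by apply/funext => y; rewrite mxE.
Qed.

End first_order.

Lemma derive_row_dir (R : realType) (F : normedModType R) n
    (g : 'rV[R]_n -> F) x v :
  differentiable g x ->
  'D_v g x = \sum_k v 0 k *: 'D_(delta_mx 0 k) g x.
Proof. by move=> dg; rewrite -(derive_sum_dir _ _ (v 0)) -?row_sum_delta. Qed.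

(** * Closure properties of smooth maps *)

Section smooth_calculus.
Context {R : realType} {E : normedModType R}.
Implicit Types U : set E.

Lemma ndiff_sub (F : normedModType R) j U U' (h : E -> F) :
  U' `<=` U -> ndifferentiable_on j U h -> ndifferentiable_on j U' h.
Proof.
move=> UU'; elim: j h => //= j IH h [dh Dh]; split=> [x /UU'|v]; first exact: dh.
exact: IH.
Qed.

Lemma ndiff_local (F : normedModType R) j U (h : E -> F) :
  (forall x, U x -> exists2 U', U' x & ndifferentiable_on j U' h) ->
  ndifferentiable_on j U h.
Proof.
elim: j h => //= j IH h H; split=> [x Ux|v].
  by have [U' U'x [dh _]] := H x Ux; exact: dh.
by apply: IH => x /H [U' U'x [_ Dh]]; exists U'.
Qed.

(** Open sets matter: the derivatives of [h] and [h'] have to agree on [U] for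
    the induction to go on. *)
Lemma ndiff_ext (F : normedModType R) j U (h h' : E -> F) : open U ->
  {in U, h =1 h'} -> ndifferentiable_on j U h -> ndifferentiable_on j U h'.
Proof.
move=> oU; elim: j h h' => //= j IH h h' hh' [dh Dh].
have near_hh' x : U x -> \near x, h x = h' x.
  move=> Ux; near=> y; apply: hh'; rewrite inE.
  by near: y; exact: open_nbhs_nbhs.
split=> [x Ux|v].
  exact: differentiable_near_eq (near_hh' x Ux) (dh x Ux).
apply: (IH ('D_v h)) => // x; rewrite inE => Ux.
exact: near_eq_derive (near_hh' x Ux).
Unshelve. all: by end_near. Qed.

Lemma ndiffS (F : normedModType R) j U (h : E -> F) :
  ndifferentiable_on j.+1 U h -> ndifferentiable_on j U h.
Proof.
elim: j h => //= j IH h [dh Dh]; split=> // v.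
exact/IH/Dh.
Qed.

Lemma ndiff_cst (F : normedModType R) j U (a : F) :
  ndifferentiable_on j U (fun=> a).
Proof.
elim: j a => //= j IH a; split=> [x _|v]; first exact: differentiable_cst.
rewrite [X in ndifferentiable_on _ _ X](_ : _ = (fun=> 0)).
  exact: IH.
by apply/funext => x; rewrite derive_cst.
Qed.

Lemma ndiffD (F : normedModType R) j U (f g : E -> F) : open U ->
  ndifferentiable_on j U f -> ndifferentiable_on j U g ->
  ndifferentiable_on j U (fun x => f x + g x).
Proof.
move=> oU; elim: j f g => //= j IH f g [df Df] [dg Dg]; split=> [x Ux|v].
  by apply: differentiableD; [exact: df|exact: dg].
apply: (ndiff_ext oU) (IH _ _ (Df v) (Dg v)) => x; rewrite inE => Ux /=.
by rewrite -deriveD//; apply: diff_derivable; [exact: df|exact: dg].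
Qed.

Lemma ndiff_sum (F : normedModType R) j U (I : Type) (s : seq I) (P : pred I)
    (f : I -> E -> F) : open U ->
  (forall i, ndifferentiable_on j U (f i)) ->
  ndifferentiable_on j U (fun x => \sum_(i <- s | P i) f i x).
Proof.
move=> oU df; elim: s => [|i s IH].
  by under eq_fun do rewrite big_nil; exact: ndiff_cst.
under eq_fun do rewrite big_cons.
by case: (P i) => //; exact: ndiffD.
Qed.

Lemma ndiffM j U (f g : E -> R) : open U ->
  ndifferentiable_on j U f -> ndifferentiable_on j U g ->
  ndifferentiable_on j U (fun x => f x * g x).
Proof.
move=> oU; elim: j f g => //= j IH f g [df Df] [dg Dg]; split=> [x Ux|v].
  by apply: differentiableM; [exact: df|exact: dg].
have fj : ndifferentiable_on j U f by apply: ndiffS.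
have gj : ndifferentiable_on j U g by apply: ndiffS.
apply: (ndiff_ext oU) (ndiffD oU (IH _ _ fj (Dg v)) (IH _ _ gj (Df v))).
move=> x; rewrite inE => Ux /=.
by rewrite -deriveM//; apply: diff_derivable; [exact: df|exact: dg].
Qed.

Lemma ndiff_prod j U (I : Type) (s : seq I) (f : I -> E -> R) : open U ->
  (forall i, ndifferentiable_on j U (f i)) ->
  ndifferentiable_on j U (fun x => \prod_(i <- s) f i x).
Proof.
move=> oU df; elim: s => [|i s IH].
  by under eq_fun do rewrite big_nil; exact: ndiff_cst.
by under eq_fun do rewrite big_cons; exact: ndiffM.
Qed.

Lemma ndiffN j U (f : E -> R) : open U ->
  ndifferentiable_on j U f -> ndifferentiable_on j U (fun x => - f x).
Proof.
move=> oU df; under eq_fun do rewrite -mulN1r.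
by apply: ndiffM => //; exact: ndiff_cst.
Qed.

Lemma ndiffV j U (f : E -> R) : open U -> (forall x, U x -> f x != 0) ->
  ndifferentiable_on j U f -> ndifferentiable_on j U (fun x => (f x)^-1).
Proof.
move=> oU f0; elim: j f f0 => //= j IH f f0 [df Df]; split=> [x Ux|v].
  by apply: differentiableV; [exact: df|exact: f0].
have fj : ndifferentiable_on j U f by apply: ndiffS.
have fVj := IH f f0 fj.
apply: (ndiff_ext oU) (ndiffN oU (ndiffM oU (ndiffM oU fVj fVj) (Df v))).
move=> x; rewrite inE => Ux /=.
rewrite deriveV//; first by rewrite -[RHS]/(_ * _) mulNr -exprVn expr2.
  exact: f0.
exact/diff_derivable/df.
Qed.

Lemma ndiff_mx m n j U (M : E -> 'M[R]_(m, n)) : open U ->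
  (forall i k, ndifferentiable_on j U (fun x => M x i k)) ->
  ndifferentiable_on j U M.
Proof.
move=> oU; elim: j M => //= j IH M dM.
have dM1 x : U x -> differentiable M x.
  by move=> Ux; apply: differentiable_mx => i k; have [+ _] := dM i k; exact.
split=> // v; apply: IH => i k.
apply: (ndiff_ext oU) ((dM i k).2 v) => x; rewrite inE => Ux.
by rewrite derive_entry//; exact: dM1.
Qed.

Lemma ndiff_entry m n j U (M : E -> 'M[R]_(m, n)) i k : open U ->
  ndifferentiable_on j U M -> ndifferentiable_on j U (fun x => M x i k).
Proof.
move=> oU; elim: j M => //= j IH M [dM DM]; split=> [x Ux|v].
  exact/differentiable_entry/dM.
apply: (ndiff_ext oU) (IH _ (DM v)) => x; rewrite inE => Ux.
by rewrite derive_entry//; exact: dM.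
Qed.

End smooth_calculus.

Section smooth_composition.
Context {R : realType} {E : normedModType R} {n : nat}.

(** The induction runs over all maps at once: by the chain rule, the derivatives
   of [g \o h] are sums of products of those of [h] and of maps [g' \o h]. *)
Lemma ndiff_comp_scalar j (U : set E) (W : set 'rV[R]_n) (h : E -> 'rV[R]_n)
    (g : 'rV[R]_n -> R) : open U -> (forall x, U x -> W (h x)) ->
  ndifferentiable_on j U h -> ndifferentiable_on j W g ->
  ndifferentiable_on j U (g \o h).
Proof.
move=> oU UW; elim: j g => //= j IH g dh dg.
split=> [x Ux|v].
  apply: (@differentiable_comp _ _ _ _ h g); first exact: (proj1 dh).
  exact/(proj1 dg)/UW.
have hj := ndiffS (dh : ndifferentiable_on j.+1 U h).
have gk k := IH _ hj (dg.2 (delta_mx 0 k)).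
apply: (ndiff_ext oU) (ndiff_sum (index_enum 'I_n) predT oU (fun k =>
   ndiffM oU (ndiff_entry 0 k oU (dh.2 v)) (gk k))) => x; rewrite inE => Ux.
rewrite (derive_comp (g := g) v (dh.1 x Ux) (dg.1 _ (UW x Ux))).
by rewrite (derive_row_dir _ (dg.1 _ (UW x Ux))).
Qed.

Lemma ndiff_comp_mx p q j (U : set E) (W : set 'rV[R]_n) (h : E -> 'rV[R]_n)
    (g : 'rV[R]_n -> 'M[R]_(p, q)) : open U -> open W ->
  (forall x, U x -> W (h x)) ->
  ndifferentiable_on j U h -> ndifferentiable_on j W g ->
  ndifferentiable_on j U (g \o h).
Proof.
move=> oU oW UW dh dg; apply: ndiff_mx => // i k.
apply: (ndiff_comp_scalar (g := fun y => g y i k) oU UW dh).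
exact: ndiff_entry.
Qed.

End smooth_composition.

Section smooth_matrices.
Context {R : realType} {E : normedModType R}.
Implicit Types U : set E.

Lemma ndiff_mulmx m n p j U (A : E -> 'M[R]_(m, n)) (B : E -> 'M[R]_(n, p)) :
  open U -> ndifferentiable_on j U A -> ndifferentiable_on j U B ->
  ndifferentiable_on j U (fun x => A x *m B x).
Proof.
move=> oU dA dB; apply: ndiff_mx => // i k.
under eq_fun do rewrite mxE.
by apply: ndiff_sum => // l; apply: ndiffM => //; exact: ndiff_entry.
Qed.

Lemma ndiff_trmx m n j U (A : E -> 'M[R]_(m, n)) :
  open U -> ndifferentiable_on j U A ->
  ndifferentiable_on j U (fun x => (A x)^T).
Proof.
move=> oU dA; apply: ndiff_mx => // i k.
by under eq_fun do rewrite mxE; exact: ndiff_entry.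
Qed.

Lemma ndiff_det n j U (A : E -> 'M[R]_n) :
  open U -> ndifferentiable_on j U A ->
  ndifferentiable_on j U (fun x => \det (A x)).
Proof.
move=> oU dA; apply: ndiff_sum => // s; apply: ndiffM => //.
  exact: ndiff_cst.
by apply: ndiff_prod => // i; exact: ndiff_entry.
Qed.

(** By Cramer's formula. *)
Lemma ndiff_invmx n j U (A : E -> 'M[R]_n) : open U ->
  (forall x, U x -> A x \in unitmx) -> ndifferentiable_on j U A ->
  ndifferentiable_on j U (fun x => invmx (A x)).
Proof.
move=> oU uA dA; apply: ndiff_mx => // i k.
apply: (@ndiff_ext _ _ _ _ _
  (fun x => (\det (A x))^-1 * cofactor (A x) k i)) => //.
  by move=> x; rewrite inE => /uA Ax; rewrite /invmx Ax !mxE.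
apply: ndiffM => //.
  apply: ndiffV => //; last exact: ndiff_det.
  by move=> x /uA; rewrite unitmxE unitfE.
apply: ndiffM => //; first exact: ndiff_cst.
apply: ndiff_det => //; apply: ndiff_mx => // a b.
by under eq_fun do rewrite !mxE; exact: ndiff_entry.
Qed.

End smooth_matrices.

(** * Symmetry of second derivatives *)

Lemma close_through (R : realFieldType) (e a1 a2 b1 b2 : R) :
  b2 = b1 -> `|a1 - b1| < e / 2 -> `|a2 - b2| < e / 2 -> `|a1 - a2| <= e.
Proof.
move=> -> h1 h2; rewrite (le_trans (ler_distD b1 _ _))// [leRHS]splitr.
by rewrite lerD// ltW// distrC.
Qed.

Section mean_value.
Context {R : realType} {E : normedModType R}.
Implicit Types (x y v w : E).

Lemma is_derive_line (F : normedModType R) (f : E -> F) y v (t : R) :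
  differentiable f (y + t *: v) ->
  is_derive t 1 (fun s : R => f (y + s *: v)) ('D_v f (y + t *: v)).
Proof.
move=> df; pose l : R -> E := fun s => y + s *: v.
have dl : is_diff t l (fun s => s *: v).
  rewrite (_ : l = cst y + (fun s => s *: v)); last exact/funext.
  exact: (is_diff_eq (is_diffD (is_diff_cst y t) (is_diff_scalel t v)) (add0r _)).
have dfl : differentiable (f \o l) t.
  by apply: differentiable_comp => //; exact: df.
apply: DeriveDef; first exact/(@diff_derivable _ _ _ (f \o l)).
have dl' : differentiable l t by exact: ex_diff.
have df' : differentiable f (l t) by [].
have -> : 'D_1 (f \o l) t = 'd f (l t) ('d l t 1).
  by rewrite deriveE// (diff_comp dl' df').
by rewrite (@diff_val _ _ _ _ _ _ _ dl) scale1r deriveE.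
Qed.

Lemma MVT_line (f : E -> R) y v (s : R) : 0 <= s ->
  (forall t, 0 <= t <= s -> differentiable f (y + t *: v)) ->
  exists2 c, 0 <= c <= s & f (y + s *: v) - f y = s * 'D_v f (y + c *: v).
Proof.
move=> s0 df.
have [t||c] := @MVT_segment R (fun t => f (y + t *: v))
    (fun t => 'D_v f (y + t *: v)) 0 s s0.
- rewrite in_itv/= => /andP[t0 ts]; apply: is_derive_line; apply: df.
  by rewrite !ltW.
- apply: continuous_in_subspaceT => t; rewrite inE/= in_itv/= => /df dft.
  apply: differentiable_continuous; apply/derivable1_diffP.
  by have [] := is_derive_line dft.
rewrite in_itv/= => cs; rewrite scale0r addr0 subr0 => ->.
by exists c => //; rewrite mulrC.
Qed.

Lemma line_constant (f : E -> R) y v :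
  (forall t, 0 <= t <= 1 -> differentiable f (y + t *: v)) ->
  (forall t, 0 <= t <= 1 -> 'D_v f (y + t *: v) = 0) -> f (y + v) = f y.
Proof.
move=> df Df; have [c c01] := MVT_line ler01 df.
by rewrite scale1r Df// mulr0 => /subr0_eq.
Qed.

Lemma parallelogram_nbhs x v w (U : set E) : nbhs x U ->
  exists2 d : R, 0 < d &
    forall a b, 0 <= a <= d -> 0 <= b <= d -> U (x + a *: v + b *: w).
Proof.
move=> /nbhs_ballP[e/= e0 eU].
have n0 : 0 < `|v| + `|w| + 1 by rewrite ltr_pwDr// addr_ge0.
exists (e / (`|v| + `|w| + 1)) => [|a b /andP[a0 ad] /andP[b0 bd]].
  by rewrite divr_gt0.
apply: eU; rewrite -ball_normE/= -addrA opprD addNKr normrN.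
apply: (le_lt_trans (ler_normD _ _)); rewrite !normrZ !ger0_norm//.
apply: (@le_lt_trans _ _ (e / (`|v| + `|w| + 1) * (`|v| + `|w|))).
  by rewrite mulrDr lerD// ler_wpM2r.
by rewrite mulrAC ltr_pdivrMr// ltr_pM2l// ltrDl.
Qed.

(** The mean value theorem twice, in the direction [v] for the increment of [f]
    in the direction [w], then in the direction [w]. *)
Lemma second_difference (f : E -> R) x v w (U : set E) (d : R) : 0 < d ->
  (forall a b, 0 <= a <= d -> 0 <= b <= d -> U (x + a *: v + b *: w)) ->
  ndifferentiable_on 2 U f ->
  exists a b, [/\ 0 <= a <= d, 0 <= b <= d &
    f (x + d *: v + d *: w) - f (x + d *: v) - (f (x + d *: w) - f x) =
    d * (d * 'D_w ('D_v f) (x + a *: v + b *: w))].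
Proof.
move=> d0 dU [df Df].
have shiftd (y : E) : differentiable f (y + d *: w) ->
    is_diff y (fun z => f (z + d *: w)) ('d f (y + d *: w)).
  move=> dfy; have dh : is_diff y (fun z => z + d *: w) id.
    rewrite (_ : (fun _ => _) = id + cst (d *: w)); last exact/funext.
    exact: (is_diff_eq (is_diffD (is_diff_id y) (is_diff_cst _ y)) (addr0 _)).
  exact: (@is_diff_comp _ _ _ _ (fun z => z + d *: w) id f ('d f (y + d *: w)) y
    dh (differentiableP dfy)).
have dd : 0 <= d <= d by rewrite lexx ltW.
have Uv a : 0 <= a <= d -> U (x + a *: v).
  move=> ad; rewrite -[x + _]addr0 -(scale0r w).
  by apply: dU => //; rewrite lexx ltW.
pose g := (fun z => f (z + d *: w)) - f.
have dg a : 0 <= a <= d -> is_diff (x + a *: v) g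
    (('d f (x + a *: v + d *: w) : E -> R) - ('d f (x + a *: v) : E -> R)).
  move=> ad; have := shiftd (x + a *: v) (df _ (dU _ _ ad dd)).
  by move=> dfw; exact: is_diffB dfw (differentiableP (df _ (Uv _ ad))).
have [|a ad] := @MVT_line g x v d (ltW d0).
  by move=> a ad; have := dg a ad; case.
rewrite /g !fctE => eqg.
have [|b bd] := @MVT_line ('D_v f) (x + a *: v) w d (ltW d0).
  by move=> b bd; apply: (Df v).1; exact: dU.
move=> eqb; exists a, b; split=> //.
rewrite eqg; congr (d * _); rewrite -eqb.
have dga := dg a ad.
rewrite deriveE; last by case: dga.
rewrite (@diff_val _ _ _ _ _ _ _ dga) !fctE.
by rewrite !deriveE//; [exact/df/Uv|exact/df/dU].
Qed.

(** Both iterated derivatives are limits of the same second difference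
    quotient. *)
Lemma derive_sym (f : E -> R) (U : set E) x v w : open U -> U x ->
  ndifferentiable_on 3 U f -> 'D_v ('D_w f) x = 'D_w ('D_v f) x.
Proof.
move=> oU Ux df.
have df2 := ndiffS df.
have cont a b : {for x, continuous ('D_a ('D_b f))}.
  exact/differentiable_continuous/((df.2 b).2 a).1.
apply/eqP; rewrite -subr_eq0 -normr_le0; apply/ler_addgt0Pr => e e0.
have e2 : 0 < e / 2 by rewrite divr_gt0.
have /cvgrPdist_lt /(_ _ e2) n1 := cont v w.
have /cvgrPdist_lt /(_ _ e2) n2 := cont w v.
have nU := open_nbhs_nbhs (conj oU Ux).
have [d d0 dP] := parallelogram_nbhs v w (filterI nU (filterI n1 n2)).
have [|a [b [ad bd E1]]] := @second_difference f x v w U d d0 _ df2.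
  by move=> a b /dP + /[dup] bd => /(_ _ bd)[].
have [|a' [b' [ad' bd' E2]]] := @second_difference f x w v U d d0 _ df2.
  by move=> a' b' ? ?; rewrite addrAC; have [] := dP b' a'.
have E3 : 'D_w ('D_v f) (x + a *: v + b *: w) =
          'D_v ('D_w f) (x + a' *: w + b' *: v).
  have d0' : d != 0 by rewrite gt_eqF.
  have E12 : f (x + d *: v + d *: w) - f (x + d *: v) - (f (x + d *: w) - f x) =
     f (x + d *: w + d *: v) - f (x + d *: w) - (f (x + d *: v) - f x).
    by rewrite [x + d *: w + _]addrAC; ring.
  by have /(mulfI d0') /(mulfI d0') := etrans (esym E1) (etrans E12 E2).
have [_ [_ /= k2]] := dP a b ad bd.
have [_ [/= k1 _]] := dP b' a' bd' ad'.
rewrite addrAC in k1; rewrite add0r.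
exact: close_through E3 k1 k2.
Qed.

Lemma derive_sym_mx m n (f : E -> 'M[R]_(m, n)) (U : set E) x v w :
  open U -> U x -> ndifferentiable_on 3 U f ->
  'D_v ('D_w f) x = 'D_w ('D_v f) x.
Proof.
move=> oU Ux df; apply/matrixP => i j.
have E1 a b : ('D_a ('D_b f) x) i j = 'D_a ('D_b (fun y => f y i j)) x.
  rewrite derive_entry; last exact: (df.2 b).1.
  apply: near_eq_derive; near=> y; rewrite derive_entry//; apply: df.1.
  by near: y; exact: open_nbhs_nbhs.
have S := derive_sym v w oU Ux (ndiff_entry i j oU df).
exact: etrans (E1 v w) (etrans S (esym (E1 w v))).
Unshelve. all: by end_near. Qed.

End mean_value.

(** * Bilinear forms given by matrices *)

Section bilinear_forms.
Context {R : comNzRingType} {n : nat}.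
Implicit Types (M : 'M[R]_n) (a b : 'rV[R]_n).

Definition bform M a b : R := (a *m M *m b^T) 0 0.

Lemma bformDl M a a' b : bform M (a + a') b = bform M a b + bform M a' b.
Proof. by rewrite /bform !mulmxDl mxE. Qed.

Lemma bformDr M a b b' : bform M a (b + b') = bform M a b + bform M a b'.
Proof. by rewrite /bform linearD mulmxDr mxE. Qed.

Lemma bformZl M k a b : bform M (k *: a) b = k * bform M a b.
Proof. by rewrite /bform -!scalemxAl mxE. Qed.

Lemma bformZr M k a b : bform M a (k *: b) = k * bform M a b.
Proof. by rewrite /bform linearZ -scalemxAr mxE. Qed.

Lemma bformDm M M' a b : bform (M + M') a b = bform M a b + bform M' a b.
Proof. by rewrite /bform mulmxDr mulmxDl mxE. Qed.

Lemma bformZm k M a b : bform (k *: M) a b = k * bform M a b.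
Proof. by rewrite /bform -scalemxAr -scalemxAl mxE. Qed.

Lemma bform0m a b : bform 0 a b = 0.
Proof. by rewrite /bform mulmx0 mul0mx mxE. Qed.

Lemma bform0l M b : bform M 0 b = 0.
Proof. by rewrite /bform !mul0mx mxE. Qed.

Lemma bform0r M a : bform M a 0 = 0.
Proof. by rewrite /bform trmx0 mulmx0 mxE. Qed.

Lemma bformNl M a b : bform M (- a) b = - bform M a b.
Proof. by rewrite /bform !mulNmx mxE. Qed.

Lemma bform_suml M (I : Type) (s : seq I) (P : pred I) (a : I -> 'rV[R]_n) b :
  bform M (\sum_(i <- s | P i) a i) b = \sum_(i <- s | P i) bform M (a i) b.
Proof. by rewrite /bform !mulmx_suml summxE. Qed.

Lemma bform_mull M N a b : bform (N *m M) a b = bform M (a *m N) b.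
Proof. by rewrite /bform !mulmxA. Qed.

Lemma bform_mulr M N a b : bform (M *m N^T) a b = bform M a (b *m N).
Proof. by rewrite /bform trmx_mul !mulmxA. Qed.

Lemma bform_sym M a b : M^T = M -> bform M a b = bform M b a.
Proof.
move=> sM; rewrite /bform.
have -> : a *m M *m b^T = (b *m M *m a^T)^T by rewrite !trmx_mul trmxK sM mulmxA.
by rewrite mxE.
Qed.

Lemma bform_ext M M' : (forall a b, bform M a b = bform M' a b) -> M = M'.
Proof.
move=> MM'; apply/matrixP => i j; have := MM' (delta_mx 0 i) (delta_mx 0 j).
by rewrite /bform -!rowE !trmx_delta -!colE !mxE.
Qed.

End bilinear_forms.

Lemma ipE (R : realType) n (G : 'rV[R]_n -> 'M[R]_n) u a b :
  ip G u a b = bform (G u) a b.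
Proof. by []. Qed.

(** * Orthogonal projections *)

Section projections.
Context {R : realType} {n : nat}.
Variables (G V : 'rV[R]_n -> 'M[R]_n) (u : 'rV[R]_n).
Hypothesis Gpos : forall v, v != 0 -> 0 < ip G u v v.
Hypothesis Gsym : (G u)^T = G u.

Lemma metric_unit : G u \in unitmx.
Proof.
rewrite -row_free_unit -kermx_eq0; apply/eqP/row_matrixP => i; rewrite row0.
apply/eqP/negP => /negP /Gpos; rewrite /ip.
have -> : row i (kermx (G u)) *m G u = 0 by apply/sub_kermxP; exact: row_sub.
by rewrite mul0mx mxE ltxx.
Qed.

(** Two candidates for the projection differ by a vector of the subspace that
    is orthogonal to the subspace, hence to itself. *)
Lemma projV_unique (Q : 'M[R]_n) : (forall a : 'rV_n, a *m Q <= V u)%MS ->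
  (forall a b : 'rV_n, (b <= V u)%MS -> ip G u (a *m Q) b = ip G u a b) ->
  Q = projV G V u.
Proof.
move=> QV Qo; apply/row_matrixP => i; rewrite !rowE.
set a := delta_mx 0 i; apply/eqP; rewrite -subr_eq0; apply/negP => /negP d0.
have := Gpos d0; set d := _ - _ => dpos.
have dV : (d <= V u)%MS by rewrite addmx_sub// ?eqmx_opp// projV_sub.
move: dpos; rewrite {1}/d ipE bformDl bformNl -!ipE Qo// (projV_orth a Gpos dV).
by rewrite subrr ltxx.
Qed.

Lemma basis_gram_unit r (B : 'M[R]_(r, n)) : row_free B ->
  B *m G u *m B^T \in unitmx.
Proof.
move=> Bfree; rewrite -row_free_unit -kermx_eq0; apply/eqP/row_matrixP => i.
rewrite row0; set v := row i _.
have vB : v *m (B *m G u *m B^T) = 0 by apply/sub_kermxP; exact: row_sub.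
have wB : v *m B = 0.
  apply/eqP/negP => /negP /Gpos.
  rewrite ipE /bform trmx_mul (_ : _ *m _ =
    v *m (B *m G u *m B^T) *m v^T); last by rewrite !mulmxA.
  by rewrite vB mul0mx mxE ltxx.
by apply: (row_free_inj Bfree); rewrite wB mul0mx.
Qed.

(** In a flat chart [B] can be taken constant, which makes the projections
    smooth. *)
Lemma projV_basis r (B : 'M[R]_(r, n)) : row_free B -> (B == V u)%MS ->
  projV G V u = G u *m B^T *m invmx (B *m G u *m B^T) *m B.
Proof.
move=> Bfree BV; have uB := basis_gram_unit Bfree.
apply/esym/projV_unique => [a|a b].
  by rewrite mulmxA (submx_trans (submxMl _ _))// (eqmxP BV).
rewrite -(eqmxP BV) => /submxP[c ->]; rewrite !ipE /bform trmx_mul.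
rewrite (_ : _ *m _ = a *m G u *m B^T *m
   (invmx (B *m G u *m B^T) *m (B *m G u *m B^T)) *m c^T); last by rewrite !mulmxA.
by rewrite mulVmx// mulmx1 !mulmxA.
Qed.

Lemma projV_idem : projV G V u *m projV G V u = projV G V u.
Proof. by apply/row_matrixP => i; rewrite row_mul projV_id// rowE projV_sub. Qed.

(** Both sides represent the form [(a, b) |-> g(pi a, pi b)]. *)
Lemma projV_selfadj : projV G V u *m G u = G u *m (projV G V u)^T.
Proof.
apply: bform_ext => a b; rewrite bform_mull bform_mulr.
have H x y : bform (G u) (x *m projV G V u) y =
    bform (G u) (x *m projV G V u) (y *m projV G V u).
  rewrite [LHS]bform_sym// [RHS]bform_sym//; apply/esym.
  exact/projV_orth/projV_sub.
by rewrite H bform_sym// -H bform_sym.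
Qed.

Lemma projH_idem : projH G V u *m projH G V u = projH G V u.
Proof.
by rewrite /projH mulmxBl mul1mx mulmxBr mulmx1 projV_idem subrr subr0.
Qed.

Lemma projH_selfadj : projH G V u *m G u = G u *m (projH G V u)^T.
Proof.
by rewrite /projH linearB/= trmx1 mulmxBl mulmxBr mul1mx mulmx1 projV_selfadj.
Qed.

Lemma projH_ker (a : 'rV_n) : (a *m projH G V u == 0) = (a <= V u)%MS.
Proof.
rewrite /projH mulmxBr mulmx1 subr_eq0; apply/eqP/idP => [->|].
  exact: projV_sub.
by move=> /(projV_id Gpos).
Qed.

Lemma ipH_sym_form a b :
  ipH G V u a b = bform (projH G V u *m G u) a b.
Proof.
by rewrite /ipH ipE -bform_mulr -projH_selfadj -bform_mull mulmxA projH_idem.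
Qed.

End projections.

(** * The tension field in a chart adapted to the foliation *)

(** Here [P] is the horizontal projection at a point, [K = P *m G] the transverse
    part of the metric, and [dG], [dP], [dK] are their derivatives at that point
    as functions of the direction.  With the derivatives abstracted, the
    computation is linear algebra. *)
Section tension_algebra.
Context {R : realType} {n : nat}.
Variables (G P : 'M[R]_n) (dG dP dK : 'rV[R]_n -> 'M[R]_n).
Implicit Types (x y v w : 'rV[R]_n).
Hypotheses (Gs : G^T = G) (dGs : forall x, (dG x)^T = dG x)
  (dGD : forall x y, dG (x + y) = dG x + dG y)
  (dKD : forall x y, dK (x + y) = dK x + dK y)
  (PP : P *m P = P) (PG : P *m G = G *m P^T)
  (dPP : forall x, dP x = dP x *m P + P *m dP x)
  (dK_l : forall x, dK x = dP x *m G + P *m dG x)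
  (dK_r : forall x, dK x = dG x *m P^T + G *m (dP x)^T)
  (dK_vert : forall v, v *m P = 0 -> dK v = 0)
  (vert_dK : forall v x, v *m P = 0 -> v *m dK x = 0).

(** Christoffel symbols of the first kind. *)
Definition gamma x y w : R :=
  2^-1 * (bform (dG x) y w + bform (dG y) x w - bform (dG w) x y).

Lemma dK_sym x : (dK x)^T = dK x.
Proof. by rewrite {2}dK_r dK_l linearD/= !trmx_mul dGs Gs addrC. Qed.

Lemma dK_vertr v x a : v *m P = 0 -> bform (dK x) a v = 0.
Proof.
by move=> /vert_dK vK; rewrite bform_sym ?dK_sym// /bform vK mul0mx mxE.
Qed.

Lemma dK_vertl v x a : v *m P = 0 -> bform (dK x) v a = 0.
Proof. by move=> /vert_dK vK; rewrite /bform vK mul0mx mxE. Qed.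

(** Differentiating [P *m P = P] shows that [dP] maps horizontal vectors to
    vertical ones. *)
Lemma dP_hor x a w : a *m P = a -> w *m P = w -> bform G (a *m dP x) w = 0.
Proof.
move=> aP wP; rewrite -wP -bform_mulr -PG bform_mull.
suff -> : a *m dP x *m P = 0 by rewrite bform0l.
have /eqP := dPP x; rewrite -subr_eq0 opprD addrA => /eqP E.
have := congr1 (mulmx a) (dPP x); rewrite mulmxDr !mulmxA aP => /eqP.
by rewrite -subr_eq0 opprD addrCA subrr addr0 oppr_eq0 => /eqP.
Qed.

(** [K] is the metric induced on the local leaf space.  Its Christoffel symbols
    appear once the last two terms, which come from [T*], absorb the vertical part
    of [X]. *)
Lemma tension_algebra X w : w *m P = w ->
  let a := X *m P in let v := X - a in
  bform G (X *m dP X) w + gamma X a w + bform G v (w *m dP a) + gamma a w v =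
  bform (dK X) X w - 2^-1 * bform (dK w) X X.
Proof.
move=> wP a v.
have aP : a *m P = a by rewrite /a -mulmxA PP.
have vP : v *m P = 0 by rewrite /v mulmxBl aP subrr.
have Xav : X = a + v by rewrite /v addrC subrK.
have aE : a = X *m P by [].
clearbody v a.
have sG x y z : bform (dG x) y z = bform (dG x) z y by exact: bform_sym.
have E1 : bform (dK X) X w = bform G (X *m dP X) w + bform (dG X) a w.
  by rewrite dK_l bformDm !bform_mull -aE.
have E2 : bform G v (w *m dP a) = - bform (dG a) v w.
  rewrite -bform_mulr; apply/eqP; rewrite -addr_eq0 addrC -[in bform _ v w]wP.
  rewrite -bform_mulr -bformDm -dK_r.
  by rewrite dK_vertl.
have E3 : bform (dG v) a w = 0.
  have : bform (dK v) a w = 0 by rewrite dK_vert// bform0m.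
  by rewrite dK_l bformDm !bform_mull aP dP_hor// add0r.
have E4 : bform (dG w) a a = bform (dK w) X X.
  rewrite Xav bformDl !bformDr !(dK_vertr _ _ vP) !(dK_vertl _ _ vP) !addr0.
  by rewrite dK_l bformDm !bform_mull aP dP_hor// add0r.
have E5 : bform (dG X) a w = bform (dG a) a w.
  by rewrite Xav dGD bformDm E3 addr0.
have E6 : gamma X a w = gamma a a w + gamma v a w.
  by rewrite /gamma Xav dGD !bformDm bformDl bformDl; field.
rewrite E6 E2 -E4 E1 E5 /gamma E3 (sG w v a) (sG a w v).
by field.
Qed.

End tension_algebra.

Section tension_in_chart.
Context {R : realType} {n : nat}.
Variables (G V : 'rV[R]_n -> 'M[R]_n) (U : set 'rV[R]_n).
Local Notation P := (projH G V).
Local Notation K u := (P u *m G u).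
Hypotheses (oU : open U)
  (Gpos : forall u v, U u -> v != 0 -> 0 < ip G u v v)
  (Gsym : forall u, U u -> (G u)^T = G u)
  (Gdiff : forall u, U u -> differentiable G u)
  (Pdiff : forall u, U u -> differentiable P u).

Lemma derive_form m' (E : normedModType R) (A : E -> 'M[R]_m') (x v : E) b c :
  differentiable A x -> 'D_v (fun y => bform (A y) b c) x = bform ('D_v A x) b c.
Proof.
move=> dA.
have cst_diff p q (a : 'M[R]_(p, q)) : differentiable (cst a : E -> _) x.
  exact: differentiable_cst.
have db := differentiable_mulmx (cst_diff _ _ b) dA.
have dbc := differentiable_mulmx db (cst_diff _ _ c^T).
rewrite /bform -(derive_entry v 0 0 dbc) (derive_mulmx v db (cst_diff _ _ c^T)).
rewrite (derive_mulmx v (cst_diff _ _ b) dA) !derive_cst.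
by rewrite mul0mx add0r mulmx0 addr0.
Qed.

Lemma christoffelE (D : 'rV[R]_n -> 'M[R]_n) u a b w : U u ->
  (forall x, 'D_x G u = D x) ->
  bform (G u) (christoffel G u a b) w = gamma D a b w.
Proof.
move=> Uu ED; have dG := Gdiff Uu.
have DE x y z : 'D_x (fun u' => ip G u' y z) u = bform (D x) y z.
  by rewrite -ED; exact: derive_form x y z dG.
have Dw : bform (D w) a b = \sum_j w 0 j * bform (D (delta_mx 0 j)) a b.
  rewrite -(ED w) (derive_row_dir w dG) /bform mulmx_sumr mulmx_suml summxE.
  by apply: eq_bigr => j _; rewrite -scalemxAr -scalemxAl mxE (ED (delta_mx 0 j)).
have -> : christoffel G u a b = (\row_l (2^-1 * (bform (D a) b (delta_mx 0 l)
    + bform (D b) a (delta_mx 0 l) - bform (D (delta_mx 0 l)) a b))) *m invmx (G u).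
  congr (_ *m _); apply/rowP => l; rewrite !mxE.
  congr (_ * _); congr (_ - _); last exact: DE.
  by congr (_ + _); exact: DE.
rewrite {1}/bform mulmxKV; last by apply: metric_unit => // v; exact: Gpos.
have formr M c : bform M c w = \sum_j w 0 j * bform M c (delta_mx 0 j).
  rewrite {1}(row_sum_delta w) /bform linear_sum mulmx_sumr summxE.
  by apply: eq_bigr => j _; rewrite linearZ/= -scalemxAr mxE.
rewrite /gamma (formr (D a)) (formr (D b)) Dw.
rewrite -big_split/= -sumrB mulr_sumr mxE; apply: eq_bigr => j _.
rewrite !mxE; move: (bform _ a b) (bform _ _ _) (bform _ _ _) (w 0 j) => c1 c2 c3 c4.
by ring.
Qed.

End tension_in_chart.

Lemma scalar_linear_sum (R : comNzRingType) n (f : 'rV[R]_n -> R) w :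
  (forall k a b, f (k *: a + b) = k * f a + f b) ->
  f w = \sum_j w 0 j * f (delta_mx 0 j).
Proof.
move=> fl; have f0 : f 0 = 0.
  by have := fl 1 0 0; rewrite scaler0 addr0 mul1r => /eqP;
    rewrite -subr_eq0 opprD addNKr oppr_eq0 => /eqP.
rewrite {1}(row_sum_delta w).
elim/big_rec2 : _ => [|j y x _ <-]; first exact: f0.
exact: fl.
Qed.

Lemma derive_form3 (R : realType) n (E : normedModType R) (A : E -> 'M[R]_n)
    (b c : E -> 'rV[R]_n) x v :
  differentiable A x -> differentiable b x -> differentiable c x ->
  'D_v (fun y => bform (A y) (b y) (c y)) x =
    bform ('D_v A x) (b x) (c x) + bform (A x) ('D_v b x) (c x)
    + bform (A x) (b x) ('D_v c x).
Proof.
move=> dA db dc.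
have dbA := differentiable_mulmx db dA.
have dct := differentiable_trmx dc.
have dall := differentiable_mulmx dbA dct.
rewrite /bform -(derive_entry v 0 0 dall) (derive_mulmx v dbA dct).
rewrite (derive_mulmx v db dA) (derive_trmx v dc) mulmxDl !mxE.
by rewrite [X in X + _ = _]addrC.
Qed.

Section flat_chart.
Context {R : realType} {n r : nat}.
Variables (G V : 'rV[R]_n -> 'M[R]_n) (U : set 'rV[R]_n) (W : 'M[R]_(r, n)).
Local Notation P := (projH G V).
(** The matrix of [g_H].  In a flat chart it depends on the transverse
    coordinates only, and is the metric of the local leaf space. *)
Definition transverse_metric u := P u *m G u.
Local Notation K := transverse_metric.
Hypotheses (oU : open U)
  (Gpos : forall u v, U u -> v != 0 -> 0 < ip G u v v)
  (Gsym : forall u, U u -> (G u)^T = G u)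
  (Gsmooth : smooth_on U G)
  (Wfree : row_free W) (VW : forall u, U u -> (V u == W)%MS).

Lemma projH_smooth : smooth_on U P.
Proof.
move=> j.
have E u : U u ->
    1%:M - G u *m W^T *m invmx (W *m G u *m W^T) *m W = P u.
  move=> Uu; congr (_ - _); apply/esym/projV_basis => // [v|].
    exact: Gpos.
  by have /andP[-> ->] := VW Uu.
have WGW u : U u -> W *m G u *m W^T \in unitmx.
  by move=> Uu; apply: basis_gram_unit => // v; exact: Gpos.
have cW p q (B : 'M[R]_(p, q)) : ndifferentiable_on j U (fun=> B).
  exact: ndiff_cst.
apply: (@ndiff_ext _ _ _ _ _
   (fun u => 1%:M + (G u *m W^T *m invmx (W *m G u *m W^T)) *m (- W))) => //.
  by move=> u; rewrite inE => /E <-; rewrite mulmxN.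
apply: ndiffD => //; do 2 apply: ndiff_mulmx => //.
  by apply: ndiff_mulmx => //; exact: Gsmooth.
apply: ndiff_invmx => //; do 2 apply: ndiff_mulmx => //.
Qed.

Lemma transverse_metric_smooth : smooth_on U K.
Proof.
by move=> j; apply: ndiff_mulmx => //; exact: projH_smooth.
Qed.

Let Gdiff u : U u -> differentiable G u.
Proof. by move=> Uu; exact: (proj1 (Gsmooth 1)). Qed.

Let Pdiff u : U u -> differentiable P u.
Proof. by move=> Uu; exact: (proj1 (projH_smooth 1)). Qed.

Let Kdiff u : U u -> differentiable K u.
Proof. by move=> Uu; exact: (proj1 (transverse_metric_smooth 1)). Qed.

Let PP u : U u -> P u *m P u = P u.
Proof. by move=> Uu; apply: projH_idem => // v; exact: Gpos. Qed.

Let PG u : U u -> P u *m G u = G u *m (P u)^T.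
Proof. by move=> Uu; apply: projH_selfadj; [move=> v; exact: Gpos|exact: Gsym]. Qed.

Lemma vertE u (v : 'rV[R]_n) : U u -> (v *m P u == 0) = (v <= W)%MS.
Proof.
move=> Uu; rewrite projH_ker; last by move=> w; exact: Gpos.
by rewrite (eqmxP (VW Uu)).
Qed.

Let nearU u : U u -> \near u, U u.
Proof. by move=> Uu; exact: open_nbhs_nbhs. Qed.

Lemma derive_metric_sym u x : U u -> ('D_x G u)^T = 'D_x G u.
Proof.
move=> Uu; rewrite -(derive_trmx x (Gdiff Uu)); apply: near_eq_derive.
by near=> y; apply: Gsym; near: y; exact: nearU.
Unshelve. all: by end_near. Qed.

Lemma derive_proj u x : U u ->
  'D_x P u = 'D_x P u *m P u + P u *m 'D_x P u.
Proof.
move=> Uu; rewrite -(derive_mulmx x (Pdiff Uu) (Pdiff Uu)).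
apply: near_eq_derive.
by near=> y; apply/esym/PP; near: y; exact: nearU.
Unshelve. all: by end_near. Qed.

Lemma derive_K_r u x : U u ->
  'D_x K u = 'D_x G u *m (P u)^T + G u *m ('D_x P u)^T.
Proof.
move=> Uu; have dPt := differentiable_trmx (Pdiff Uu).
rewrite -(derive_trmx x (Pdiff Uu)) -(derive_mulmx x (Gdiff Uu) dPt).
apply: near_eq_derive.
by near=> y; apply/PG; near: y; exact: nearU.
Unshelve. all: by end_near. Qed.

Lemma vert_derive_K u x (v : 'rV[R]_n) : U u -> (v <= W)%MS -> v *m 'D_x K u = 0.
Proof.
move=> Uu vW.
have cv : differentiable (cst v : 'rV[R]_n -> _) u by exact: differentiable_cst.
have := derive_mulmx x cv (Kdiff Uu); rewrite derive_cst mul0mx add0r => <-.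
rewrite -[RHS](derive_cst (0 : 'rV[R]_n) u x); apply: near_eq_derive.
near=> y; have Uy : U y by near: y; exact: nearU.
by rewrite /K mulmxA (_ : _ *m P y = 0) ?mul0mx//; apply/eqP; rewrite vertE.
Unshelve. all: by end_near. Qed.

Lemma derive_K_sym u x : U u -> ('D_x K u)^T = 'D_x K u.
Proof.
move=> Uu; rewrite -(derive_trmx x (Kdiff Uu)); apply: near_eq_derive.
near=> y; have Uy : U y by near: y; exact: nearU.
by rewrite {2}/transverse_metric PG// trmx_mul Gsym.
Unshelve. all: by end_near. Qed.

Hypothesis riem : forall F : 'rV[R]_n -> 'rV[R]_n, smooth_on U F ->
  (forall u, U u -> (F u <= V u)%MS) ->
  forall u a b, U u -> lie_ipH G V F u a b = 0.

(** Applied to the constant vertical fields of a flat chart, the condition on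
    Lie derivatives says that [K] does not vary along the leaves. *)
Lemma derive_K_vert u (v : 'rV[R]_n) : U u -> (v <= W)%MS -> 'D_v K u = 0.
Proof.
move=> Uu vW; apply: bform_ext => a b; rewrite bform0m.
have sv : smooth_on U (cst v : 'rV[R]_n -> 'rV[R]_n) by move=> j; exact: ndiff_cst.
have vV : forall u, U u -> ((cst v : 'rV[R]_n -> 'rV[R]_n) u <= V u)%MS.
  by move=> y Uy /=; rewrite (eqmxP (VW Uy)).
have ip0 y c : ipH G V y 0 c = 0 by rewrite /ipH ipE mul0mx bform0l.
have ip0r y c : ipH G V y c 0 = 0 by rewrite /ipH ipE mul0mx bform0r.
have := riem sv vV a b Uu; rewrite /lie_ipH !derive_cst ip0 ip0r !addr0.
move=> E; rewrite -(derive_form v a b (Kdiff Uu)) -[RHS]E.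
apply: near_eq_derive; near=> y.
have Uy : U y by near: y; exact: nearU.
by rewrite ipH_sym_form//; [move=> w; exact: Gpos|exact: Gsym].
Unshelve. all: by end_near. Qed.

(** By duality this is [g(v, T_a w)], which the Levi-Civita connection turns into
    a derivative of the projection and a Christoffel symbol. *)
Lemma tensorTadj_pairing u dG dP (w a v : 'rV[R]_n) : U u ->
  (forall x, 'D_x G u = dG x) -> (forall x, 'D_x P u = dP x) ->
  w *m P u = w -> a *m P u = a -> (v <= W)%MS ->
  bform (G u) (tensorTadj G V u a v) w =
    bform (G u) v (w *m dP a) + gamma dG a w v.
Proof.
move=> Uu ED EP wP aP vW.
have GE x y c := christoffelE Gpos Gdiff x y c Uu ED.
have sGu := Gsym Uu.
have dGs x : (dG x)^T = dG x by rewrite -ED; exact: derive_metric_sym.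
have dGD c x y : dG (c *: x + y) = c *: dG x + dG y.
  by have := derive_linear x y c (Gdiff Uu); rewrite !ED.
pose l c := bform (G u) v (c *m dP a) + gamma dG a (c *m P u) v.
have TE c : bform (G u) v (tensorT G V u a c) = l c.
  rewrite bform_sym// /tensorT -ipE (projV_orth _ (fun x => @Gpos u x Uu)); last first.
    by have /andP[_ WV] := VW Uu; exact: submx_trans vW WV.
  rewrite ipE /nabla bformDl GE aP /l bform_sym//; congr (bform _ _ _ + _).
  have cc : differentiable (cst c : 'rV[R]_n -> _) u by exact: differentiable_cst.
  by rewrite (derive_mulmx a cc (Pdiff Uu)) derive_cst mul0mx add0r EP.
have llin c x y : l (c *: x + y) = c * l x + l y.
  rewrite /l /gamma !mulmxDl -!scalemxAl !dGD !bformDr !bformDl !bformDm !bformZr.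
  rewrite !bformZl !bformZm.
  move: (bform (dG v) _ _) (bform (dG v) _ _) => e1 e2; move: (bform _ _ _) => e3.
  move: (bform _ _ _) (bform _ _ _) (bform _ _ _) => e4 e5 e6.
  by ring.
rewrite /tensorTadj {1}/bform mulmxKV; last by apply: metric_unit => x; exact: Gpos.
rewrite -[LHS]/(_ 0 0).
have -> : (v *m G u *m (lin1_mx (tensorT G V u a))^T *m w^T) 0 0 =
    bform (G u) v (w *m lin1_mx (tensorT G V u a)).
  by rewrite /bform trmx_mul !mulmxA.
rewrite mulmx_sum_row /bform linear_sum mulmx_sumr summxE.
transitivity (l w); last by rewrite /l wP.
rewrite (scalar_linear_sum w llin).
apply: eq_bigr => j _; rewrite linearZ/= -scalemxAr mxE -TE /bform; congr (_ * _).
by congr ((_ *m _^T) 0 0); apply/rowP => c; rewrite !mxE.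
Qed.

Section maps_into_chart.
Context {m k : nat}.
Local Notation E := ('rV[R]_m * 'rV[R]_k)%type.
Variables (h : E -> 'rV[R]_n) (D : set E) (z : E).
Hypotheses (oD : open D) (Dz : D z) (DU : forall y, D y -> U (h y))
  (hsmooth : smooth_on D h).
Local Notation u := (h z).
Local Notation X i := ('D_(hframe i) h z).
Local Notation Y i := ('D_(hframe i) ('D_(hframe i) h) z).

Let hdiff y : D y -> differentiable h y.
Proof. by move=> Dy; have [+ _] := hsmooth 1; exact. Qed.

Let dhdiff e y : D y -> differentiable ('D_e h) y.
Proof. by move=> Dy; have [_ /(_ e) [+ _]] := hsmooth 2; exact. Qed.

Let Uu : U u. Proof. exact: DU. Qed.

Lemma beta_horizontal i :
  betaHH G V h (cst (hframe i)) (cst (hframe i)) z =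
  Y i *m P u + X i *m 'D_(X i) P u + christoffel G u (X i) (X i *m P u).
Proof.
rewrite /betaHH derive_cst.
have -> : dHH G V h z 0 = 0.
  by rewrite /dHH (_ : pH 0 = 0)// derive0 mul0mx.
rewrite subr0 /pullback_nabla; congr (_ + _).
have dPh : differentiable (P \o h) z.
  by apply: (@differentiable_comp _ _ _ _ h P); [exact: hdiff|exact: Pdiff].
rewrite -(derive_comp (hframe i) (hdiff Dz) (Pdiff Uu)).
exact: derive_mulmx (hframe i) (dhdiff (hframe i) Dz) dPh.
Qed.

Section horizontal_pairing.
Variable w : 'rV[R]_n.
Hypothesis wP : w *m P u = w.

Lemma form_vert_hor a : bform (G u) (a *m projV G V u) w = 0.
Proof.
rewrite -wP -bform_mulr -PG// bform_mull -mulmxA.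
have -> : projV G V u *m P u = 0.
  by rewrite /projH mulmxBr mulmx1 projV_idem ?subrr// => v; exact: Gpos.
by rewrite mulmx0 bform0l.
Qed.

(** [dHH] vanishes on the vertical frame, at all points. *)
Lemma beta_vertical j :
  bform (G u) (betaHH G V h (cst (vframe j)) (cst (vframe j)) z) w = 0.
Proof.
have d0 y : dHH G V h y (vframe j) = 0.
  by rewrite /dHH (_ : pH _ = 0)// derive0 mul0mx.
have d00 : dHH G V h z 0 = 0 by rewrite /dHH (_ : pH 0 = 0)// derive0 mul0mx.
rewrite /betaHH derive_cst d00 subr0 /pullback_nabla.
have -> : (fun z' => dHH G V h z' (cst (vframe j) z')) = cst 0 by apply/funext.
rewrite derive_cst add0r.
rewrite (christoffelE Gpos Gdiff _ _ _ Uu (fun x => erefl ('D_x G u))).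
rewrite /gamma /cst d0 (derive0 G) !bform0m !(bform0l, bform0r).
by rewrite addr0 subr0 mulr0.
Qed.

Lemma vert_part i : X i *m projV G V u = X i - X i *m P u.
Proof. by rewrite /projH mulmxBr mulmx1 opprB addrC subrK. Qed.

(** Along horizontal vectors the tension is that of the composition of [h] with
    the projection to the local leaf space, whose metric is [K]. *)
Lemma tension_pairing i :
  bform (G u) (betaHH G V h (cst (hframe i)) (cst (hframe i)) z +
    (tensorTadj G V u (dHH G V h z (hframe i)) (dHV G V h z (hframe i))
     + tensorW G V u (dHH G V h z (hframe i)) (dHV G V h z (hframe i)))) w =
  bform (K u) (Y i) w + (bform ('D_(X i) K u) (X i) w
    - 2^-1 * bform ('D_w K u) (X i) (X i)).
Proof.
have [dG ED] : exists D, forall x, 'D_x G u = D x by exists (fun x => 'D_x G u).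
have [dP EP] : exists D, forall x, 'D_x P u = D x by exists (fun x => 'D_x P u).
have [dK EK] : exists D, forall x, 'D_x K u = D x by exists (fun x => 'D_x K u).
have sGu := Gsym Uu.
have dGs x : (dG x)^T = dG x by rewrite -ED; exact: derive_metric_sym.
have dGD x y : dG (x + y) = dG x + dG y.
  by have := derive_linear x y 1 (Gdiff Uu); rewrite !scale1r !ED.
have dPP x : dP x = dP x *m P u + P u *m dP x.
  by have := derive_proj x Uu; rewrite EP.
have dK_l x : dK x = dP x *m G u + P u *m dG x.
  by have := derive_mulmx x (Pdiff Uu) (Gdiff Uu); rewrite EP ED => <-; rewrite -EK.
have dK_r x : dK x = dG x *m (P u)^T + G u *m (dP x)^T.
  by have := derive_K_r x Uu; rewrite EK EP ED.
have vW (v : 'rV[R]_n) : v *m P u = 0 -> (v <= W)%MS.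
  by move=> v0; rewrite -(vertE _ Uu) v0 eqxx.
have dK_vert (v : 'rV[R]_n) : v *m P u = 0 -> dK v = 0.
  by move=> /vW vv; rewrite -EK; exact: derive_K_vert.
have vert_dK (v : 'rV[R]_n) x : v *m P u = 0 -> v *m dK x = 0.
  by move=> /vW vv; rewrite -EK; exact: vert_derive_K.
have T := tension_algebra sGu dGs dGD (PP Uu) (PG Uu) dPP dK_l dK_r dK_vert vert_dK.
have GE a b c := christoffelE Gpos Gdiff a b c Uu ED.
have Wpart a b : bform (G u) (tensorW G V u a b) w = 0.
  by rewrite /tensorW bformNl form_vert_hor oppr0.
have Tpart a v := @tensorTadj_pairing u dG dP w a v Uu ED EP wP.
rewrite beta_horizontal !EP EK (EK w) -(T (X i) w wP).
rewrite /dHH /dHV -![pH _]/(hframe i) vert_part !bformDl Wpart addr0.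
rewrite GE Tpart; first last.
- by rewrite -(vertE _ Uu) mulmxBl -mulmxA PP// subrr.
- by rewrite -mulmxA PP.
by rewrite /transverse_metric bform_mull bformDl !addrA.
Qed.

End horizontal_pairing.

Definition pullback_metric i j (y : E) : R :=
  bform (K (h y)) ('D_(hframe i) h y) ('D_(hframe j) h y).

Lemma derive_pullback_metric e i j :
  'D_e (pullback_metric i j) z =
    bform ('D_('D_e h z) K u) (X i) (X j)
    + bform (K u) ('D_e ('D_(hframe i) h) z) (X j)
    + bform (K u) (X i) ('D_e ('D_(hframe j) h) z).
Proof.
have dKh : differentiable (K \o h) z.
  by apply: (@differentiable_comp _ _ _ _ h K); [exact: hdiff|exact: Kdiff].
rewrite -(derive_comp e (hdiff Dz) (Kdiff Uu)).
exact: (derive_form3 e dKh (dhdiff _ Dz) (dhdiff _ Dz)).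
Qed.

(** This is the conservation law of the stress-energy tensor of harmonic maps: the
    terms with mixed second derivatives cancel, and what remains is the tension
    paired with the horizontal part of [X j]. *)
Lemma stress_energy_conservation j : horizontal_tension G V h z = 0 ->
  \sum_i 'D_(hframe i) (pullback_metric i j) z =
  2^-1 * \sum_i 'D_(hframe j) (pullback_metric i i) z.
Proof.
have combine (c1 c2 c3 c4 : R) :
    c3 + c1 + c2 - 2^-1 * (c4 + c2 + c2) = c1 + (c3 - 2^-1 * c4) by field.
move=> tension0; pose w := X j *m P u.
have wP : w *m P u = w by rewrite /w -mulmxA PP.
have vW : (X j - w <= W)%MS by rewrite -(vertE _ Uu) mulmxBl wP subrr.
have KX x : bform (K u) x (X j) = bform (K u) x w.
  by rewrite /transverse_metric PG// !bform_mulr wP.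
have dKX : 'D_(X j) K u = 'D_w K u.
  have -> : X j = 1 *: w + (X j - w) by rewrite scale1r addrC subrK.
  rewrite (derive_linear w (X j - w) 1 (Kdiff Uu)) (derive_K_vert Uu vW).
  by rewrite addr0 scale1r.
have dKr x a : bform ('D_x K u) a (X j) = bform ('D_x K u) a w.
  have -> : X j = w + (X j - w) by rewrite addrC subrK.
  rewrite bformDr; set v := _ - w.
  suff -> : bform ('D_x K u) a v = 0 by rewrite addr0.
  rewrite (bform_sym _ _ (derive_K_sym x Uu)) /bform.
  by rewrite (vert_derive_K x Uu vW) !mul0mx mxE.
pose Z i := 'D_(hframe i) ('D_(hframe j) h) z.
have sym i : 'D_(hframe j) ('D_(hframe i) h) z = Z i.
  exact: derive_sym_mx oD Dz (hsmooth 3).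
have pairing : \sum_i (bform (K u) (Y i) w + (bform ('D_(X i) K u) (X i) w
    - 2^-1 * bform ('D_w K u) (X i) (X i))) = 0.
  rewrite -(eq_bigr _ (fun i _ => tension_pairing wP i)) -bform_suml big_split/=.
  have := congr1 (fun t => bform (G u) t w) tension0.
  rewrite /horizontal_tension !bformDl bform0l => <-.
  suff -> : bform (G u) (\sum_(l < k)
      betaHH G V h (cst (vframe l)) (cst (vframe l)) z) w = 0 by rewrite addr0.
  by rewrite bform_suml big1// => l _; exact: beta_vertical.
apply/eqP; rewrite -subr_eq0 mulr_sumr -sumrB -[Z in _ == Z]pairing.
apply/eqP/eq_bigr => i _.
have sKu : (K u)^T = K u.
  by rewrite {2}/transverse_metric PG// trmx_mul Gsym.
have E1 := etrans (derive_pullback_metric (hframe i) i j)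
  (f_equal2 +%R (f_equal2 +%R (dKr (X i) (X i)) (KX (Y i)))
     (erefl (bform (K u) (X i) (Z i)))).
have E2 := etrans (derive_pullback_metric (hframe j) i i)
  (f_equal2 +%R (f_equal2 +%R (congr1 (fun M => bform M (X i) (X i)) dKX)
     (etrans (congr1 (fun t => bform (K u) t (X i)) (sym i))
        (bform_sym (Z i) (X i) sKu)))
     (congr1 (bform (K u) (X i)) (sym i))).
apply: (etrans (f_equal2 (fun p q => p - 2^-1 * q) E1 E2)).
exact: combine.
Qed.

End maps_into_chart.
End flat_chart.

(** * The pulled-back transverse metric *)

(** [J], an isometry that maps one subspace to the other, intertwines the
    orthogonal projections: the difference of the two sides takes values in the
    subspace and is orthogonal to it. *)
Lemma projV_change (R : realType) n (G V G' V' : 'rV[R]_n -> 'M[R]_n) u u'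
    (J : 'M[R]_n) :
  (forall v, v != 0 -> 0 < ip G u v v) ->
  (forall v, v != 0 -> 0 < ip G' u' v v) ->
  G u = J *m G' u' *m J^T -> (V u *m J == V' u')%MS ->
  projV G V u *m J = J *m projV G' V' u'.
Proof.
move=> Gpos Gpos' GJ /andP[VJ JV]; apply/row_matrixP => i; rewrite !rowE.
set a := delta_mx 0 i.
rewrite (mulmxA a (projV G V u)) (mulmxA a J).
have GG x y : bform (G' u') (x *m J) (y *m J) = bform (G u) x y.
  by rewrite GJ /bform trmx_mul !mulmxA.
apply/eqP; rewrite -subr_eq0; apply/negP => /negP d0.
have := Gpos' _ d0; set d := _ - _ => dpos.
have aV : (a *m projV G V u *m J <= V' u')%MS.
  by apply: submx_trans VJ; apply: submxMr; exact: projV_sub.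
have dV : (d <= V' u')%MS.
  by apply: addmx_sub => //; rewrite eqmx_opp; exact: projV_sub.
have [x dx] := submxP (submx_trans dV JV).
have dxJ : d = (x *m V u) *m J by rewrite dx mulmxA.
move: dpos; rewrite ipE {1}/d bformDl bformNl -!ipE (projV_orth _ Gpos')//.
rewrite !ipE dxJ !GG -!ipE projV_orth ?subrr ?ltxx//.
exact: submxMl.
Qed.

Lemma row_free_flat (R : fieldType) q r :
  row_free (row_mx (0 : 'M[R]_(r, q)) 1%:M).
Proof.
apply/row_freeP; exists (col_mx 0 1%:M).
by rewrite mul_row_col mul0mx mulmx1 add0r.
Qed.

Section pullback.
Context {R : realType} {m k q r : nat}.
Local Notation E := ('rV[R]_m * 'rV[R]_k)%type.
Variables (N : smooth_manifold R (q + r)) (g V : chart_field N) (f : E -> N).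
Hypotheses (g_metric : riemannian_metric g) (V_foliation : foliation V)
  (N_riemannian : riemannian_foliation g V)
  (f_smooth : smooth_to [set: E] f)
  (f_harmonic : horizontally_harmonic g V f).

Lemma metric_pos c u v : atlas c -> cimg c u -> v != 0 -> 0 < ip (g c) u v v.
Proof. by case: g_metric => _ _ + _; exact. Qed.

Lemma metric_sym c u : atlas c -> cimg c u -> (g c u)^T = g c u.
Proof. by case: g_metric => _ + _ _; exact. Qed.

Lemma open_preimage_dom (c : chart R N (q + r)) : atlas c -> open (f @^-1` cdom c).
Proof.
move=> /atlas_chart[oc _ _ _ _].
by apply: open_comp => // x _; case: f_smooth => + _; exact.
Qed.

Lemma smooth_coordinates (c : chart R N (q + r)) : atlas c ->
  smooth_on (f @^-1` cdom c) (cmap c \o f).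
Proof. by move=> ac; have := f_smooth.2 c ac; rewrite setTI. Qed.

Lemma cimg_coord (c : chart R N (q + r)) z : cdom c (f z) -> cimg c (cmap c (f z)).
Proof. by exists (f z). Qed.

Section change_of_chart.
Variables (c c' : chart R N (q + r)) (z : E).
Hypotheses (ac : atlas c) (ac' : atlas c') (cz : cdom c (f z)) (cz' : cdom c' (f z)).
Local Notation J := ('J (transition c c') (cmap c (f z))).

Let cz_inv : cinv c (cmap c (f z)) = f z.
Proof. by have [_ _ + _ _] := atlas_chart ac; exact. Qed.

Let ov : overlap c c' (cmap c (f z)).
Proof. by split; [exact: cimg_coord|rewrite /= cz_inv]. Qed.

Lemma transition_coord : transition c c' (cmap c (f z)) = cmap c' (f z).
Proof. by rewrite /transition/= cz_inv. Qed.

Lemma derive_change e :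
  'D_e (cmap c' \o f) z = 'D_e (cmap c \o f) z *m J.
Proof.
have dt : differentiable (transition c c') (cmap c (f z)).
  exact: (proj1 ((atlas_compatible ac ac').1 1)).
have dc : differentiable (cmap c \o f) z.
  exact: (proj1 (smooth_coordinates ac 1)).
rewrite -deriveEjacobian// -(derive_comp e dc dt); apply: near_eq_derive.
near=> y; rewrite /transition/=; congr cmap.
have [_ _ -> //] := atlas_chart ac.
near: y; apply: open_nbhs_nbhs; split; [exact: open_preimage_dom|exact: cz].
Unshelve. all: by end_near. Qed.

Lemma dHH_change X :
  dHH (g c') (V c') (cmap c' \o f) z X = dHH (g c) (V c) (cmap c \o f) z X *m J.
Proof.
rewrite /dHH derive_change -!mulmxA; congr (_ *m _).
rewrite /projH mulmxBl mulmxBr mul1mx mulmx1; congr (_ - _).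
apply/esym/projV_change.
- by move=> v; apply: metric_pos => //; exact: cimg_coord.
- by move=> v; apply: metric_pos => //; exact: cimg_coord.
- by case: g_metric => _ _ _ /(_ c c' _ ac ac' ov); rewrite transition_coord.
- by have := V_foliation.1.2 c c' _ ac ac' ov; rewrite transition_coord.
Qed.

Lemma ip_dHH_change X Y :
  ip (g c') (cmap c' (f z)) (dHH (g c') (V c') (cmap c' \o f) z X)
    (dHH (g c') (V c') (cmap c' \o f) z Y) =
  ip (g c) (cmap c (f z)) (dHH (g c) (V c) (cmap c \o f) z X)
    (dHH (g c) (V c) (cmap c \o f) z Y).
Proof.
rewrite !dHH_change.
case: g_metric => _ _ _ /(_ c c' _ ac ac' ov)/= GJ.
by rewrite /ip GJ transition_coord trmx_mul !mulmxA.
Qed.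

End change_of_chart.

(** Read in an arbitrary chart; by invariance a flat chart can be used for all
    its local properties. *)
Definition transverse_pullback i j (z : E) : R :=
  let c := chart_at (f z) in
  ip (g c) (cmap c (f z)) (dHH (g c) (V c) (cmap c \o f) z (hframe i))
    (dHH (g c) (V c) (cmap c \o f) z (hframe j)).

Lemma chart_atP (p : N) : atlas (chart_at p) /\ cdom (chart_at p) p.
Proof. exact: svalP (cid (atlas_cover p)). Qed.

Lemma transverse_pullback_chart c z i j : atlas c -> cdom c (f z) ->
  transverse_pullback i j z = pullback_metric (g c) (V c) (cmap c \o f) i j z.
Proof.
move=> ac cz; have [ac0 cz0] := chart_atP (f z).
rewrite /transverse_pullback (ip_dHH_change ac ac0 cz cz0).
rewrite /pullback_metric /transverse_metric -ipH_sym_form//.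
- by move=> v; apply: metric_pos => //; exact: cimg_coord.
- by apply: metric_sym => //; exact: cimg_coord.
Qed.

Lemma energy_densityE z : energy_density g V f z = \sum_i transverse_pullback i i z.
Proof. by []. Qed.

(** The double sum is the square of the norm of [\sum_i x i *: dHH e_i]. *)
Lemma transverse_pullback_ge0 (x : 'I_m -> R) z :
  0 <= \sum_i \sum_j x i * x j * transverse_pullback i j z.
Proof.
have [ac0 cz0] := chart_atP (f z); rewrite /transverse_pullback.
set c := chart_at _ in ac0 cz0 *; set d := dHH _ _ _ _.
rewrite (_ : \sum_i _ = ip (g c) (cmap c (f z)) (\sum_i x i *: d (hframe i))
    (\sum_i x i *: d (hframe i))).
  have [->|v0] := eqVneq (\sum_i x i *: d (hframe i)) 0; first by rewrite ipE bform0l.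
  by apply/ltW/metric_pos => //; exact: cimg_coord.
have sG : (g c (cmap c (f z)))^T = g c (cmap c (f z)).
  by apply: metric_sym => //; exact: cimg_coord.
rewrite ipE bform_suml; apply: eq_bigr => i _.
rewrite bformZl (bform_sym _ _ sG) bform_suml mulr_sumr; apply: eq_bigr => j _.
by rewrite bformZl -mulrA (bform_sym _ _ sG).
Qed.

Lemma flat_chart_at z : exists c,
  [/\ atlas c, cdom c (f z) & flat_chart V c].
Proof. by case: V_foliation => _ /(_ (f z)). Qed.

Lemma ndiff_bform j n (D : set E) (A : E -> 'M[R]_n) (a b : E -> 'rV[R]_n) :
  open D -> ndifferentiable_on j D A -> ndifferentiable_on j D a ->
  ndifferentiable_on j D b ->
  ndifferentiable_on j D (fun z => bform (A z) (a z) (b z)).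
Proof.
move=> oD dA da db; apply: (ndiff_entry 0 0 oD).
by apply: ndiff_mulmx => //; [exact: ndiff_mulmx|exact: ndiff_trmx].
Qed.

Lemma transverse_pullback_smooth i j :
  smooth_on [set: E] (transverse_pullback i j).
Proof.
move=> l; apply: ndiff_local => z _.
have [c [ac cz flat]] := flat_chart_at z.
have oD := open_preimage_dom ac.
have [_ oU _ _ _] := atlas_chart ac.
exists (f @^-1` cdom c) => //.
apply: (@ndiff_ext _ _ _ _ _ (pullback_metric (g c) (V c) (cmap c \o f) i j)) => //.
  by move=> y; rewrite inE => yD; rewrite (transverse_pullback_chart i j ac yD).
have hs := smooth_coordinates ac.
apply: ndiff_bform => //; [|exact: (hs l.+1).2|exact: (hs l.+1).2].
apply: (ndiff_comp_mx oD oU _ (hs l)); first by move=> y; exact: cimg_coord.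
apply: (transverse_metric_smooth oU _ _ (row_free_flat R q r) flat) => //.
- by move=> u v; exact: metric_pos.
- by case: g_metric => + _ _ _; exact.
Qed.

Lemma transverse_pullback_conservation j z :
  \sum_i 'D_(hframe i) (transverse_pullback i j) z =
  2^-1 * \sum_i 'D_(hframe j) (transverse_pullback i i) z.
Proof.
have [c [ac cz flat]] := flat_chart_at z.
have oD := open_preimage_dom ac.
have [_ oU _ _ _] := atlas_chart ac.
have E1 e i l : 'D_e (transverse_pullback i l) z =
    'D_e (pullback_metric (g c) (V c) (cmap c \o f) i l) z.
  apply: near_eq_derive; near=> y; apply: transverse_pullback_chart => //.
  by near: y; exact: open_nbhs_nbhs.
have S : \sum_i 'D_(hframe i) (pullback_metric (g c) (V c) (cmap c \o f) i j) z =
    2^-1 * \sum_i 'D_(hframe j) (pullback_metric (g c) (V c) (cmap c \o f) i i) z.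
  apply: (stress_energy_conservation (W := row_mx 0 1%:M) oU _ _ _
    (row_free_flat R q r) flat _ oD cz _ (smooth_coordinates ac)).
  - by move=> u v; exact: metric_pos.
  - by move=> u; exact: metric_sym.
  - by case: g_metric => + _ _ _; exact.
  - by move=> F sF FV u a b; exact: N_riemannian.
  - by move=> y; exact: cimg_coord.
  - exact: f_harmonic.
exact: (etrans (eq_bigr _ (fun i _ => E1 (hframe i) i j)) (etrans S
  (congr1 (fun s => 2^-1 * s)
     (esym (eq_bigr _ (fun i _ => E1 (hframe j) i i)))))).
Unshelve. all: by end_near. Qed.

Lemma dHH_eq0_of_energy :
  (forall z, energy_density g V f z = 0) -> dHH_eq0 g V f.
Proof.
move=> e0 z X c ac cz.
have p0 i : dHH (g c) (V c) (cmap c \o f) z (hframe i) = 0.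
  have tp0 l : transverse_pullback l l z = 0.
    have [ac0 cz0] := chart_atP (f z).
    have ge0 l' : true -> 0 <= transverse_pullback l' l' z.
      move=> _; rewrite /transverse_pullback; set d := dHH _ _ _ _ _.
      have [->|v0] := eqVneq d 0; first by rewrite ipE bform0l.
      by apply/ltW/metric_pos => //; exact: cimg_coord.
    have /eqP := e0 z; rewrite energy_densityE psumr_eq0// => /allP/(_ l).
    by rewrite mem_index_enum => /(_ isT)/eqP.
  apply/eqP/negP => /negP v0.
  have := metric_pos ac (cimg_coord cz) v0.
  have [ac0 cz0] := chart_atP (f z).
  by rewrite -(ip_dHH_change ac ac0 cz cz0) -[X in _ < X]/(transverse_pullback i i z) tp0 ltxx.
have -> : dHH (g c) (V c) (cmap c \o f) z X =
    \sum_i X.1 0 i *: dHH (g c) (V c) (cmap c \o f) z (hframe i).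
  rewrite /dHH.
  have dc : differentiable (cmap c \o f) z.
    exact: (proj1 (smooth_coordinates ac 1)).
  have -> : pH X = \sum_i X.1 0 i *: hframe i.
    rewrite /pH {1}(row_sum_delta X.1).
    rewrite (big_morph (fun v => (v, 0) : E) (id1 := 0) (op1 := +%R)) => [|x y|//].
      by apply: eq_bigr => i _; congr pair; rewrite scaler0.
    by congr pair; rewrite addr0.
  by rewrite derive_sum_dir// mulmx_suml; apply: eq_bigr => i _; rewrite -scalemxAl.
by rewrite big1// => i _; rewrite p0 scaler0.
Qed.

End pullback.

(** * Measurability of continuous functions and of boxes *)

Lemma rational_approx (R : realType) (x c : R) : 0 < c ->
  exists p : rat, `|x - ratr p| < c.
Proof.
move=> c0; have /rat_in_itvoo[p] : x - c < x + c.
  by rewrite ltrD2l (lt_trans _ c0)// oppr_lt0.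
rewrite in_itv/= => /andP[p1 p2]; exists p.
by rewrite ltr_distlC p1.
Qed.

Section rational_boxes.
Context {R : realType} {n k : nat}.
Local Notation E := ('rV[R]_n * 'rV[R]_k)%type.

Definition rational_box (i : 'rV[rat]_n * 'rV[rat]_k * nat) : set E :=
  [set z : E | (forall j, `|z.1 0 j - ratr (i.1.1 0 j)| < i.2.+1%:R^-1) /\
           (forall j, `|z.2 0 j - ratr (i.1.2 0 j)| < i.2.+1%:R^-1)].

Lemma rational_box_basis (U : set E) z : open U -> U z ->
  exists2 i, rational_box i z & rational_box i `<=` U.
Proof.
move=> oU Uz; have /nbhs_ballP[e/= e0 eU] : nbhs z U by exact: open_nbhs_nbhs.
have e2 : 0 < e / 2 by rewrite divr_gt0.
have [l le] : exists l : nat, l.+1%:R^-1 < e / 2.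
  by have [l _ /(_ l (leqnn l))/= le] := near_infty_natSinv_lt (PosNum e2); exists l.
have l0 : 0 < l.+1%:R^-1 :> R by rewrite invr_gt0.
have approx (x : R) : exists p : rat, `|x - ratr p| < l.+1%:R^-1.
  exact: rational_approx.
exists (\row_j sval (cid (approx (z.1 0 j))), \row_j sval (cid (approx (z.2 0 j))), l).
  by split=> j /=; rewrite mxE; case: cid.
move=> y [/= y1 y2]; apply: eU; split; split=> // i j; rewrite ord1 /ball/=.
  move: (y1 j); rewrite mxE; case: cid => p /= zp yp.
  rewrite (le_lt_trans (ler_distD (ratr p) _ _))// [ltRHS]splitr.
  by rewrite ltrD ?(lt_trans zp)// distrC (lt_trans yp).
move: (y2 j); rewrite mxE; case: cid => p /= zp yp.
rewrite (le_lt_trans (ler_distD (ratr p) _ _))// [ltRHS]splitr.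
by rewrite ltrD ?(lt_trans zp)// distrC (lt_trans yp).
Qed.

(** Open sets are countable unions of rational boxes, whose preimages only involve
    the coordinates of [p]. *)
Lemma measurable_continuous_coord d (T : measurableType d) (p : T -> E) (F : E -> R) :
  (forall j, measurable_fun setT (fun t => (p t).1 0 j)) ->
  (forall j, measurable_fun setT (fun t => (p t).2 0 j)) ->
  continuous F -> measurable_fun setT (F \o p).
Proof.
move=> m1 m2 cF.
have mbox i : measurable (p @^-1` rational_box i).
  have mball (h : T -> R) c (e : R) : measurable_fun setT h ->
      measurable (h @^-1` [set x | `|x - c| < e]).
    move=> mh; rewrite -[X in measurable X]setTI; apply: mh => //.
    rewrite (_ : [set x | _] = ball c e).
      by rewrite ball_itv; exact: measurable_itv.
    by apply/seteqP; split => x /=; rewrite /ball/= distrC.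
  rewrite (_ : p @^-1` _ =
    (\bigcap_(j in [set: 'I_n])
       ((fun t => (p t).1 0 j) @^-1` [set x | `|x - ratr (i.1.1 0 j)| < i.2.+1%:R^-1]))
    `&` (\bigcap_(j in [set: 'I_k])
       ((fun t => (p t).2 0 j) @^-1` [set x | `|x - ratr (i.1.2 0 j)| < i.2.+1%:R^-1]))).
    by apply: measurableI; apply: fin_bigcap_measurable => // j _; exact: mball.
  apply/seteqP; split=> t [h1 h2]; split=> j.
  - by move=> _; exact: h1.
  - by move=> _; exact: h2.
  - exact: h1.
  - exact: h2.
have mopen U : open U -> measurable (p @^-1` U).
  move=> oU; rewrite (_ : p @^-1` U = \bigcup_i
      (if `[< rational_box i `<=` U >] then p @^-1` rational_box i else set0)).
    apply: countable_bigcupT_measurable => // i.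
    by case: ifP => _; [exact: mbox|exact: measurable0].
  apply/seteqP; split=> [t Ut|t [i _]].
    have [i iz iU] := rational_box_basis oU Ut.
    by exists i => //; rewrite (asboolT iU).
  by case: ifPn => // /asboolP iU /iU.
move=> _; apply: (measurability _ (RGenOInfty.measurableE R)) => //.
move=> /= _ [_ [x ->] <-]; rewrite setTI; apply: (mopen (F @^-1` `]x, +oo[%classic)).
by apply: open_comp => [z _|]; [exact: cF|exact: interval_open].
Qed.

End rational_boxes.

Section tuples.
Context {R : realType}.
Local Notation T n := (n.-tuple (measurableTypeR R)).

Definition tuple_box n (c : 'I_n -> R) (e : R) : set (T n) :=
  [set t | forall i, c i - e <= tnth t i <= c i + e].

Lemma measurable_tuple_box n (c : 'I_n -> R) e : measurable (tuple_box c e).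
Proof.
rewrite (_ : tuple_box c e = \bigcap_(i in [set: 'I_n])
    ((@tnth n (measurableTypeR R))^~ i @^-1` `[c i - e, c i + e])).
  apply: fin_bigcap_measurable => // i _.
  by rewrite -[X in measurable X]setTI; apply: measurable_tnth.
apply/seteqP; split=> t tb i => [_|]; first by rewrite /= in_itv/= tb.
by have := tb i I; rewrite /= in_itv.
Qed.

Lemma lebesgue_tuple_box n (c : 'I_n -> R) e : 0 < e ->
  lebesgue_tuple R n (tuple_box c e) = (((e *+ 2) ^+ n)%:E).
Proof.
move=> e0; elim: n c => [|n IH] c /=.
  by rewrite diracE mem_set// => -[].
rewrite /cons_measure /pushforward.
rewrite (_ : _ @^-1` _ = `[c ord0 - e, c ord0 + e] `*` tuple_box (c \o lift ord0) e).
  rewrite product_measure1E//; last exact: measurable_tuple_box.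
  have L : lebesgue_measure `[c ord0 - e, c ord0 + e]%classic = (e *+ 2)%:E.
    rewrite lebesgue_measure_itv/= lte_fin ltrD2l gtrN// -EFinB.
    by congr (_%:E); rewrite mulr2n; ring.
  by rewrite IH exprS EFinM; congr (_ * _)%E; exact: L.
apply/seteqP; split=> [[x t] tb|[x t] [/= xb tb] i].
  split=> [|i] /=; first by have := tb ord0; rewrite in_itv.
  by have := tb (lift ord0 i); rewrite tnthS.
case: (unliftP ord0 i) => [j ->|->]; last by move: xb; rewrite in_itv.
by rewrite tnthS; exact: tb.
Qed.

End tuples.

(** * Integrals of derivatives with bounded support *)

Lemma entry_le_norm (R : realType) n (v : 'rV[R]_n) i : `|v 0 i| <= `|v|.
Proof.
rewrite [leRHS]/Num.Def.normr/= mx_normrE.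
exact: (le_bigmax _ (fun ij => `|v ij.1 ij.2|) (ord0, i)).
Qed.

Section bounded_support.
Context {R : realType}.

(** Balls of the sup norm are products of segments, hence compact. *)
Lemma bounded_of_support n k (F : 'rV[R]_n * 'rV[R]_k -> R) M : continuous F ->
  (forall z, M < `|z| -> F z = 0) -> exists C, forall z, `|F z| <= C.
Proof.
move=> cF F0; pose B l := [set v : 'rV[R]_l | forall i, `[- M, M]%classic (v ord0 i)].
have cB l : compact (B l).
  exact: (@rV_compact R l (fun=> `[- M, M]%classic) (fun=> @segment_compact _ _ _)).
have cFB : compact (F @` (B n `*` B k)).
  apply: continuous_compact; last exact: compact_setX.
  exact: continuous_subspaceT.
have [C [_ /(_ (`|C| + 1))]] := compact_bounded cFB.
move=> /(_ (ltr_pwDr ltr01 (ler_norm _))) FC.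
exists (`|C| + 1) => z; have [zM|/F0 ->] := leP `|z| M; last first.
  by rewrite normr0 addr_ge0.
apply: FC; exists z => //.
have entry l (v : 'rV[R]_l) : `|v| <= M -> B l v.
  by move=> vM i; rewrite /= in_itv/= -ler_norml (le_trans (entry_le_norm _ _)).
by move: zM; rewrite [X in X <= _]prod_normE ge_max => /andP[z1 z2]; split; exact: entry.
Qed.

Lemma integrable_supp d (T : measurableType d) (mu : {measure set T -> \bar R})
    (h : T -> R) A C : measurable A -> (mu A < +oo)%E -> measurable_fun setT h ->
  (forall t, `|h t| <= C) -> (forall t, ~ A t -> h t = 0) ->
  mu.-integrable setT (EFin \o h).
Proof.
move=> mA muA mh hC h0.
have -> : EFin \o h = (EFin \o h) \_ A.
  apply/funext => t; rewrite patchE; case: ifPn => //.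
  by rewrite notin_setE => /h0 /= ->.
apply: (proj1 (integrable_mkcond _ mA)); apply: measurable_bounded_integrable => //.
  exact: measurable_funTS.
exists C; split; first by rewrite num_real.
by move=> y Cy t _ /=; rewrite (le_trans (hC t))// ltW.
Qed.

Lemma integral_derive_line (phi dphi : R -> R) M :
  (forall x : R, is_derive x (1 : R) phi (dphi x)) -> continuous dphi ->
  (forall x : R, M < `|x| -> phi x = 0) -> (forall x : R, M < `|x| -> dphi x = 0) ->
  (\int[lebesgue_measure]_x (dphi x)%:E = 0)%E.
Proof.
move=> dp cdp p0 dp0; pose M' : R := `|M| + 1.
have MM' : M < M' by rewrite /M' ltr_pwDr// ler_norm.
have M'0 : 0 < M' by rewrite /M' ltr_pwDr.
have -> : (fun x => (dphi x)%:E) = (EFin \o dphi) \_ `[- M', M'].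
  apply/funext => x; rewrite patchE; case: ifPn => //.
  rewrite notin_setE /= in_itv/= -ler_norml => /negP; rewrite -ltNge => Mx.
  by rewrite dp0// (lt_trans MM').
have pM : phi M' = 0 by apply: p0; rewrite gtr0_norm.
have pNM : phi (- M') = 0 by apply: p0; rewrite normrN gtr0_norm.
rewrite -integral_mkcond (@continuous_FTC2 _ dphi phi).
- by rewrite pM pNM -EFinB subrr.
- by rewrite gtrN.
- exact: continuous_subspaceT.
- have cphi x : {for x, continuous phi}.
    by apply/differentiable_continuous/derivable1_diffP; have [] := dp x.
  split.
  + by move=> x _; have [] := dp x.
  + exact/cvg_at_right_filter/cphi.
  + exact/cvg_at_left_filter/cphi.
- by move=> x _; rewrite derive1E; have [] := dp x.
Qed.

End bounded_support.

Section row_cons.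
Context {R : realType} {n : nat}.

(** The counterpart of [tcons], through which [lebesgue_tuple] is defined, for the
    row vectors on which derivatives are taken. *)
Definition row_cons (x : R) (y : 'rV[R]_n) : 'rV[R]_n.+1 :=
  \row_i oapp (y 0) x (unlift ord0 i).

Lemma row_cons0 x y : row_cons x y 0 ord0 = x.
Proof. by rewrite mxE unlift_none. Qed.

Lemma row_consS x y j : row_cons x y 0 (lift ord0 j) = y 0 j.
Proof. by rewrite mxE liftK. Qed.

Lemma row_of_tcons (x : measurableTypeR R) (t : n.-tuple (measurableTypeR R)) :
  row_of_tuple (tcons (x, t)) = row_cons x (row_of_tuple t).
Proof.
apply/rowP => i; case: (unliftP ord0 i) => [j ->|->].
  by rewrite row_consS !mxE tnthS.
by rewrite row_cons0 mxE.
Qed.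

Lemma row_cons_shift0 h x y :
  row_cons (h *: (1 : R) + x) y = h *: delta_mx 0 ord0 + row_cons x y.
Proof.
apply/rowP => i; case: (unliftP ord0 i) => [j ->|->].
  rewrite !mxE liftK/=.
  by rewrite mulr0 add0r.
by rewrite !mxE unlift_none eqxx /GRing.scale/= mulr1.
Qed.

Lemma row_cons_shiftS h x y j :
  row_cons x (h *: delta_mx 0 j + y) = h *: delta_mx 0 (lift ord0 j) + row_cons x y.
Proof.
apply/rowP => i; case: (unliftP ord0 i) => [l ->|->].
  by rewrite !mxE liftK/= !mxE (inj_eq lift_inj).
by rewrite !mxE unlift_none/= mulr0 add0r.
Qed.

Lemma row_cons_norml x y : `|x| <= `|row_cons x y|.
Proof. by rewrite -{1}(row_cons0 x y) entry_le_norm. Qed.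

Lemma row_cons_normr x y : `|y| <= `|row_cons x y|.
Proof.
rewrite [leLHS]/Num.Def.normr/= mx_normrE (bigmax_le _ (normr_ge0 _))//= => -[i j] _.
by rewrite ord1 -(row_consS x y) entry_le_norm.
Qed.

Lemma row_cons_ball x y x' y' e : 0 < e -> ball x e x' -> ball y e y' ->
  ball (row_cons x y) e (row_cons x' y').
Proof.
move=> e0 xx' [_ yy']; split=> // i j; rewrite ord1.
by case: (unliftP ord0 j) => [l ->|->]; rewrite ?row_consS ?row_cons0.
Qed.

Lemma row_cons_continuousr x : continuous (row_cons x).
Proof.
move=> y A /nbhs_ballP[e/= e0 eA]; apply/nbhs_ballP; exists e => // y' yy'.
by apply: eA; apply: row_cons_ball => //; exact: ballxx.
Qed.

Lemma row_cons_continuousl y : continuous (row_cons^~ y).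
Proof.
move=> x A /nbhs_ballP[e/= e0 eA]; apply/nbhs_ballP; exists e => // x' xx'.
by apply: eA; apply: row_cons_ball => //; exact: ballxx.
Qed.

End row_cons.

(** The difference quotients on both sides coincide. *)
Lemma derive_comp_affine (R : realType) (E F G : normedModType R) (H : F -> G)
    (a : E -> F) v w x :
  (forall h : R, a (h *: v + x) = h *: w + a x) ->
  'D_v (H \o a) x = 'D_w H (a x) /\ (derivable H (a x) w -> derivable (H \o a) x v).
Proof.
move=> aE; have E1 : (fun h : R => h^-1 *: ((H \o a \o shift x) (h *: v) - (H \o a) x)) =
    (fun h : R => h^-1 *: ((H \o shift (a x)) (h *: w) - H (a x))).
  by apply/funext => h /=; rewrite aE.
by rewrite /derive /derivable E1.
Qed.

Lemma derive_outside (R : realType) (F G : normedModType R) (H : F -> G) M v x :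
  (forall x, M < `|x| -> H x = 0) -> M < `|x| -> 'D_v H x = 0.
Proof.
move=> H0 Mx; rewrite -(derive_cst (0 : G) x v); apply: near_eq_derive.
near=> y; rewrite H0//; near: y.
have cn : {for x, continuous (fun y : F => `|y|)} by exact: norm_continuous.
exact: (cvgr_gt _ cn _ Mx).
Unshelve. all: by end_near. Qed.

Section divergence.
Context {R : realType}.
Local Notation T n := (n.-tuple (measurableTypeR R)).

Lemma row_of_tuple_entry n (t : T n) i : row_of_tuple t 0 i = tnth t i.
Proof. by rewrite mxE. Qed.

Lemma measurable_row_fun n (F : 'rV[R]_n -> R) : continuous F ->
  measurable_fun setT (fun t : T n => F (row_of_tuple t)).
Proof.
move=> cF; pose p (t : T n) : 'rV[R]_n * 'rV[R]_0 := (row_of_tuple t, 0).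
have -> : (fun t : T n => F (row_of_tuple t)) = (F \o fst) \o p by [].
apply: measurable_continuous_coord => [j|[]//|].
  by rewrite /p/=; under eq_fun do rewrite mxE; exact: measurable_tnth.
by move=> z; apply: continuous_comp; [exact: cvg_fst|exact: cF].
Qed.

Lemma tuple_box_norm n (t : T n) M : 0 < M ->
  ~ tuple_box (fun=> 0) M t -> M < `|row_of_tuple t|.
Proof.
move=> M0 /existsNP[i]; rewrite sub0r add0r -ler_norml => /negP; rewrite -ltNge.
by move=> Mt; apply: lt_le_trans Mt _; rewrite -row_of_tuple_entry entry_le_norm.
Qed.

Lemma integrable_cons n (F : 'rV[R]_n.+1 -> R) M : continuous F ->
  (forall x, M < `|x| -> F x = 0) ->
  (@lebesgue_measure R \x lebesgue_tuple R n)%E.-integrable setT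
    (EFin \o (fun z : measurableTypeR R * T n => F (row_of_tuple (tcons z)))).
Proof.
move=> cF F0; pose M' : R := `|M| + 1.
have MM' : M < M' by rewrite /M' ltr_pwDr// ler_norm.
have M'0 : 0 < M' by rewrite /M' ltr_pwDr.
have [C FC] : exists C, forall z, `|F z| <= C.
  have [] := @bounded_of_support R n.+1 0 (F \o fst) M.
  - by move=> z; apply: continuous_comp; [exact: cvg_fst|exact: cF].
  - move=> [z1 z2] Mz; apply: F0; move: Mz; rewrite [X in _ < X]prod_normE/=.
    have -> : z2 = 0 by apply/rowP => -[].
    by rewrite normr0 max_l.
  - by move=> C FC; exists C => z; exact: (FC (z, 0)).
pose A : set (measurableTypeR R * T n) :=
  [set` `[- M', M']] `*` tuple_box (fun=> 0) M'.
apply: (@integrable_supp _ _ _ (@lebesgue_measure R \x lebesgue_tuple R n)%E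
  (fun z : measurableTypeR R * T n => F (row_of_tuple (tcons z))) A C).
- by apply: measurableX => //; exact: measurable_tuple_box.
- have E : (@lebesgue_measure R \x lebesgue_tuple R n)%E A =
      (lebesgue_measure [set` `[- M', M']%R] *
       lebesgue_tuple R n (tuple_box (fun=> 0%R) M'))%E.
    by apply: product_measure1E => //; exact: measurable_tuple_box.
  have L : (lebesgue_measure [set` `[- M', M']%R] * lebesgue_tuple R n
      (tuple_box (fun=> 0%R) M') < +oo)%E.
    rewrite lebesgue_tuple_box// lebesgue_measure_itv/=.
    by case: ifP => _; rewrite -?EFinB -?EFinM ?mul0e ltry.
  exact: (eq_ind_r (fun x => (x < +oo)%E) L E).
- apply: (measurableT_comp (measurable_row_fun cF)).
  exact: measurable_cons.
- by move=> t; exact: FC.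
- move=> [x t] nb; apply: F0; rewrite row_of_tcons (lt_trans MM')//.
  have [xM|xM] := leP `|x| M'; last exact: lt_le_trans xM (row_cons_norml _ _).
  apply: lt_le_trans (row_cons_normr _ _); apply: tuple_box_norm => // tb.
  by apply: nb; split => //=; rewrite in_itv/= -ler_norml.
Qed.

(** Fubini's theorem reduces this to the fundamental theorem of calculus along the
    axis [i]. *)
Lemma integral_derive0 n (H : 'rV[R]_n -> R) i M :
  (forall x, derivable H x (delta_mx 0 i)) -> continuous ('D_(delta_mx 0 i) H) ->
  (forall x, M < `|x| -> H x = 0) ->
  (\int[lebesgue_tuple R n]_t ('D_(delta_mx 0 i) H (row_of_tuple t))%:E = 0)%E.
Proof.
elim: n H i => [H []//|n IH] H i dH cH H0.
have dH0 x : M < `|x| -> 'D_(delta_mx 0 i) H x = 0 by exact: derive_outside.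
pose mu := (@lebesgue_measure R \x lebesgue_tuple R n)%E.
pose F z := ('D_(delta_mx 0 i) H (row_of_tuple (tcons z)))%:E.
have intF : mu.-integrable setT F by exact: integrable_cons cH dH0.
transitivity (\int[pushforward mu (@tcons _ _ n)]_(t in setT)
    ('D_(delta_mx 0 i) H (row_of_tuple t))%:E)%E; first by [].
rewrite integral_pushforward//; first last.
- by apply/measurable_EFinP; exact: measurable_row_fun cH.
- exact: measurable_cons.
case: (unliftP ord0 i) => [j ij|i0].
  rewrite -(integral12_prod_meas1 intF) /fubini_F.
  apply: integral0_eq => x _.
  have sh y := derive_comp_affine H (fun h => row_cons_shiftS h x y j).
  rewrite -[RHS](IH (H \o row_cons x) j).
  - apply: eq_integral => t _; rewrite /F row_of_tcons ij.
    by rewrite (sh (row_of_tuple t)).1.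
  - by move=> y; apply: (sh y).2; rewrite -ij.
  - have -> : 'D_(delta_mx 0 j) (H \o row_cons x) = 'D_(delta_mx 0 i) H \o row_cons x.
      by apply/funext => y; rewrite (sh y).1 ij.
    by move=> y; apply: (continuous_comp (@row_cons_continuousr _ _ x y)); exact: cH.
  - by move=> y My; apply: H0; exact: lt_le_trans My (row_cons_normr _ _).
rewrite -(integral21_prod_meas1 intF) /fubini_G.
apply: integral0_eq => t _; set y := row_of_tuple t.
have sh x := derive_comp_affine H (a := row_cons^~ y) (fun h => row_cons_shift0 h x y).
apply: etrans (integral_derive_line (phi := H \o row_cons^~ y)
   (dphi := 'D_(delta_mx 0 i) H \o row_cons^~ y) (M := M) _ _ _ _).
- by apply: eq_integral => x _; rewrite /F row_of_tcons.
- by move=> x; split; [apply: (sh x).2; rewrite -i0|rewrite (sh x).1 i0].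
- by move=> x; apply: (continuous_comp (@row_cons_continuousl _ _ y x)); exact: cH.
- by move=> x Mx; apply: H0; exact: lt_le_trans Mx (row_cons_norml _ _).
- by move=> x Mx; apply: dH0; exact: lt_le_trans Mx (row_cons_norml _ _).
Qed.

End divergence.

(** * A radial weight *)

Section positive_part_square.
Context {R : realType}.

Definition sqpos (t : R) : R := Num.max 0 t ^+ 2.

Lemma is_derive_sqpos (t : R) : is_derive t (1 : R) sqpos (2 * Num.max 0 t).
Proof.
have [t0|t0|->] := ltgtP t 0.
- have E : \near t, cst 0 t = sqpos t.
    near=> s; rewrite /sqpos max_l ?expr0n//=.
    by apply: ltW; near: s; exact: lt_nbhsl.
  by rewrite mulr0; exact: near_eq_is_derive E (is_derive_cst _ _ _).
- have E : \near t, (id * id : R -> R) t = sqpos t.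
    near=> s; rewrite /sqpos max_r ?expr2//.
    by apply: ltW; near: s; exact: lt_nbhsr.
  apply: near_eq_is_derive E _.
  apply: is_derive_eq (is_deriveM (is_derive_id t (1:R)) (is_derive_id t (1:R))) _.
  by rewrite /GRing.scale/= mulr1 mulr_natl mulr2n.
- rewrite mulr0.
  have C : h^-1 *: (sqpos (h *: 1 + 0) - sqpos 0) @[h --> (0:R)^'] --> (0:R).
    apply/cvgrPdist_le => e e0; near=> h.
    rewrite sub0r normrN /sqpos maxxx expr0n/= subr0 addr0 /GRing.scale/= mulr1.
    have h0 : h != 0 by near: h; exact: nbhs_dnbhs_neq.
    have he : `|h| <= e by near: h; apply: dnbhs0_le.
    have [hp|hn] := ltP 0 h; first by rewrite expr2 mulKf.
    by rewrite expr0n mulr0 normr0 ltW.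
  by apply: DeriveDef; [exact: cvgP C|exact: cvg_lim C].
Unshelve. all: by end_near. Qed.

End positive_part_square.

Section radial_weight.
Context {R : realType}.
Variables (p C : R).
Hypotheses (p0 : 0 < p) (C0 : 0 < C).

Definition decay (s : R) : R := expR (- p * ln (1 + s)).

(** For [p = m / 2 - 1] and [s = |x|^2], [decay] is a regularization at the origin
    of the fundamental solution [|x|^(2 - m)] of the Laplacian of [R^m].  This is
    a C^1 version of its truncation [max 0 (decay s - C)]. *)
Definition weight (s : R) : R := sqpos (decay s - C) / decay s.

Definition dweight (s : R) : R :=
  let v := Num.max 0 (decay s - C) in
  - p * (v * (2 * decay s - v)) / (decay s * (1 + s)).

Lemma decay_gt0 s : 0 < decay s.
Proof. exact: expR_gt0. Qed.

Lemma is_derive_decay (s : R) : 0 <= s -> is_derive s (1 : R) decay (- p * decay s / (1 + s)).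
Proof.
move=> s0; have s1 : 0 < 1 + s by rewrite ltr_pwDl.
have d1 : is_derive s (1:R) (fun s => 1 + s) 1.
  have := is_deriveD (is_derive_cst (1:R) s 1) (is_derive_id s (1:R)).
  by rewrite add0r.
have d2 : is_derive s (1:R) (fun s => ln (1 + s)) ((1 + s)^-1).
  have := @is_derive1_comp _ (@ln R) (fun s => 1 + s) s _ _ (is_derive1_ln s1) d1.
  by rewrite mulr1.
have d3 : is_derive s (1:R) (fun s => - p * ln (1 + s)) (- p * (1 + s)^-1).
  exact: is_deriveZ.
have := @is_derive1_comp _ (@expR R) (fun s => - p * ln (1 + s)) s _ _ (is_derive_expR _) d3.
by rewrite mulrCA mulrA.
Qed.

Lemma is_derive_weight (s : R) : 0 <= s -> is_derive s (1 : R) weight (dweight s).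
Proof.
move=> s0; have dd := is_derive_decay s0; have u0 := decay_gt0 s.
have s1 : 0 < 1 + s by rewrite ltr_pwDl.
have dB : is_derive s (1:R) (fun s => decay s - C) (- p * decay s / (1 + s)).
  by have := is_deriveB dd (is_derive_cst C s 1); rewrite subr0.
have dsq := @is_derive1_comp _ (@sqpos R) (fun s => decay s - C) s _ _
  (is_derive_sqpos _) dB.
have dV := is_deriveV (lt0r_neq0 u0) dd.
rewrite (_ : weight = (sqpos \o (fun s => decay s - C)) * (fun s => (decay s)^-1)) //.
apply: is_derive_eq (is_deriveM dsq dV) _.
rewrite /dweight /sqpos /GRing.scale/=; set v := Num.max 0 _.
by field; rewrite !gt_eqF.
Qed.

Lemma continuous_dweight (s : R) : 0 <= s -> {for s, continuous dweight}.
Proof.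
move=> s0; have s1 : 0 < 1 + s by rewrite ltr_pwDl.
have cd : {for s, continuous decay}.
  apply/differentiable_continuous/derivable1_diffP.
  by have [] := is_derive_decay s0.
have cv : {for s, continuous (fun s => Num.max 0 (decay s - C))}.
  by apply: continuous_max; [exact: cvg_cst|apply: cvgB => //; exact: cvg_cst].
have c1 : {for s, continuous (fun s : R => 1 + s)}.
  by apply: cvgD; [exact: cvg_cst|exact: cvg_id].
apply: cvgM.
  apply: cvgMr; apply: cvgM => //; apply: cvgB => //.
  exact: cvgMr.
apply: cvgV; first by rewrite mulf_neq0// gt_eqF// decay_gt0.
exact: cvgM.
Qed.

Lemma decay_nincr (s t : R) : 0 <= s -> s <= t -> decay t <= decay s.
Proof.
move=> s0 st; rewrite /decay ler_expR !mulNr lerN2 ler_pM2l// ler_ln ?posrE.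
- by rewrite lerD2l.
- by rewrite ltr_pwDl.
- by rewrite ltr_pwDl// (le_trans s0).
Qed.

Lemma weight_eq0 (s : R) : decay s <= C -> weight s = 0.
Proof.
by move=> uC; rewrite /weight /sqpos max_l ?subr_le0// expr0n mul0r.
Qed.

Lemma dweight_eq0 (s : R) : decay s <= C -> dweight s = 0.
Proof. by move=> uC; rewrite /dweight max_l ?subr_le0// mul0r mulr0 mul0r. Qed.

Lemma dweight_le0 (s : R) : 0 <= s -> dweight s <= 0.
Proof.
move=> s0; have s1 : 0 < 1 + s by rewrite ltr_pwDl.
have u0 := decay_gt0 s; rewrite /dweight.
set v := Num.max 0 _.
have v0 : 0 <= v by rewrite /v le_max lexx.
have vu : v <= decay s.
  by rewrite /v ge_max ltW//= lerBlDr lerDl ltW.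
have u2 : 0 <= 2 * decay s - v by lra.
rewrite !mulNr oppr_le0 mulr_ge0//; first by rewrite !mulr_ge0// ltW.
by rewrite invr_ge0 mulr_ge0// ltW.
Qed.

(** For [decay] in the place of [weight], the right-hand side would be
    [decay s / (1 + s)]; the truncation costs the two terms with [C]. *)
Lemma weight_supersolution (s : R) : 0 <= s -> C <= decay s ->
  (decay s - C ^+ 2 / decay s) / (1 + s) - 2 * C <=
    weight s + s * dweight s / p.
Proof.
move=> s0 uC; have s1 : 0 < 1 + s by rewrite ltr_pwDl.
have u0 := decay_gt0 s; rewrite /weight /dweight /sqpos max_r ?subr_ge0//.
move: (decay s) u0 uC => u u0 uC.
rewrite -subr_ge0 (_ : _ - _ = 2 * C ^+ 2 / u).
  by rewrite divr_ge0 ?mulr_ge0 ?sqr_ge0 ?ltW.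
by field; rewrite !gt_eqF.
Qed.

End radial_weight.

(** * Divergences on the product space *)

Section product_integrals.
Context {R : realType} {m k : nat}.
Local Notation E := ('rV[R]_m * 'rV[R]_k)%type.
Local Notation T n := (n.-tuple (measurableTypeR R)).
Local Notation mu := (lebesgue_tuple R m \x lebesgue_tuple R k)%E.

Definition pt_of (t : T m * T k) : E := (row_of_tuple t.1, row_of_tuple t.2).

Lemma measurable_pt_fun (F : E -> R) : continuous F ->
  measurable_fun setT (F \o pt_of).
Proof.
move=> cF; apply: measurable_continuous_coord => // j.
- rewrite /pt_of/=; under eq_fun do rewrite mxE.
  exact: (measurableT_comp (measurable_tnth j) measurable_fst).
- rewrite /pt_of/=; under eq_fun do rewrite mxE.
  exact: (measurableT_comp (measurable_tnth j) measurable_snd).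
Qed.

Definition pair_box (c : E) (e : R) : set (T m * T k) :=
  tuple_box (c.1 0) e `*` tuple_box (c.2 0) e.

Lemma measurable_pair_box c e : measurable (pair_box c e).
Proof. by apply: measurableX; exact: measurable_tuple_box. Qed.

Lemma pair_box_measure c e : 0 < e ->
  mu (pair_box c e) = ((e *+ 2) ^+ m * (e *+ 2) ^+ k)%:E.
Proof.
move=> e0; have E1 : mu (pair_box c e) = (lebesgue_tuple R m (tuple_box (c.1 0%R) e) *
    lebesgue_tuple R k (tuple_box (c.2 0%R) e))%E.
  by apply: product_measure1E => //; exact: measurable_tuple_box.
by apply: (etrans E1); rewrite !lebesgue_tuple_box// EFinM.
Qed.

Lemma pair_box_norm t M : 0 < M -> ~ pair_box 0 M t -> M < `|pt_of t|.
Proof.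
move=> M0 nb; rewrite [ltRHS]prod_normE lt_max.
have box0 n (s : T n) : ~ tuple_box ((0 : 'rV[R]_n) 0) M s -> M < `|row_of_tuple s|.
  have -> : (0 : 'rV[R]_n) 0 = (fun=> 0) by apply/funext => i; rewrite mxE.
  exact: tuple_box_norm.
have [b1|/box0 -> //] := pselect (tuple_box ((0 : 'rV[R]_m) 0) M t.1).
by rewrite [X in _ || X]box0 ?orbT// => b2; apply: nb; split.
Qed.

Lemma integrable_bounded_pt (h : T m * T k -> R) M C :
  measurable_fun setT h -> (forall t, `|h t| <= C) ->
  (forall t, M < `|pt_of t| -> h t = 0) -> mu.-integrable setT (EFin \o h).
Proof.
move=> mh hC h0; pose M' : R := `|M| + 1.
have MM' : M < M' by rewrite /M' ltr_pwDr// ler_norm.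
have M'0 : 0 < M' by rewrite /M' ltr_pwDr.
apply: (@integrable_supp _ _ _ mu h (pair_box 0 M') C) => //.
- exact: measurable_pair_box.
- have := pair_box_measure 0 M'0.
  by move=> E1; apply: (eq_ind_r (fun x => (x < +oo)%E) _ E1); rewrite ltry.
- by move=> t /(pair_box_norm M'0) M't; apply: h0; exact: lt_trans M't.
Qed.

Lemma integrable_pt (F : E -> R) M : continuous F ->
  (forall z, M < `|z| -> F z = 0) -> mu.-integrable setT (EFin \o (F \o pt_of)).
Proof.
move=> cF F0; have [C FC] := bounded_of_support cF F0.
apply: (@integrable_bounded_pt _ M C); first exact: measurable_pt_fun.
  by move=> t; exact: FC.
by move=> t; exact: F0.
Qed.

Lemma integral_derive_pt (F : E -> R) i M :
  (forall z, derivable F z (hframe i)) -> continuous ('D_(hframe i) F) ->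
  (forall z, M < `|z| -> F z = 0) ->
  (\int[mu]_t ('D_(hframe i) F (pt_of t))%:E = 0)%E.
Proof.
move=> dF cF F0.
have dF0 z : M < `|z| -> 'D_(hframe i) F z = 0 by exact: derive_outside.
have intF := integrable_pt cF dF0.
rewrite -[LHS](integral21_prod_meas1 intF) /fubini_G.
apply: integral0_eq => t2 _; set y := row_of_tuple t2.
have shE x (h : R) : (h *: delta_mx 0 i + x, y) = h *: hframe i + (x, y) :> E.
  transitivity (h *: delta_mx 0 i + x, h *: (0 : 'rV[R]_k) + y); last by [].
  by rewrite scaler0 add0r.
have sh x := @derive_comp_affine R _ _ _ F (fun x : 'rV[R]_m => (x, y)) _ _ x (shE x).
rewrite -[RHS](@integral_derive0 R m (F \o (fun x : 'rV[R]_m => (x, y))) i M).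
- apply: eq_integral => t1 _.
  by have [-> _] := sh (row_of_tuple t1).
- by move=> x; apply: (sh x).2.
- have -> : 'D_(delta_mx 0 i) (F \o (fun x : 'rV[R]_m => (x, y))) =
      'D_(hframe i) F \o (fun x => (x, y)).
    by apply/funext => x; have [-> _] := sh x.
  have cp : continuous (fun x : 'rV[R]_m => (x, y) : E).
    move=> x A /nbhs_ballP[e/= e0 eA]; apply/nbhs_ballP; exists e => // x' xx'.
    by apply: eA; split => //; exact: ballxx.
  by move=> x; apply: (continuous_comp (cp x)); exact: cF.
- move=> x Mx; apply: F0; apply: lt_le_trans Mx _.
  by rewrite [leRHS]prod_normE le_max lexx.
Qed.

(** The divergence integrates to zero.  The constant [kappa] on a box stands for a
    lower bound of a density: its integral is explicit. *)
Lemma integral_compare (F : 'I_m -> E -> R) (e : E -> R) (D : set E) c eps M kappa K :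
  0 < eps ->
  (forall i z, derivable (F i) z (hframe i)) ->
  (forall i, continuous ('D_(hframe i) (F i))) ->
  (forall i z, M < `|z| -> F i z = 0) ->
  continuous e -> measurable (pt_of @^-1` D) -> (forall z, D z -> `|z| <= M) ->
  (forall t, kappa * \1_(pair_box c eps) t <= \sum_i 'D_(hframe i) (F i) (pt_of t)
      + K * ((e \o pt_of) \_ (pt_of @^-1` D)) t) ->
  kappa * ((eps *+ 2) ^+ m * (eps *+ 2) ^+ k) <= K * euclidean_integral D e.
Proof.
move=> eps0 dF cF F0 ce mD DM le_pt.
have [C eC] : exists C, forall t, `|((e \o pt_of) \_ (pt_of @^-1` D)) t| <= C.
  (* [e] is bounded on [D], where it agrees with the compactly supported [e']. *)
  pose e' z := e z * Num.max 0 (Num.min 1 (M + 1 - `|z|)).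
  have ce' : continuous e'.
    move=> z.
    have c1 : {for z, continuous (fun z : E => M + 1 - `|z|)}.
      by apply: cvgB; [exact: cvg_cst|exact: norm_continuous].
    have c2 : {for z, continuous (fun z : E => Num.min 1 (M + 1 - `|z|))}.
      by apply: continuous_min => //; exact: cvg_cst.
    have c3 : {for z, continuous (fun z : E => Num.max 0 (Num.min 1 (M + 1 - `|z|)))}.
      by apply: continuous_max => //; exact: cvg_cst.
    by apply: cvgM => //; exact: ce.
  have e'0 z : M + 1 < `|z| -> e' z = 0.
    move=> Mz; rewrite /e' max_l ?mulr0// ge_min; apply/orP; right.
    by rewrite subr_le0 ltW.
  have [C e'C] := bounded_of_support ce' e'0.
  exists C => t; rewrite patchE; case: ifPn => [/set_mem/= Dt|_]; last first.
    by rewrite normr0 (le_trans _ (e'C 0)).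
  have := e'C (pt_of t); rewrite /e' min_l; last first.
    by rewrite lerBrDr addrC lerD2r DM.
  by rewrite max_r// mulr1.
have me : measurable_fun setT ((e \o pt_of) \_ (pt_of @^-1` D)).
  apply: (proj1 (measurable_restrictT _ mD)).
  exact: measurable_funTS (measurable_pt_fun ce).
have inte : mu.-integrable setT (EFin \o ((e \o pt_of) \_ (pt_of @^-1` D))).
  apply: (@integrable_bounded_pt _ M C) => // t Mt; rewrite patchE.
  case: ifPn => // /set_mem Dt.
  by have := DM _ Dt; rewrite leNgt Mt.
have intF i : mu.-integrable setT (fun t => ('D_(hframe i) (F i) (pt_of t))%:E).
  by apply: (integrable_pt (cF i) (M := M)) => z; apply: derive_outside => //; exact: F0.
pose G t := (\sum_i 'D_(hframe i) (F i) (pt_of t))%:E.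
have intG : mu.-integrable setT G.
  rewrite /G; under eq_fun do rewrite -sumEFin.
  by apply: integrable_sum => // i _; exact: intF.
have IG : (\int[mu]_t G t = 0)%E.
  rewrite /G; under eq_integral do rewrite -sumEFin.
  rewrite integral_sum//; apply: big1 => i _.
  exact: integral_derive_pt (dF i) (cF i) (F0 i).
have intKe : mu.-integrable setT
    (fun t => (K%:E * ((e \o pt_of) \_ (pt_of @^-1` D) t)%:E)%E).
  exact: integrableZl inte.
have mQ := measurable_pair_box c eps.
have intI : mu.-integrable setT (EFin \o \1_(pair_box c eps)).
  apply: (@integrable_supp _ _ _ mu _ (pair_box c eps) 1) => //.
  - have := pair_box_measure c eps0.
    by move=> E1; apply: (eq_ind_r (fun x => (x < +oo)%E) _ E1); rewrite ltry.
  - by move=> t; rewrite indicE; case: (_ \in _); rewrite ?normr0 ?normr1.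
  - by move=> t nQ; rewrite indicE memNset.
have intQ : mu.-integrable setT (fun t => (kappa%:E * (\1_(pair_box c eps) t)%:E)%E).
  exact: integrableZl intI.
have : (\int[mu]_t (kappa%:E * (\1_(pair_box c eps) t)%:E) <=
    \int[mu]_t (G t + K%:E * ((e \o pt_of) \_ (pt_of @^-1` D) t)%:E))%E.
  apply: le_integral => //; first exact: integrableD.
  by move=> t _; rewrite /G -!EFinM -EFinD lee_fin le_pt.
rewrite integralD// IG add0e (integralZl _ inte)// (integralZl _ intI)//.
rewrite integral_indic// setIT.
have I : (\int[mu]_t ((e \o pt_of) \_ (pt_of @^-1` D) t)%:E =
    (euclidean_integral D e)%:E)%E.
  have -> : euclidean_integral D e =
      (\int[mu]_t ((e \o pt_of) \_ (pt_of @^-1` D)) t)%R.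
    exact: (Rintegral_mkcond mu (pt_of @^-1` D) (e \o pt_of)).
  by rewrite /Rintegral fineK//; exact: integrable_fin_num inte.
have V := pair_box_measure c eps0.
move=> le_int; rewrite -lee_fin !EFinM -I.
apply: le_trans le_int.
by apply: (eq_ind_r (fun x => (_ <= kappa%:E * x)%E) _ V); rewrite EFinM.
Qed.

End product_integrals.

(** * Monotonicity *)

Section linear_coordinates.
Context {R : realType} {m k : nat}.
Local Notation E := ('rV[R]_m * 'rV[R]_k)%type.

Lemma differentiable_fst_entry j (z : E) : differentiable (fun z : E => z.1 0 j) z.
Proof.
apply: (@differentiable_comp _ _ _ _ fst (fun x : 'rV[R]_m => x 0 j)).
  by apply: linear_differentiable => x; exact: cvg_fst.
exact: differentiable_coord.
Qed.

Lemma differentiable_snd_entry j (z : E) : differentiable (fun z : E => z.2 0 j) z.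
Proof.
apply: (@differentiable_comp _ _ _ _ snd (fun x : 'rV[R]_k => x 0 j)).
  by apply: linear_differentiable => x; exact: cvg_snd.
exact: differentiable_coord.
Qed.

Definition fst_offset (x0 : 'rV[R]_m) j (z : E) : R := z.1 0 j - x0 0 j.

Lemma is_derive_fst_offset x0 j (z v : E) : is_derive z v (fst_offset x0 j) (v.1 0 j).
Proof.
have dl := differentiable_fst_entry j z.
have d1 : is_derive z v (fun z : E => z.1 0 j) (v.1 0 j).
  apply: DeriveDef; first exact: diff_derivable.
  have did : differentiable (id : 'rV[R]_m -> 'rV[R]_m) z.1 by exact: ex_diff.
  have [-> _] := @derive_comp_affine R E _ _ (fun x : 'rV[R]_m => x 0 j) fst v v.1 z
    (fun h => erefl).
  by rewrite -(derive_entry v.1 0 j did) derive_id.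
have := is_deriveB d1 (is_derive_cst (x0 0 j) z v).
by rewrite subr0.
Qed.

Lemma ndiff_fst_offset x0 j l (U : set E) : ndifferentiable_on l U (fst_offset x0 j).
Proof.
case: l => //= l; split=> [z _|v].
  apply: differentiableB; [exact: differentiable_fst_entry|exact: differentiable_cst].
rewrite [X in ndifferentiable_on _ _ X](_ : _ = fun=> v.1 0 j); first exact: ndiff_cst.
by apply/funext => z; have [] := is_derive_fst_offset x0 j z v.
Qed.

End linear_coordinates.

Section monotonicity.
Context {R : realType} {m k : nat}.
Local Notation E := ('rV[R]_m * 'rV[R]_k)%type.
Variables (a : 'I_m -> 'I_m -> E -> R) (x0 : 'rV[R]_m) (y0 : 'rV[R]_k).
Hypotheses (m_gt2 : (2 < m)%N)
  (a_smooth : forall i j, smooth_on setT (a i j))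
  (a_ge0 : forall (x : 'I_m -> R) z, 0 <= \sum_i \sum_j x i * x j * a i j z)
  (a_cons : forall j z, \sum_i 'D_(hframe i) (a i j) z =
     2^-1 * \sum_i 'D_(hframe j) (a i i) z).

Definition trace : E -> R := \sum_i a i i.
Local Notation e := trace.
Local Notation xr := (fst_offset x0).
Definition rad2 : E -> R := \sum_j (xr j * xr j).
(** The stress-energy tensor [e / 2 - a]; [a_cons] says that its divergence is
    zero.  As in the proof of the monotonicity formula for harmonic maps, it is
    contracted with the position vector field of [R^m]. *)
Definition stress i j : E -> R := (i == j)%:R *: (2^-1 *: e) - a i j.
Definition radial_stress i : E -> R := \sum_j (xr j * stress i j).

(** The exponent in [|x|^(2 - m) = (|x|^2)^(- p)]. *)
Let p : R := m%:R / 2 - 1.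

Lemma dimension_gt0 : 0 < p.
Proof. by rewrite /p subr_gt0 ltr_pdivlMr// mul1r ltr_nat. Qed.

Lemma rad2E z : rad2 z = \sum_j xr j z ^+ 2.
Proof. by rewrite /rad2 fct_sumE; apply: eq_bigr => j _; rewrite expr2. Qed.

Lemma rad2_ge0 z : 0 <= rad2 z.
Proof. by rewrite rad2E sumr_ge0// => j _; exact: sqr_ge0. Qed.

Lemma ndiff_fun_sum n l (f : 'I_n -> E -> R) :
  (forall i, ndifferentiable_on l setT (f i)) ->
  ndifferentiable_on l setT (\sum_i f i).
Proof.
move=> fl; rewrite (_ : \sum_i f i = fun z => \sum_i f i z).
  by apply: ndiff_sum => //; exact: openT.
by apply/funext => z; rewrite fct_sumE.
Qed.

Lemma ndiff_funM l (f g : E -> R) :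
  ndifferentiable_on l setT f -> ndifferentiable_on l setT g ->
  ndifferentiable_on l setT (f * g).
Proof. by move=> fl gl; apply: ndiffM => //; exact: openT. Qed.

Lemma trace_smooth : smooth_on setT e.
Proof. by move=> l; apply: ndiff_fun_sum => i; exact: a_smooth. Qed.

Lemma rad2_smooth : smooth_on setT rad2.
Proof. by move=> l; apply: ndiff_fun_sum => i; apply: ndiff_funM; exact: ndiff_fst_offset. Qed.

Lemma stress_smooth i j : smooth_on setT (stress i j).
Proof.
move=> l; have oT := @openT E; apply: (ndiffD oT).
  have c (x : R) : ndifferentiable_on l setT (fun=> x : R) := @ndiff_cst R E _ l setT x.
  exact: (ndiffM oT (c _) (ndiffM oT (c _) (trace_smooth l))).
exact: (ndiffN oT (a_smooth i j l)).
Qed.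

Lemma radial_stress_smooth i : smooth_on setT (radial_stress i).
Proof.
move=> l; apply: ndiff_fun_sum => j; apply: ndiff_funM.
  exact: ndiff_fst_offset.
exact: stress_smooth.
Qed.

Lemma smooth_is_derive (f : E -> R) z v : smooth_on setT f ->
  is_derive z v f ('D_v f z).
Proof.
move=> sf; apply: DeriveDef => //; apply: diff_derivable.
exact: (proj1 (sf 1)).
Qed.

Lemma smooth_derive_continuous (f : E -> R) v : smooth_on setT f ->
  continuous ('D_v f).
Proof. by move=> sf z; exact/differentiable_continuous/(((sf 2).2 v).1 z I). Qed.

Lemma smooth_continuous (f : E -> R) : smooth_on setT f -> continuous f.
Proof. by move=> sf z; exact/differentiable_continuous/((sf 1).1 z I). Qed.

Lemma is_derive_rad2 z i : is_derive z (hframe i) rad2 (2 * xr i z).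
Proof.
have d j := is_derive_fst_offset x0 j z (hframe i).
apply: is_derive_eq (is_derive_sum (fun j => is_deriveM (d j) (d j))) _.
rewrite (bigD1 i)//= big1 ?addr0.
  by rewrite mxE !eqxx/= /GRing.scale/= mulr1 mulr_natl mulr2n.
by move=> j ji; rewrite mxE eqxx/= (negbTE ji) scaler0 addr0.
Qed.

Lemma is_derive_stress z v i j : is_derive z v (stress i j)
  ((i == j)%:R * (2^-1 * 'D_v e z) - 'D_v (a i j) z).
Proof.
apply: is_deriveB; last exact/smooth_is_derive/a_smooth.
do 2 apply: is_deriveZ; exact/smooth_is_derive/trace_smooth.
Qed.

Lemma derive_radial_stress z i : 'D_(hframe i) (radial_stress i) z =
  stress i i z + \sum_j xr j z *
    ((i == j)%:R * (2^-1 * 'D_(hframe i) e z) - 'D_(hframe i) (a i j) z).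
Proof.
have d j := is_derive_fst_offset x0 j z (hframe i).
have D := is_derive_sum (fun j => is_deriveM (d j) (is_derive_stress z (hframe i) i j)).
apply: (etrans (@derive_val _ _ _ _ _ _ _ D)); rewrite big_split/= addrC; congr (_ + _).
rewrite (bigD1 i)//= big1 ?addr0 => [|j ji].
  by rewrite mxE !eqxx/= /GRing.scale/= mulr1.
by rewrite mxE eqxx/= (negbTE ji) scaler0.
Qed.

Lemma stressE i j z : stress i j z = (i == j)%:R * (2^-1 * e z) - a i j z.
Proof. by []. Qed.

Lemma derive_trace v z : 'D_v e z = \sum_i 'D_v (a i i) z.
Proof.
have D := is_derive_sum (fun i => smooth_is_derive z v (a_smooth i i)).
exact: (@derive_val _ _ _ _ _ _ _ D).
Qed.

(** Since [stress] is divergence free, only the derivatives of the position vector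
    contribute, and they give the trace of [stress], [(m / 2 - 1) * e]. *)
Lemma stress_divergence z :
  \sum_i 'D_(hframe i) (radial_stress i) z = p * e z.
Proof.
rewrite (eq_bigr _ (fun i _ => derive_radial_stress z i)) big_split/=.
rewrite [X in _ + X](_ : _ = 0) ?addr0; last first.
  rewrite exchange_big/= big1// => j _; rewrite -mulr_sumr.
  suff -> : \sum_i ((i == j)%:R * (2^-1 * 'D_(hframe i) e z)
      - 'D_(hframe i) (a i j) z) = 0 by rewrite mulr0.
  rewrite big_split/= sumrN a_cons -derive_trace (bigD1 j)//= eqxx mul1r big1.
    by rewrite addr0 subrr.
  by move=> i ij; rewrite (negbTE ij) mul0r.
under eq_bigr do rewrite stressE eqxx mul1r.
rewrite big_split/= sumr_const card_ord sumrN /p.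
have -> : \sum_(i < m) a i i z = e z by rewrite /trace fct_sumE.
by rewrite -mulr_natl; field.
Qed.

Lemma radial_stress_radial z : \sum_i xr i z * radial_stress i z =
  2^-1 * e z * rad2 z - \sum_i \sum_j xr i z * xr j z * a i j z.
Proof.
rewrite rad2E mulr_sumr -sumrB; apply: eq_bigr => i _.
rewrite /radial_stress fct_sumE mulr_sumr.
rewrite (eq_bigr (fun j => xr i z * xr j z * ((i == j)%:R * (2^-1 * e z))
    - xr i z * xr j z * a i j z)); last first.
  move=> j _; transitivity (xr i z * (xr j z * stress i j z)); first by [].
  by rewrite stressE; ring.
rewrite sumrB; congr (_ - _).
rewrite (bigD1 i)//= eqxx mul1r big1 ?addr0 => [|j ji]; first by ring.
by rewrite eq_sym (negbTE ji) mul0r mulr0.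
Qed.

(** The pair is swapped for [fst_offset] to apply to the leaf coordinates. *)
Definition yrad2 (z : E) : R := \sum_l (fst_offset y0 l (z.2, z.1)) ^+ 2.

(** It is merely Lipschitz, which is enough because only horizontal derivatives are
    taken. *)
Definition leaf_cutoff delta (z : E) : R := Num.max 0 (1 - yrad2 z / delta ^+ 2).

Definition weighted_stress C delta i : E -> R :=
  (weight p C \o rad2) * (leaf_cutoff delta * radial_stress i).

Lemma yrad2_ge0 z : 0 <= yrad2 z.
Proof. by rewrite sumr_ge0// => j _; exact: sqr_ge0. Qed.

Lemma yrad2_continuous : continuous yrad2.
Proof.
have -> : yrad2 = \sum_l (fun z : E => (z.2 0 l - y0 0 l) * (z.2 0 l - y0 0 l)).
  by apply/funext => z; rewrite fct_sumE; apply: eq_bigr => l _; rewrite expr2.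
move=> z; apply/differentiable_continuous/differentiable_sum => l.
have d : differentiable (fun z : E => z.2 0 l - y0 0 l) z.
  by apply: differentiableB; [exact: differentiable_snd_entry|exact: differentiable_cst].
exact: differentiableM.
Qed.

Lemma leaf_cutoff_continuous delta : continuous (leaf_cutoff delta).
Proof.
move=> z; have c1 : {for z, continuous (fun z : E => 1 - yrad2 z / delta ^+ 2)}.
  apply: cvgB; first exact: cvg_cst.
  by apply: cvgM; [exact: yrad2_continuous|exact: cvg_cst].
suff : {for z, continuous (fun z : E => Num.max 0 (1 - yrad2 z / delta ^+ 2))} by [].
by apply: continuous_max => //; exact: cvg_cst.
Qed.

Lemma leaf_cutoff_ge0 delta z : 0 <= leaf_cutoff delta z.
Proof. by rewrite /leaf_cutoff le_max lexx. Qed.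

Lemma leaf_cutoff_le1 delta z : leaf_cutoff delta z <= 1.
Proof.
rewrite /leaf_cutoff ge_max ler01/= gerBl divr_ge0//; first exact: yrad2_ge0.
exact: sqr_ge0.
Qed.

Lemma leaf_cutoff_eq0 delta z : 0 < delta -> delta ^+ 2 < yrad2 z ->
  leaf_cutoff delta z = 0.
Proof.
move=> d0 dz; rewrite /leaf_cutoff max_l// subr_le0 ler_pdivlMr ?exprn_gt0//.
by rewrite mul1r ltW.
Qed.

Lemma is_derive_leaf_cutoff delta z i : is_derive z (hframe i) (leaf_cutoff delta) 0.
Proof.
pose H (y : 'rV[R]_k) := Num.max 0 (1 - (\sum_l (y 0 l - y0 0 l) ^+ 2) / delta ^+ 2).
have [E1 E2] := @derive_comp_affine R E _ _ H snd (hframe i) 0 z (fun h => erefl).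
apply: DeriveDef; first exact/E2/derivable0.
by apply: (etrans E1); rewrite derive0.
Qed.

Section weighted.
Variables (C : R).

Lemma differentiable_weight z : differentiable (weight p C) (rad2 z).
Proof.
apply/derivable1_diffP.
by have [] := is_derive_weight p C (rad2_ge0 z).
Qed.

Lemma is_derive_weight_rad2 z i : is_derive z (hframe i) (weight p C \o rad2)
  (dweight p C (rad2 z) * (2 * xr i z)).
Proof.
have dw := differentiable_weight z; have dr := (rad2_smooth 1).1 z I.
have dwr : differentiable (weight p C \o rad2) z by exact: differentiable_comp.
apply: DeriveDef; first exact: diff_derivable.
apply: (etrans (derive_comp (hframe i) dr dw)).
have -> : 'D_(hframe i) rad2 z = 2 * xr i z by have [] := is_derive_rad2 z i.
have := derive_linear (1 : R) (0 : R) (2 * xr i z) dw; rewrite addr0 derive0 addr0.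
rewrite /GRing.scale/= mulr1 => ->; rewrite [RHS]mulrC; congr (_ * _).
by have [] := is_derive_weight p C (rad2_ge0 z).
Qed.

Lemma is_derive_weighted_stress delta z i :
  is_derive z (hframe i) (weighted_stress C delta i)
    (weight p C (rad2 z) *
       (leaf_cutoff delta z * 'D_(hframe i) (radial_stress i) z)
     + leaf_cutoff delta z * radial_stress i z *
       (dweight p C (rad2 z) * (2 * xr i z))).
Proof.
have d1 := is_derive_weight_rad2 z i.
have d2 := is_deriveM (is_derive_leaf_cutoff delta z i)
  (smooth_is_derive z (hframe i) (radial_stress_smooth i)).
apply: is_derive_eq (is_deriveM d1 d2) _.
by rewrite scaler0 addr0.
Qed.

Lemma weighted_stress_continuous delta i :
  continuous ('D_(hframe i) (weighted_stress C delta i)).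
Proof.
rewrite (_ : 'D_(hframe i) _ = fun z => (weight p C (rad2 z) *
       (leaf_cutoff delta z * 'D_(hframe i) (radial_stress i) z)
     + leaf_cutoff delta z * radial_stress i z *
       (dweight p C (rad2 z) * (2 * xr i z)))); last first.
  by apply/funext => z; have [] := is_derive_weighted_stress delta z i.
move=> z; have cr : {for z, continuous rad2} by exact: smooth_continuous rad2_smooth z.
have cx : {for z, continuous (xr i)}.
  by apply: smooth_continuous => l; exact: ndiff_fst_offset.
apply: cvgD; apply: cvgM.
- apply: (@continuous_comp _ _ _ rad2 (weight p C)) => //.
  exact/differentiable_continuous/differentiable_weight.
- apply: cvgM; first exact: leaf_cutoff_continuous.
  exact: smooth_derive_continuous (radial_stress_smooth i) z.
- apply: cvgM; first exact: leaf_cutoff_continuous.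
  exact: smooth_continuous (radial_stress_smooth i) z.
- apply: cvgM; last by apply: cvgM => //; exact: cvg_cst.
  apply: (@continuous_comp _ _ _ rad2 (dweight p C)) => //.
  exact: continuous_dweight (rad2_ge0 z).
Qed.

Lemma weighted_divergence delta z :
  \sum_i 'D_(hframe i) (weighted_stress C delta i) z =
  leaf_cutoff delta z * (weight p C (rad2 z) * p * e z + dweight p C (rad2 z) *
    (e z * rad2 z - 2 * \sum_i \sum_j xr i z * xr j z * a i j z)).
Proof.
have D i := @derive_val _ _ _ _ _ _ _ (is_derive_weighted_stress delta z i).
rewrite (eq_bigr _ (fun i _ => D i)) big_split/=.
transitivity (weight p C (rad2 z) * (leaf_cutoff delta z * (p * e z)) +
    2 * leaf_cutoff delta z * dweight p C (rad2 z) *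
    \sum_i xr i z * radial_stress i z).
  rewrite -!mulr_sumr stress_divergence; congr (_ + _).
  by rewrite mulr_sumr; apply: eq_bigr => i _; ring.
rewrite radial_stress_radial; move: (\sum_i _) => A.
by field.
Qed.

End weighted.

Lemma cylinderE b delta z : 0 < b -> 0 < delta ->
  cylinder x0 y0 b delta z <-> rad2 z <= b ^+ 2 /\ yrad2 z <= delta ^+ 2.
Proof.
move=> b0 d0; rewrite /cylinder /= /enorm.
have sqrt_le (x c : R) : 0 < c -> 0 <= x -> (Num.sqrt x <= c) = (x <= c ^+ 2).
  move=> c0 xx; rewrite -{2}(sqr_sqrtr xx) ler_pXn2r// nnegrE ?sqrtr_ge0//.
  exact: ltW.
have -> : \sum_i (z.1 - x0) 0 i ^+ 2 = rad2 z.
  by rewrite rad2E; apply: eq_bigr => i _; rewrite !mxE.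
have -> : \sum_i (z.2 - y0) 0 i ^+ 2 = yrad2 z.
  by apply: eq_bigr => i _; rewrite !mxE.
by rewrite !sqrt_le// ?rad2_ge0 ?yrad2_ge0.
Qed.

Lemma cylinder_bounded b delta z : 0 < b -> 0 < delta ->
  rad2 z <= b ^+ 2 -> yrad2 z <= delta ^+ 2 ->
  `|z| <= b + delta + `|x0| + `|y0|.
Proof.
move=> b0 d0 zb zd; rewrite [leLHS]prod_normE ge_max.
have bound n (v w : 'rV[R]_n) c : 0 < c ->
    \sum_j (v 0 j - w 0 j) ^+ 2 <= c ^+ 2 -> `|v| <= c + `|w|.
  move=> c0 vw; rewrite [leLHS]/Num.Def.normr/= mx_normrE.
  apply: bigmax_le => /= [|[l j] _]; first by rewrite addr_ge0// ltW.
  rewrite ord1 -(subrK (w 0 j) (v 0 j)) (le_trans (ler_normD _ _))//.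
  rewrite lerD ?entry_le_norm//.
  have c0' := ltW c0.
  rewrite -(ler_pXn2r (n := 2)) ?nnegrE// real_normK ?num_real//.
  apply: le_trans vw; rewrite (bigD1 j)//= lerDl sumr_ge0// => i _.
  exact: sqr_ge0.
apply/andP; split.
  have := @bound _ z.1 x0 b b0 _; rewrite rad2E in zb => /(_ zb) zx.
  apply: (le_trans zx); rewrite -!addrA lerD2l.
  by rewrite addrCA lerDl addr_ge0// ltW.
have := @bound _ z.2 y0 delta d0 zd => zy; apply: (le_trans zy).
by rewrite lerD2r -addrA addrCA lerDl addr_ge0// ltW.
Qed.

Lemma measurable_cylinder b delta : 0 < b -> 0 < delta ->
  measurable (@pt_of R m k @^-1` cylinder x0 y0 b delta).
Proof.
move=> b0 d0.
have mle (h : E -> R) c : continuous h ->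
    measurable ((h \o @pt_of R m k) @^-1` `]-oo, c]).
  move=> ch; rewrite -[X in measurable X]setTI.
  exact: (measurable_pt_fun ch).
rewrite (_ : _ @^-1` _ = ((rad2 \o @pt_of R m k) @^-1` `]-oo, b ^+ 2]) `&`
    ((yrad2 \o @pt_of R m k) @^-1` `]-oo, delta ^+ 2])).
  apply: measurableI; apply: mle.
    exact: smooth_continuous rad2_smooth.
  exact: yrad2_continuous.
apply/seteqP; split=> t /=; rewrite !in_itv/=.
  by move=> /(cylinderE _ b0 d0).
by move=> h; apply/(cylinderE _ b0 d0).
Qed.

Lemma trace_ge0 z : 0 <= e z.
Proof.
rewrite /trace fct_sumE sumr_ge0// => i _.
have := a_ge0 (fun j => (j == i)%:R) z.
rewrite (bigD1 i)//= [X in _ + X]big1 => [|j ji]; last first.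
  by rewrite big1// => l _; rewrite (negbTE ji) !mul0r.
rewrite (bigD1 i)//= big1 => [|j ji]; last by rewrite (negbTE ji) mulr0 mul0r.
by rewrite eqxx !mul1r !addr0.
Qed.

Lemma decay_bound b : 0 < b -> decay p (b ^+ 2) <= (b ^+ (m - 2))^-1.
Proof.
move=> b0; have b20 : 0 < b ^+ 2 by rewrite exprn_gt0.
apply: (@le_trans _ _ (expR (- p * ln (b ^+ 2)))).
  rewrite /decay ler_expR !mulNr lerN2 ler_pM2l ?dimension_gt0//.
  by rewrite ler_ln ?posrE ?lerDr ?addr_gt0.
rewrite -[X in _ <= X^-1](lnK (x := b ^+ (m - 2))) ?posrE ?exprn_gt0//.
rewrite -expRN !lnXn// ler_expR le_eqVlt; apply/orP; left; apply/eqP.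
rewrite -[ln b *+ 2]mulr_natl -[ln b *+ (m - 2)]mulr_natl natrB; last exact: ltnW.
by rewrite /p; field.
Qed.

(** [weight_supersolution] turns the divergence identity into a differential
    inequality; the quadratic form [a] enters with a favourable sign because the
    weight decreases. *)
Lemma weighted_divergence_ge C delta z : 0 < C -> C <= decay p (rad2 z) ->
  p * (leaf_cutoff delta z * e z *
    ((decay p (rad2 z) - C ^+ 2 / decay p (rad2 z)) / (1 + rad2 z))) <=
  \sum_i 'D_(hframe i) (weighted_stress C delta i) z
    + 2 * p * C * (leaf_cutoff delta z * e z).
Proof.
move=> C0 uC; rewrite weighted_divergence.
have A0 := a_ge0 (fun i => xr i z) z.
have dw := dweight_le0 dimension_gt0 C0 (rad2_ge0 z).
have sup := weight_supersolution dimension_gt0 C0 (rad2_ge0 z) uC.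
have chi0 := leaf_cutoff_ge0 delta z; have e0 := trace_ge0 z.
have p0 := dimension_gt0.
move: (\sum_i _) A0 => A A0.
move: (dweight p C _) dw sup => dwv dw; move: (weight p C _) => wv.
move: (_ / (1 + rad2 z)) => v sup.
move: (leaf_cutoff delta z) chi0 (e z) e0 (rad2 z) (rad2_ge0 z) sup => chi chi0 ev e0 s s0 sup.
have h1 : chi * ev * p * (v - 2 * C) <= chi * ev * p * (wv + s * dwv / p).
  by rewrite ler_wpM2l// !mulr_ge0// ltW.
have h2 : 0 <= - (2 * chi * dwv * A).
  have dA : dwv * A <= 0 by rewrite mulr_le0_ge0.
  by rewrite oppr_ge0 -!mulrA mulr_ge0_le0// mulr_ge0_le0.
rewrite -subr_ge0.
have -> : chi * (wv * p * ev + dwv * (ev * s - 2 * A)) + 2 * p * C * (chi * ev)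
    - p * (chi * ev * v) =
  (chi * ev * p * (wv + s * dwv / p) - chi * ev * p * (v - 2 * C))
   + - (2 * chi * dwv * A) by field; rewrite gt_eqF.
by rewrite addr_ge0// subr_ge0.
Qed.

(** The integrated inequality: the energy near [zs] is controlled by the energy
    of a large cylinder times the value of the fundamental solution on its
    lateral boundary.  The truncation level [C] is the value of [decay] there, so
    that the weight is supported in the cylinder. *)
Lemma energy_box_le b delta zs r chi0 e0 s1 : 0 < b -> 0 < delta -> 0 < r ->
  0 < chi0 -> 0 < e0 -> 0 < s1 -> s1 <= b ^+ 2 ->
  (b ^+ (m - 2))^-1 <= decay p s1 / 2 ->
  (forall t, pair_box zs r t -> [/\ chi0 <= leaf_cutoff delta (pt_of t),
     e0 <= e (pt_of t) & rad2 (pt_of t) <= s1]) ->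
  chi0 * e0 * (decay p s1 / 2) / (1 + s1) * ((r *+ 2) ^+ m * (r *+ 2) ^+ k) <=
  2 * (b ^+ (m - 2))^-1 * euclidean_integral (cylinder x0 y0 b delta) e.
Proof.
move=> b0 d0 r0 chi00 e00 s10 s1b small near_zs.
pose C := decay p (b ^+ 2); have C0 : 0 < C by exact: decay_gt0.
have Cb : C <= (b ^+ (m - 2))^-1 by exact: decay_bound.
have p0 := dimension_gt0.
have outside z : b ^+ 2 < rad2 z -> decay p (rad2 z) <= C.
  by move=> bz; apply: decay_nincr => //; [exact: sqr_ge0|exact: ltW].
have I0 : 0 <= euclidean_integral (cylinder x0 y0 b delta) e.
  by apply: Rintegral_ge0 => t _; exact: trace_ge0.
have zero_or z : b + delta + `|x0| + `|y0| < `|z| ->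
    b ^+ 2 < rad2 z \/ delta ^+ 2 < yrad2 z.
  move=> Mz; have [zb|] := leP (rad2 z) (b ^+ 2); last by left.
  have [zd|] := leP (yrad2 z) (delta ^+ 2); last by right.
  by have := cylinder_bounded b0 d0 zb zd; rewrite leNgt Mz.
have le_int := @integral_compare R m k (weighted_stress C delta) e
  (cylinder x0 y0 b delta) zs r (b + delta + `|x0| + `|y0|)
  (p * (chi0 * e0 * (decay p s1 / 2) / (1 + s1))) (2 * p * C) r0
  (fun i z => @ex_derive _ _ _ _ _ _ _ (is_derive_weighted_stress C delta z i))
  (@weighted_stress_continuous C delta).
have {le_int} : p * (chi0 * e0 * (decay p s1 / 2) / (1 + s1)) *
    ((r *+ 2) ^+ m * (r *+ 2) ^+ k) <=
    2 * p * C * euclidean_integral (cylinder x0 y0 b delta) e.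
  apply: le_int.
  - move=> i z /zero_or nz; transitivity
      (weight p C (rad2 z) * (leaf_cutoff delta z * radial_stress i z)) => //.
    case: nz => [/outside/weight_eq0 ->|/(leaf_cutoff_eq0 d0) ->].
      by rewrite mul0r.
    by rewrite mul0r mulr0.
  - exact: smooth_continuous trace_smooth.
  - exact: measurable_cylinder.
  - by move=> z /(cylinderE _ b0 d0)[]; exact: cylinder_bounded.
  - move=> t; set z := pt_of t; rewrite patchE /= -/z.
    have [zb|bz] := leP (rad2 z) (b ^+ 2); last first.
      have D0 : \sum_i 'D_(hframe i) (weighted_stress C delta i) z = 0.
        rewrite weighted_divergence weight_eq0 ?outside// dweight_eq0 ?outside//.
        by rewrite !mul0r addr0 mulr0.
      rewrite D0 memNset; last by move=> /(cylinderE _ b0 d0)[]; rewrite leNgt bz.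
      rewrite indicE memNset ?mulr0 ?addr0// => /near_zs[_ _].
      by rewrite -/z leNgt (le_lt_trans s1b bz).
    have uC : C <= decay p (rad2 z) by apply: decay_nincr => //; exact: rad2_ge0.
    have key := weighted_divergence_ge delta C0 uC.
    have u0 := decay_gt0 p (rad2 z).
    have V0 : 0 <= (decay p (rad2 z) - C ^+ 2 / decay p (rad2 z)) / (1 + rad2 z).
      rewrite divr_ge0//; last by rewrite addr_ge0// rad2_ge0.
      rewrite subr_ge0 ler_pdivrMr// -expr2 ler_pXn2r// nnegrE ltW//.
    have KE : 2 * p * C * (leaf_cutoff delta z * e z) <= 2 * p * C *
        (if t \in pt_of @^-1` cylinder x0 y0 b delta then (e \o pt_of) t else 0).
      have K0 : 0 <= 2 * p * C by rewrite !mulr_ge0// ltW.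
      rewrite ler_wpM2l//.
      have [zd|dz] := leP (yrad2 z) (delta ^+ 2).
        rewrite mem_set; last by apply/(cylinderE _ b0 d0).
        by rewrite -[leRHS]mul1r ler_wpM2r ?trace_ge0 ?leaf_cutoff_le1.
      rewrite leaf_cutoff_eq0// mul0r; case: ifP => // _; exact: trace_ge0.
    apply: le_trans (le_trans key _); last by apply: lerD => //; exact: KE.
    rewrite indicE; case: (boolP (t \in pair_box zs r)) => [/set_mem tb|_]; last first.
      have ce0 : 0 <= leaf_cutoff delta z * e z.
        by rewrite mulr_ge0 ?leaf_cutoff_ge0 ?trace_ge0.
      by rewrite mulr0 mulr_ge0 ?(ltW p0)// mulr_ge0.
    have [h1 h2 h3] := near_zs t tb; rewrite -/z in h1 h2 h3.
    have us : decay p s1 <= decay p (rad2 z).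
      by apply: decay_nincr => //; exact: rad2_ge0.
    have Cu : C <= decay p (rad2 z) / 2.
      by rewrite (le_trans Cb)// (le_trans small)// ler_pM2r.
    have hu : decay p s1 / 2 <= decay p (rad2 z) - C ^+ 2 / decay p (rad2 z).
      move: (decay p s1) (decay p (rad2 z)) u0 us Cu => u1 u u0 us Cu.
      have : C ^+ 2 / u <= u / 4.
        rewrite ler_pdivrMr// expr2 (le_trans (ler_pM _ _ Cu Cu)) ?(ltW C0)//.
        by rewrite le_eqVlt; apply/orP; left; apply/eqP; field.
      lra.
    have hs : (1 + s1)^-1 <= (1 + rad2 z)^-1.
      by rewrite lef_pV2 ?posrE ?ltr_pwDl ?rad2_ge0 ?lerD2l// ltW.
    have hce : chi0 * e0 <= leaf_cutoff delta z * e z by rewrite ler_pM// ltW.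
    have d10 : 0 <= decay p s1 / 2 by rewrite divr_ge0// ltW// decay_gt0.
    have is10 : 0 <= (1 + s1)^-1 by rewrite invr_ge0 addr_ge0// ltW.
    have ce0 : 0 <= chi0 * e0 by rewrite mulr_ge0// ltW.
    rewrite mulr1 ler_pM2l// -[leLHS]mulrA ler_pM//; first by rewrite mulr_ge0.
    by rewrite ler_pM.
move=> le_int; rewrite -(ler_pM2l p0) [leLHS]mulrA; apply: le_trans le_int _.
rewrite [leRHS](_ : _ = 2 * p * (b ^+ (m - 2))^-1 *
  euclidean_integral (cylinder x0 y0 b delta) e); last by ring.
by rewrite ler_wpM2r// ler_wpM2l// mulr_ge0// ltW.
Qed.

Hypothesis growth : forall delta, 0 < delta -> forall eps, 0 < eps ->
  \forall rho \near +oo,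
    `|euclidean_integral (cylinder x0 y0 rho delta) e| <= eps * `|rho ^+ (m - 2)|.

Lemma pair_box_ball (zs : E) r t : 0 < r -> pair_box zs (r / 2) t ->
  ball zs r (pt_of t).
Proof.
move=> r0 [b1 b2].
have close x y : x - r / 2 <= y <= x + r / 2 -> `|x - y| < r.
  move=> /andP[h1 h2]; rewrite ltr_distlC; apply/andP; split; lra.
by split; split=> // i j; rewrite ord1 !mxE; apply: close; [exact: b1|exact: b2].
Qed.

(** If [e zs > 0], then [e], [leaf_cutoff] and the truncated weight are bounded
    below on a box around [zs], so the left-hand side of [energy_box_le] stays
    away from zero, whereas the right-hand side is [o(1)] by [growth]. *)
Lemma energy_vanishes zs : e zs = 0.
Proof.
apply/eqP/negP => /negP ez; have ep : 0 < e zs by rewrite lt0r ez trace_ge0.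
pose delta := yrad2 zs + 1.
have d1 : 1 <= delta by rewrite /delta lerDr yrad2_ge0.
have d0 : 0 < delta by exact: lt_le_trans d1.
have chip : 0 < leaf_cutoff delta zs.
  rewrite /leaf_cutoff lt_max; apply/orP; right.
  rewrite subr_gt0 ltr_pdivrMr ?exprn_gt0// mul1r.
  by rewrite (@lt_le_trans _ _ delta) ?ltrDl// -[leLHS]mulr1 expr2 ler_pM2l.
pose s1 := rad2 zs + 1; have s10 : 0 < s1 by rewrite ltr_wpDl ?rad2_ge0.
have u10 := decay_gt0 p s1; set u1 := decay p s1 in u10.
have half (x : R) : 0 < x -> x / 2 < x by move=> xp; lra.
have c1 : {for zs, continuous (leaf_cutoff delta)} by exact: leaf_cutoff_continuous.
have c2 : {for zs, continuous e} by exact: smooth_continuous trace_smooth zs.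
have c3 : {for zs, continuous rad2} by exact: smooth_continuous rad2_smooth zs.
have n1 : \forall z \near zs, leaf_cutoff delta zs / 2 < leaf_cutoff delta z.
  exact: (cvgr_gt _ c1 _ (half _ chip)).
have n2 : \forall z \near zs, e zs / 2 < e z by exact: (cvgr_gt _ c2 _ (half _ ep)).
have n3 : \forall z \near zs, rad2 z < s1.
  by apply: (cvgr_lt _ c3); rewrite /s1 ltrDl.
have : \forall z \near zs, [/\ leaf_cutoff delta zs / 2 < leaf_cutoff delta z,
    e zs / 2 < e z & rad2 z < s1] by near=> z; split; near: z.
move=> /nbhs_ballP[r/= r0 rP].
(* The left-hand side of [energy_box_le] for the box of half side [r / 2]. *)
pose kappa := leaf_cutoff delta zs / 2 * (e zs / 2) * (u1 / 2) / (1 + s1) *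
  ((r / 2 *+ 2) ^+ m * (r / 2 *+ 2) ^+ k).
have k0 : 0 < kappa.
  have v0 : 0 < r / 2 *+ 2 by rewrite pmulrn_rgt0// divr_gt0.
  apply: mulr_gt0; last by rewrite mulr_gt0// exprn_gt0.
  apply: divr_gt0; last by rewrite addr_gt0.
  by rewrite !mulr_gt0// invr_gt0.
have kappa4 : 0 < kappa / 4 by rewrite divr_gt0.
(* As [m > 2], [b >= 2 / u1] makes [b ^- (m - 2)] at most [u1 / 2]. *)
have [b [b1 bs bu Ib]] : exists b, [/\ 1 <= b, s1 <= b, 2 / u1 <= b &
    `|euclidean_integral (cylinder x0 y0 b delta) e| <= kappa / 4 * `|b ^+ (m - 2)|].
  apply: (@filter_ex _ (+oo : set_system R)); near=> b; split.
  - by near: b; apply: nbhs_pinfty_ge; rewrite num_real.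
  - by near: b; apply: nbhs_pinfty_ge; rewrite num_real.
  - by near: b; apply: nbhs_pinfty_ge; rewrite num_real.
  - by near: b; exact: growth.
have b0 : 0 < b by exact: lt_le_trans b1.
have bm : b <= b ^+ (m - 2).
  by rewrite -[X in X <= _]expr1 ler_weXn2l// subn_gt0.
have bm0 : 0 < b ^+ (m - 2) by rewrite exprn_gt0.
have small : (b ^+ (m - 2))^-1 <= u1 / 2.
  rewrite -[leRHS]invrK lef_pV2 ?posrE ?invr_gt0 ?divr_gt0// invf_div.
  exact: le_trans bm.
have s1b : s1 <= b ^+ 2.
  by rewrite (le_trans bs)// expr2 -[leLHS]mulr1 ler_pM2l.
have := @energy_box_le b delta zs (r / 2) (leaf_cutoff delta zs / 2) (e zs / 2) s1
  b0 d0 (divr_gt0 r0 (ltr0n _ 2)) (divr_gt0 chip (ltr0n _ 2))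
  (divr_gt0 ep (ltr0n _ 2)) s10 s1b small.
rewrite -/u1 -/kappa => /(_ _)-kI.
have {}kI : kappa <= 2 * (b ^+ (m - 2))^-1 *
    euclidean_integral (cylinder x0 y0 b delta) e.
  by apply: kI => t /(pair_box_ball r0)/rP[/ltW ? /ltW ? /ltW ?].
have I1 := le_trans (ler_norm _) Ib.
move: I1; rewrite ger0_norm ?(ltW bm0)// => I1.
have : kappa <= 2 * (b ^+ (m - 2))^-1 * (kappa / 4 * b ^+ (m - 2)).
  by apply: (le_trans kI); rewrite ler_wpM2l// mulr_ge0// invr_ge0 ltW.
rewrite (_ : 2 * _ * _ = kappa / 2); last by field; rewrite gt_eqF.
by rewrite leNgt half.
Unshelve. all: by end_near. Qed.

End monotonicity.

(** * Connectedness and generated atlases *)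

Lemma connected_locally_constant (S : topologicalType) (D A : set S) x y :
  connected D -> D x -> D y ->
  (forall s, D s -> \forall s' \near s, D s' -> (A s <-> A s')) ->
  A x -> A y.
Proof.
move=> cD Dx Dy loc Ax.
have near_open s (P : set S) : nbhs s P -> exists2 O, open_nbhs s O & O `<=` P.
  by rewrite nbhsE.
pose pick s (Ds : D s) := sval (cid2 (near_open s _ (loc s Ds))).
have pickP s (Ds : D s) : open_nbhs s (pick s Ds) /\
    forall s', pick s Ds s' -> D s' -> (A s <-> A s').
  by rewrite /pick; case: cid2.
pose C := \bigcup_(i in [set u : {s | D s} | A (sval u)]) pick _ (svalP i).
pose C' := \bigcup_(i in [set u : {s | D s} | ~ A (sval u)]) pick _ (svalP i).
have oC : open C.
  by apply: bigcup_open => i _; exact: (pickP _ (svalP i)).1.1.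
have oC' : open C'.
  by apply: bigcup_open => i _; exact: (pickP _ (svalP i)).1.1.
have ADC : D `&` A = D `&` C.
  apply/seteqP; split=> s [Ds].
    by move=> As; split=> //; exists (exist _ s Ds) => //; exact: (pickP _ _).1.2.
  move=> [[s' Ds'] /= As' ss']; split=> //.
  by have := (pickP _ _).2 s ss' Ds; rewrite /=; tauto.
have ADC' : D `&` A = D `&` ~` C'.
  apply/seteqP; split=> s [Ds].
    move=> As; split=> // -[[s' Ds'] /= As' ss'].
    by have := (pickP _ _).2 s ss' Ds; rewrite /=; tauto.
  move=> C's; split=> //; apply: contrapT => nAs; apply: C's.
  by exists (exist _ s Ds) => //; exact: (pickP _ _).1.2.
have : D `&` A = D.
  apply: cD; first by exists x.
  - by exists C.
  - by exists (~` C') => //; exact: open_closedC.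
by move=> DA; have [] : (D `&` A) y by rewrite DA.
Qed.

Lemma segment_locally_constant (R : realType) (P : R -> Prop) :
  (forall t : R, 0 <= t <= 1 -> \forall t' \near t, 0 <= t' <= 1 -> (P t <-> P t')) ->
  P 0 -> P 1.
Proof.
move=> loc; apply: (@connected_locally_constant R `[0, 1]%classic P).
- exact: segment_connected.
- by rewrite /= in_itv/= lexx ler01.
- by rewrite /= in_itv/= lexx ler01.
- by move=> s; rewrite /= in_itv/= => /loc; apply: filterS => s' +; rewrite in_itv.
Qed.

Section maximal_atlas.
Context {R : realType} {S : topologicalType} {n : nat}.
Implicit Types c b : chart R S n.
Variable B : set (chart R S n).
Hypotheses (B_chart : forall b, B b -> is_chart b)
  (B_cover : forall s, exists b, B b /\ cdom b s)
  (B_compat : forall b b', B b -> B b' -> compatible b b').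

(** The maximal atlas that contains [B]. *)
Definition generated_atlas : set (chart R S n) :=
  [set c | is_chart c /\ forall b, B b -> compatible c b].

Lemma open_overlap c c' : is_chart c -> is_chart c' -> open (overlap c c').
Proof.
move=> [oc oi _ _ ci] [oc' _ _ _ _]; rewrite openE => u [cu c'u].
apply: filterI; first exact: open_nbhs_nbhs.
by apply: (ci u cu); exact: open_nbhs_nbhs.
Qed.

Lemma cinvK c u : is_chart c -> cimg c u -> cmap c (cinv c u) = u /\ cdom c (cinv c u).
Proof. by move=> [_ _ K _ _] [p cp <-]; rewrite K. Qed.

(** Around each point, the transition factors through a chart in [B]. *)
Lemma compatible_smooth c c' : generated_atlas c -> generated_atlas c' ->
  smooth_on (overlap c c') (transition c c').
Proof.
move=> [cc cB] [cc' cB'] j; apply: ndiff_local => u [cu c'u].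
have [b [Bb bu]] := B_cover (cinv c u).
have bc := B_chart Bb.
exists (overlap c c' `&` overlap c b); first by do 2 split.
have o1 := open_overlap cc cc'; have o2 := open_overlap cc bc.
have o3 := open_overlap bc cc'.
have oI : open (overlap c c' `&` overlap c b) by exact: openI.
apply: (@ndiff_ext _ _ _ _ _ (transition b c' \o transition c b)) => //.
  move=> v; rewrite inE => -[[cv c'v] [_ bv]].
  by rewrite /transition/=; congr (cmap c'); case: bc => _ _ + _ _; exact.
apply: (ndiff_comp_mx oI o3) => [v [[cv c'v] [_ bv]]||].
- have bK : cinv b (cmap b (cinv c v)) = cinv c v.
    by case: bc => _ _ + _ _; exact.
  split; last by rewrite /transition /= bK.
  by exists (cinv c v).
- by apply: ndiff_sub ((cB b Bb).1 j) => v [].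
- exact: (cB' b Bb).2.
Qed.

Lemma base_generated b : B b -> generated_atlas b.
Proof. by move=> Bb; split; [exact: B_chart|move=> b' Bb'; exact: B_compat]. Qed.

Hypotheses (S_hausdorff : hausdorff_space S) (S_countable : @second_countable S).

Definition generated_manifold : smooth_manifold R n.
Proof.
refine (@SmoothManifold R n S generated_atlas S_hausdorff S_countable _ _ _ _).
- by move=> c [].
- by move=> s; have [b [Bb bs]] := B_cover s; exists b; split => //; exact: base_generated.
- by move=> c c' cc cc'; split; exact: compatible_smooth.
- by move=> c cc cB; split=> // b Bb; apply: cB; exact: base_generated.
Defined.

End maximal_atlas.

(** * Maps tangent to the foliation *)

Lemma sub_flat (R : fieldType) q r (v : 'rV[R]_(q + r)) :
  (v <= row_mx (0 : 'M[R]_(r, q)) 1%:M)%MS = (lsubmx v == 0).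
Proof.
apply/idP/eqP => [/submxP[w ->]|v0].
  by rewrite mul_mx_row mulmx0 row_mxKl.
by rewrite -[v]hsubmxK v0; apply/submxP; exists (rsubmx v); rewrite mul_mx_row mulmx0 mulmx1.
Qed.

Section tangent_maps.
Context {R : realType} {q r : nat} {N : smooth_manifold R (q + r)}.

(** In a flat chart, the tangency hypothesis [lsubmx _ = 0] says that the
    derivative of the transverse coordinates vanishes, so they are constant along
    segments.  The lemma serves three times: for plaques seen in another cube, for
    integral submanifolds and for horizontal slices. *)
Lemma tangent_map_local (E : normedModType R) (gam : E -> N) (D : set E) x
    (c : chart R N (q + r)) (O : set N) :
  open D -> D x -> open O -> O (gam x) -> {for x, continuous gam} ->
  (forall y, D y -> O (gam y) -> differentiable (cmap c \o gam) y) ->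
  (forall y v, D y -> O (gam y) -> lsubmx ('D_v (cmap c \o gam) y) = 0) ->
  \forall y \near x, [/\ D y, O (gam y) &
    lsubmx (cmap c (gam y)) = lsubmx (cmap c (gam x))].
Proof.
move=> oD Dx oO Ox cg dg Dg.
have : nbhs x (D `&` gam @^-1` O).
  by apply: filterI; [exact: open_nbhs_nbhs|apply: cg; exact: open_nbhs_nbhs].
move=> /nbhs_ballP[e/= e0 eP]; apply/nbhs_ballP; exists e => // y xy.
have [Dy Oy] := eP _ xy; split=> //; apply/rowP => i.
pose h z := lsubmx (cmap c (gam z)) 0 i.
have seg t : 0 <= t <= 1 -> D (x + t *: (y - x)) /\ O (gam (x + t *: (y - x))).
  move=> /andP[t0 t1]; apply: eP; move: xy; rewrite -!ball_normE/= => xy.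
  rewrite opprD addNKr normrN normrZ ger0_norm// distrC.
  by apply: le_lt_trans xy; rewrite distrC ler_piMl.
have dl z : D z -> O (gam z) -> differentiable (fun z => lsubmx (cmap c (gam z))) z.
  move=> Dz Oz.
  apply: (@differentiable_comp _ _ _ _ (cmap c \o gam) (lsubmx : 'rV_(q + r) -> 'rV_q)).
    exact: dg.
  exact: differentiable_lsubmx.
have dh z : D z -> O (gam z) -> differentiable h z.
  by move=> Dz Oz; exact: differentiable_entry (dl z Dz Oz).
have Dh z v : D z -> O (gam z) -> 'D_v h z = 0.
  move=> Dz Oz; have E1 : h = fun z => (cmap c \o gam) z 0 (lshift r i).
    by apply/funext => z'; rewrite /h mxE.
  rewrite E1 -(derive_entry v 0 (lshift r i) (dg z Dz Oz)).
  by have := congr1 (fun w : 'rV[R]_q => w 0 i) (Dg z v Dz Oz); rewrite !mxE.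
suff : h (x + (y - x)) = h x by rewrite addrC subrK.
apply: line_constant.
- by move=> t /seg[]; exact: dh.
- by move=> t /seg[] *; exact: Dh.
Qed.

End tangent_maps.

(** * Plaques in flat cubes *)

Lemma ball_split (R : realType) q r (u x : 'rV[R]_(q + r)) (e : R) : 0 < e ->
  ball u e x <-> ball (lsubmx u) e (lsubmx x) /\ ball (rsubmx u) e (rsubmx x).
Proof.
move=> e0; split=> [[_ ux]|[[_ l] [_ rr]]].
  by split; split=> // i j; rewrite !mxE; exact: ux.
split=> // i j; case: (split_ordP j) => k ->.
  by have := l i k; rewrite !mxE.
by have := rr i k; rewrite !mxE.
Qed.

Lemma row_mx_shift (R : realType) q r (t : 'rV[R]_q) (w v : 'rV[R]_r) (h : R) :
  row_mx t (h *: v + w) = h *: row_mx 0 v + row_mx t w.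
Proof. by rewrite scale_row_mx add_row_mx scaler0 add0r. Qed.

Lemma ndiff_row_mx (R : realType) q r (t : 'rV[R]_q) (U : set 'rV[R]_r) :
  open U -> smooth_on U (fun w => row_mx t w).
Proof.
move=> oU j; apply: ndiff_mx => // i k.
case: (split_ordP k) => l kl.
  rewrite [X in ndifferentiable_on _ _ X](_ : _ = fun=> t i l).
    exact: ndiff_cst.
  by apply/funext => w; rewrite kl row_mxEl.
rewrite [X in ndifferentiable_on _ _ X](_ : _ = fun w : 'rV[R]_r => w i l); last first.
  by apply/funext => w; rewrite kl row_mxEr.
apply: (@ndiff_entry _ _ _ _ _ _ id) => //.
case: j => //= j; split=> [x _|v]; first exact: ex_diff.
rewrite [X in ndifferentiable_on _ _ X](_ : _ = fun=> v); first exact: ndiff_cst.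
by apply/funext => x; exact: derive_id.
Qed.

Lemma row_mx_continuous (R : realType) q r (t : 'rV[R]_q) :
  continuous (fun w : 'rV[R]_r => row_mx t w).
Proof.
move=> w; apply: differentiable_continuous.
exact: (proj1 (ndiff_row_mx t openT 1)).
Qed.

(** A ball in the image of a flat chart.  Being a product, it is the union of the
    plaques [t] x [plaque_ball], [t] ranging over [transverse_ball]. *)
Record flat_cube (R : realType) (n : nat) (N : topologicalType) := FlatCube {
  cube_chart : chart R N n;
  cube_center : 'rV[R]_n;
  cube_radius : R }.

Section cubes.
Context {R : realType} {q r : nat} {N : smooth_manifold R (q + r)}.
Variable V : chart_field N.
Local Notation cube := (flat_cube R (q + r) N).
Implicit Types (k : cube) (p : N).

Definition flat_cube_wf k : Prop :=
  [/\ atlas (cube_chart k), flat_chart V (cube_chart k), 0 < cube_radius k &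
      ball (cube_center k) (cube_radius k) `<=` cimg (cube_chart k)].

Definition cube_set k : set N :=
  cdom (cube_chart k) `&`
  cmap (cube_chart k) @^-1` ball (cube_center k) (cube_radius k).

Definition transverse k p : 'rV[R]_q := lsubmx (cmap (cube_chart k) p).
Definition along k p : 'rV[R]_r := rsubmx (cmap (cube_chart k) p).
Definition plaque_point k t w : N := cinv (cube_chart k) (row_mx t w).
Definition plaque_ball k : set 'rV[R]_r := ball (rsubmx (cube_center k)) (cube_radius k).
Definition transverse_ball k : set 'rV[R]_q :=
  ball (lsubmx (cube_center k)) (cube_radius k).

Definition same_plaque k p p' : Prop :=
  [/\ cube_set k p, cube_set k p' & transverse k p = transverse k p'].

Lemma same_plaque_sym k p p' : same_plaque k p p' -> same_plaque k p' p.
Proof. by case. Qed.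

Section one_cube.
Variable k : cube.
Hypothesis kwf : flat_cube_wf k.

Lemma cube_is_chart : is_chart (cube_chart k).
Proof. by case: kwf => /atlas_chart. Qed.

Lemma open_cube_set : open (cube_set k).
Proof.
have [od _ _ cm _] := cube_is_chart; have [_ _ e0 _] := kwf.
rewrite openE => p [dp bp]; apply: filterI; first exact: open_nbhs_nbhs.
apply: (cm p dp); apply: open_nbhs_nbhs; split=> //; exact: ball_open.
Qed.

Lemma cube_coordinates p : cube_set k p ->
  transverse_ball k (transverse k p) /\ plaque_ball k (along k p).
Proof. by have [_ _ e0 _] := kwf; move=> [_ /(ball_split _ _ e0)]. Qed.

Lemma plaque_point_along p : cube_set k p ->
  plaque_point k (transverse k p) (along k p) = p.
Proof.
move=> [dp _]; rewrite /plaque_point /transverse /along hsubmxK.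
by have [_ _ + _ _] := cube_is_chart; exact.
Qed.

Lemma plaque_pointP t w : transverse_ball k t -> plaque_ball k w ->
  [/\ cube_set k (plaque_point k t w), transverse k (plaque_point k t w) = t &
      along k (plaque_point k t w) = w].
Proof.
have [ac _ e0 sub] := kwf; have cc := cube_is_chart.
move=> tb wb; have bu : ball (cube_center k) (cube_radius k) (row_mx t w).
  by apply/(ball_split _ _ e0); rewrite row_mxKl row_mxKr.
have [E1 E2] := cinvK cc (sub _ bu).
rewrite /transverse /along /plaque_point E1 row_mxKl row_mxKr; split=> //.
by split=> //=; rewrite E1.
Qed.

Lemma same_plaque_point p w : cube_set k p -> plaque_ball k w ->
  same_plaque k p (plaque_point k (transverse k p) w).
Proof.
move=> kp wb; have [tb _] := cube_coordinates kp.
by have [h1 h2 h3] := plaque_pointP tb wb; split.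
Qed.

Lemma plaque_pointE p p' : same_plaque k p p' ->
  p' = plaque_point k (transverse k p) (along k p').
Proof. by move=> [kp kp' ->]; rewrite plaque_point_along. Qed.

Lemma plaque_point_continuous t w : transverse_ball k t -> plaque_ball k w ->
  {for w, continuous (plaque_point k t)}.
Proof.
have [ac _ e0 sub] := kwf; have [_ _ _ _ ci] := cube_is_chart.
move=> tb wb; apply: (@continuous_comp _ _ _ (fun w => row_mx t w)).
  exact: row_mx_continuous.
by apply/ci/sub/(ball_split _ _ e0); rewrite row_mxKl row_mxKr.
Qed.

Lemma along_continuous p : cube_set k p -> {for p, continuous (along k)}.
Proof.
have [_ _ _ cm _] := cube_is_chart; move=> [dp _].
apply: (@continuous_comp _ _ _ (cmap (cube_chart k))); first exact: cm.
exact: continuous_rsubmx.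
Qed.

Lemma open_plaque_ball : open (plaque_ball k).
Proof. by have [_ _ e0 _] := kwf; exact: ball_open. Qed.

Lemma plaque_overlap t (c : chart R N (q + r)) w : transverse_ball k t -> plaque_ball k w ->
  cdom c (plaque_point k t w) -> overlap (cube_chart k) c (row_mx t w).
Proof.
have [ac _ e0 sub] := kwf; move=> tb wb cw; split=> //; apply: sub.
by apply/(ball_split _ _ e0); rewrite row_mxKl row_mxKr.
Qed.

Lemma open_plaque_preimage t (O : set N) : transverse_ball k t -> open O ->
  open (plaque_ball k `&` plaque_point k t @^-1` O).
Proof.
move=> tb oO; rewrite openE => w [wb Ow]; apply: filterI.
  by apply: open_nbhs_nbhs; split=> //; exact: open_plaque_ball.
by apply: (plaque_point_continuous tb wb); exact: open_nbhs_nbhs.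
Qed.

Lemma plaque_point_smooth t (c : chart R N (q + r)) : transverse_ball k t -> atlas c ->
  smooth_on (plaque_ball k `&` plaque_point k t @^-1` cdom c)
    (cmap c \o plaque_point k t).
Proof.
move=> tb ac j; have [ak _ e0 sub] := kwf.
have [oc _ _ _ _] := atlas_chart ac.
have oD := open_plaque_preimage tb oc.
apply: (@ndiff_comp_mx _ _ _ _ _ j _ (overlap (cube_chart k) c)
  (fun w => row_mx t w) (transition (cube_chart k) c)) => //.
- exact: open_overlap cube_is_chart (atlas_chart ac).
- by move=> w [wb cw]; exact: plaque_overlap.
- exact: ndiff_row_mx.
- exact: (atlas_compatible ak ac).1.
Qed.

Hypothesis V_dist : Defs.distribution V.

Lemma derive_plaque_point t w v (c : chart R N (q + r)) : transverse_ball k t ->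
  plaque_ball k w -> atlas c -> cdom c (plaque_point k t w) ->
  'D_v (cmap c \o plaque_point k t) w =
    v *m row_mx 0 1%:M *m 'J (transition (cube_chart k) c) (row_mx t w).
Proof.
move=> tb wb ac cw; have [ak _ e0 sub] := kwf.
have ov := plaque_overlap tb wb cw.
have dt : differentiable (transition (cube_chart k) c) (row_mx t w).
  exact: (proj1 ((atlas_compatible ak ac).1 1)).
have [E1 _] := @derive_comp_affine R _ _ _ (transition (cube_chart k) c)
  (fun w => row_mx t w) v (row_mx 0 v) w (row_mx_shift t w v).
apply: (etrans E1); rewrite deriveEjacobian//.
by rewrite mul_mx_row mulmx0 mulmx1.
Qed.

Lemma plaque_tangent t w (c : chart R N (q + r)) : transverse_ball k t ->
  plaque_ball k w -> atlas c -> cdom c (plaque_point k t w) ->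
  (row_mx (0 : 'M[R]_(r, q)) 1%:M *m 'J (transition (cube_chart k) c) (row_mx t w) ==
     V c (cmap c (plaque_point k t w)))%MS.
Proof.
move=> tb wb ac cw; have [ak fk e0 sub] := kwf.
have ov := plaque_overlap tb wb cw.
have /andP[h1 h2] := V_dist.2 _ _ _ ak ac ov.
have /andP[h3 h4] := fk _ ov.1.
by apply/andP; split; [apply: submx_trans h1|apply: (submx_trans h2)]; exact: submxMr.
Qed.

End one_cube.

Hypothesis V_dist : Defs.distribution V.

Lemma tangent_lsubmx k' (v : 'rV[R]_(q + r)) u : flat_cube_wf k' ->
  cimg (cube_chart k') u -> (v <= V (cube_chart k') u)%MS -> lsubmx v = 0.
Proof.
move=> [_ fk' _ _] /fk'/andP[h _] vV; apply/eqP.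
by rewrite -sub_flat; exact: submx_trans vV h.
Qed.

(** The plaque of [k] through [p] is tangent to the foliation, so its transverse
    coordinates in [k'] are locally constant.  All gluing of plaques rests on this
    comparison. *)
Lemma plaque_local k k' p : flat_cube_wf k -> flat_cube_wf k' ->
  cube_set k p -> cube_set k' p ->
  exists2 d, 0 < d & forall p', same_plaque k p p' ->
    ball (along k p) d (along k p') -> same_plaque k' p p'.
Proof.
move=> kwf kwf' kp kp'; have [tb wb] := cube_coordinates kwf kp.
have E := plaque_point_along kwf kp.
have ak' : atlas (cube_chart k') by case: kwf'.
have oD := @open_plaque_ball k kwf.
have c0 := plaque_point_continuous kwf tb wb.
have sm := plaque_point_smooth kwf tb ak'.
have := @tangent_map_local R q r N _ (plaque_point k (transverse k p))
  (plaque_ball k) (along k p) (cube_chart k') (cube_set k') oD wb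
  (open_cube_set kwf') _ c0.
rewrite E => /(_ kp') loc.
have /nbhs_ballP[d/= d0 dP] : \forall y \near along k p,
    [/\ plaque_ball k y, cube_set k' (plaque_point k (transverse k p) y)
     & lsubmx (cmap (cube_chart k') (plaque_point k (transverse k p) y)) =
       lsubmx (cmap (cube_chart k') p)].
  apply: loc.
  - move=> w wb' [kw _]; exact: (proj1 (sm 1)).
  - move=> w v wb' [kw _]; rewrite derive_plaque_point//.
    apply: (tangent_lsubmx (k' := k') (u := cmap (cube_chart k')
      (plaque_point k (transverse k p) w))) => //.
      by exists (plaque_point k (transverse k p) w).
    have /andP[h _] := plaque_tangent kwf V_dist tb wb' ak' kw.
    by apply: submx_trans h; rewrite -mulmxA submxMl.
exists d => // p' pp' near_p; have [_ h1 h2] := dP _ near_p.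
by rewrite -(plaque_pointE kwf pp') in h1 h2; split.
Qed.

End cubes.

(** * The leaf topology *)

Section linked_points.
Context {R : realType} {q r : nat} {N : smooth_manifold R (q + r)}.
Variable K : nat -> flat_cube R (q + r) N.

(** Chains of plaques; the leaves are the classes of this relation. *)
Inductive linked (p : N) : N -> Prop :=
| linked_refl : linked p p
| linked_step p' p'' n : linked p p' -> same_plaque (K n) p' p'' -> linked p p''.

Lemma linked_trans p p' p'' : linked p p' -> linked p' p'' -> linked p p''.
Proof. by move=> pp'; elim=> // a b n _ pa ab; exact: linked_step pa ab. Qed.

Lemma linked_plaque n p p' : same_plaque (K n) p p' -> linked p p'.
Proof. by move=> pp'; exact: linked_step (linked_refl p) pp'. Qed.

Lemma linked_sym p p' : linked p p' -> linked p' p.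
Proof.
elim=> [|a b n _ ap ab]; first exact: linked_refl.
exact: linked_trans (linked_plaque (same_plaque_sym ab)) ap.
Qed.

Definition leaf_space (p0 : N) : Type := {p : N | linked p0 p}.

HB.instance Definition _ p0 := gen_eqMixin (leaf_space p0).
HB.instance Definition _ p0 := gen_choiceMixin (leaf_space p0).

Section leaf_topology.
Variable p0 : N.
Local Notation S := (leaf_space p0).

(** The topology generated by the open subsets of plaques, in general finer than
    that of a subspace of [N]. *)
Definition leaf_open (O : set S) : Prop := forall (s : S) n, O s ->
  cube_set (K n) (sval s) -> exists2 d, 0 < d & forall s' : S,
    same_plaque (K n) (sval s) (sval s') ->
    ball (along (K n) (sval s)) d (along (K n) (sval s')) -> O s'.

Lemma leaf_openT : leaf_open setT.
Proof. by move=> s n _ _; exists 1. Qed.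

Lemma leaf_openI : setI_closed leaf_open.
Proof.
move=> A B oA oB s n [As Bs] ks; have [d d0 dA] := oA s n As ks.
have [d' d'0 dB] := oB s n Bs ks; exists (Num.min d d').
  by rewrite lt_min d0.
move=> s' ss' near_s; split.
  by apply: dA => //; apply: le_ball near_s; rewrite ge_min lexx.
by apply: dB => //; apply: le_ball near_s; rewrite ge_min lexx orbT.
Qed.

Lemma leaf_open_bigU (I : Type) (f : I -> set S) :
  (forall i, leaf_open (f i)) -> leaf_open (\bigcup_i f i).
Proof.
move=> of_ s n [i _ fs] ks; have [d d0 dP] := of_ i s n fs ks.
by exists d => // s' ss' near_s; exists i => //; exact: dP.
Qed.

HB.instance Definition _ := isOpenTopological.Build (leaf_space p0)
  leaf_openT leaf_openI leaf_open_bigU.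

Lemma leaf_openE (O : set S) : open O = leaf_open O.
Proof. by []. Qed.

Lemma leaf_space_inj (s s' : S) : sval s = sval s' -> s = s'.
Proof. by case: s s' => p hp [p' hp'] /= pp'; subst p'; congr exist; exact: Prop_irrelevance. Qed.

End leaf_topology.
End linked_points.

Section leaf_manifold.
Context {R : realType} {q r : nat} {N : smooth_manifold R (q + r)}.
Variables (V : chart_field N) (K : nat -> flat_cube R (q + r) N) (p0 : N).
Local Notation S := (leaf_space K p0).
Hypotheses (V_dist : Defs.distribution V) (Kwf : forall n, flat_cube_wf V (K n))
  (Kcover : forall p, exists n, cube_set (K n) p).

Let ploc n n' p (kp : cube_set (K n) p) (kp' : cube_set (K n') p) :=
  plaque_local V_dist (Kwf n) (Kwf n') kp kp'.

Lemma inclusion_continuous : continuous (fun s : S => sval s).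
Proof.
apply/continuousP => O oO; rewrite leaf_openE => s n Os ks.
have [tb wb] := cube_coordinates (Kwf n) ks.
have c0 := plaque_point_continuous (Kwf n) tb wb.
have : nbhs (along (K n) (sval s)) (plaque_point (K n) (transverse (K n) (sval s)) @^-1` O).
  apply: c0; apply: open_nbhs_nbhs; split=> //.
  by rewrite (plaque_point_along (Kwf n) ks).
move=> /nbhs_ballP[d/= d0 dP]; exists d => // s' ss' near_s.
by have := dP _ near_s; rewrite /= -(plaque_pointE (Kwf n) ss').
Qed.

Lemma leaf_hausdorff : hausdorff_space S.
Proof.
move=> s s' ss'; apply: leaf_space_inj; apply: (@manifold_hausdorff _ _ N).
move=> A B As Bs.
have [x [Ax Bx]] := ss' _ _ (inclusion_continuous As) (inclusion_continuous Bs).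
by exists (sval x).
Qed.

(** Openness of this set for another cube at the same point is the local
    comparison of plaques. *)
Lemma open_plaque n t (A : set 'rV[R]_r) : open A ->
  open ([set s : S | [/\ cube_set (K n) (sval s), transverse (K n) (sval s) = t &
    A (along (K n) (sval s))]]).
Proof.
move=> oA; rewrite leaf_openE => s n' [ks st As] ks'.
have [d d0 dP] := ploc ks' ks.
have ca := along_continuous (Kwf n) ks.
have [tb wb] := cube_coordinates (Kwf n') ks'.
have c0 := plaque_point_continuous (Kwf n') tb wb.
have E := plaque_point_along (Kwf n') ks'.
have : nbhs (along (K n') (sval s))
    ((along (K n) \o plaque_point (K n') (transverse (K n') (sval s))) @^-1` A).
  have ca' : {for plaque_point (K n') (transverse (K n') (sval s))
      (along (K n') (sval s)), continuous (along (K n))} by rewrite E.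
  have cc := continuous_comp c0 ca'.
  by apply: cc; apply: open_nbhs_nbhs; split=> //=; rewrite E.
move=> /nbhs_ballP[d'/= d'0 dP']; exists (Num.min d d').
  by rewrite lt_min d0.
move=> s' ss' near_s.
have [|_ ks2 tt'] := dP _ ss'.
  by apply: le_ball near_s; rewrite ge_min lexx.
split=> //; first by rewrite -tt'.
have := dP' (along (K n') (sval s')); rewrite /= -(plaque_pointE (Kwf n') ss').
by apply; apply: le_ball near_s; rewrite ge_min lexx orbT.
Qed.

(** The default value is only met outside the image of a chart, where its inverse
    is arbitrary. *)
Definition leaf_point (p : N) : S :=
  if pselect (linked K p0 p) is left lp then exist _ p lp
  else exist _ p0 (linked_refl K p0).

Lemma leaf_pointE p : linked K p0 p -> sval (leaf_point p) = p.
Proof. by move=> lp; rewrite /leaf_point; case: pselect. Qed.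

Definition plaque_chart n (s0 : S) : chart R S r := Chart
  [set s : S | same_plaque (K n) (sval s0) (sval s)]
  (fun s => along (K n) (sval s))
  (fun w => leaf_point (plaque_point (K n) (transverse (K n) (sval s0)) w)).

Section one_plaque_chart.
Variables (n : nat) (s0 : S).
Hypothesis ks0 : cube_set (K n) (sval s0).
Local Notation b := (plaque_chart n s0).

Lemma plaque_chart_cinv w : plaque_ball (K n) w ->
  sval (cinv b w) = plaque_point (K n) (transverse (K n) (sval s0)) w /\
  cdom b (cinv b w).
Proof.
move=> wb; have sp := same_plaque_point (Kwf n) ks0 wb.
have l : linked K p0 (plaque_point (K n) (transverse (K n) (sval s0)) w).
  exact: linked_step (svalP s0) sp.
by rewrite /= leaf_pointE.
Qed.

Lemma plaque_chart_cimg : cimg b = plaque_ball (K n).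
Proof.
have [tb _] := cube_coordinates (Kwf n) ks0.
apply/seteqP; split=> [_ [s [_ ks _] <-]|w wb].
  by have [] := cube_coordinates (Kwf n) ks.
have [E D] := plaque_chart_cinv wb; exists (cinv b w) => //.
have [_ _ aw] := plaque_pointP (Kwf n) tb wb.
by apply: etrans aw; rewrite -E.
Qed.

Lemma plaque_chart_dom : cdom b = [set s : S | [/\ cube_set (K n) (sval s),
  transverse (K n) (sval s) = transverse (K n) (sval s0) & setT (along (K n) (sval s))]].
Proof. by apply/seteqP; split=> s; [case=> _ h1 h2; split|case=> h1 h2 _; split]. Qed.

Lemma plaque_chart_cinvK s : cdom b s -> cinv b (cmap b s) = s.
Proof.
move=> ss; apply: leaf_space_inj; rewrite /= -(plaque_pointE (Kwf n) ss) leaf_pointE//.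
exact: svalP s.
Qed.

Lemma plaque_chart_is_chart : is_chart b.
Proof.
split.
- by rewrite plaque_chart_dom; apply: open_plaque; exact: openT.
- by rewrite plaque_chart_cimg; exact: open_plaque_ball (Kwf n).
- exact: plaque_chart_cinvK.
- move=> s [_ ks _]; apply: (@continuous_comp _ _ _ (fun s : S => sval s)).
    exact: inclusion_continuous.
  exact: (along_continuous (Kwf n) ks).
- rewrite plaque_chart_cimg => w wb A.
  rewrite nbhsE; case=> O [oO Ow] OA.
  have [E [_ kw tw]] := plaque_chart_cinv wb.
  have [d d0 dP] := oO _ n Ow kw.
  have [tb _] := cube_coordinates (Kwf n) ks0.
  have [_ _ aw] := plaque_pointP (Kwf n) tb wb.
  have nb : nbhs w (ball w d `&` plaque_ball (K n)).
    apply: filterI; first exact: nbhsx_ballx.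
    by apply: open_nbhs_nbhs; split=> //; exact: open_plaque_ball (Kwf n).
  apply: filterS nb => w' [ww' wb']; apply: OA; apply: dP.
    have [_ [_ kw' tw']] := plaque_chart_cinv wb'.
    by split=> //; rewrite -tw.
  have [_ _ aw'] := plaque_pointP (Kwf n) tb wb'.
  by have [E' _] := plaque_chart_cinv wb'; rewrite E E' aw aw'.
Qed.

End one_plaque_chart.

Definition plaque_charts : set (chart R S r) :=
  [set b | exists n (s0 : S), cube_set (K n) (sval s0) /\ b = plaque_chart n s0].

Lemma plaque_charts_chart b : plaque_charts b -> is_chart b.
Proof. by move=> [n [s0 [ks0 ->]]]; exact: plaque_chart_is_chart. Qed.

Lemma plaque_charts_cover (s : S) : exists b, plaque_charts b /\ cdom b s.
Proof.
have [n ks] := Kcover (sval s); exists (plaque_chart n s); split; first by exists n, s.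
by split.
Qed.

Lemma plaque_charts_smooth n n' (s0 s0' : S) :
  cube_set (K n) (sval s0) -> cube_set (K n') (sval s0') ->
  let b := plaque_chart n s0 in let b' := plaque_chart n' s0' in
  smooth_on (overlap b b') (transition b b').
Proof.
move=> ks0 ks0' b b' j.
have bc := plaque_chart_is_chart ks0; have bc' := plaque_chart_is_chart ks0'.
have [tb _] := cube_coordinates (Kwf n) ks0.
have ac : atlas (cube_chart (K n')) by case: (Kwf n').
have oO := open_overlap bc bc'.
have sub w : overlap b b' w -> plaque_ball (K n) w /\
    sval (cinv b w) = plaque_point (K n) (transverse (K n) (sval s0)) w.
  by move=> [+ _]; rewrite plaque_chart_cimg// => wb; have [] := plaque_chart_cinv ks0 wb.
apply: (@ndiff_ext _ _ _ _ _ (fun w => rsubmx (cmap (cube_chart (K n'))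
   (plaque_point (K n) (transverse (K n) (sval s0)) w)))) => //.
  by move=> w; rewrite inE => /sub[wb E]; rewrite -E.
have sm : ndifferentiable_on j (overlap b b') (cmap (cube_chart (K n')) \o
    plaque_point (K n) (transverse (K n) (sval s0))).
  apply: ndiff_sub (plaque_point_smooth (Kwf n) tb ac j) => w ow.
  have [wb E] := sub w ow; split=> //=; rewrite -E.
  by case: ow => _ [_ []].
apply: ndiff_mx => // i l.
have -> : (fun w => rsubmx (cmap (cube_chart (K n'))
   (plaque_point (K n) (transverse (K n) (sval s0)) w)) i l) =
  (fun w => (cmap (cube_chart (K n')) \o
    plaque_point (K n) (transverse (K n) (sval s0))) w i (rshift q l)).
  by apply/funext => w; rewrite mxE.
exact: ndiff_entry.
Qed.

Lemma plaque_charts_compat b b' : plaque_charts b -> plaque_charts b' -> compatible b b'.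
Proof.
by move=> [n [s0 [ks0 ->]]] [n' [s0' [ks0' ->]]]; split; exact: plaque_charts_smooth.
Qed.

Definition ratr_row (a : 'rV[rat]_r) : 'rV[R]_r := map_mx ratr a.

Lemma rational_ball_basis (w : 'rV[R]_r) (A : set 'rV[R]_r) : nbhs w A ->
  exists (a : 'rV[rat]_r) (l : nat), ball (ratr_row a) l.+1%:R^-1 w /\
    ball (ratr_row a) l.+1%:R^-1 `<=` A.
Proof.
move=> /nbhs_ballP[e/= e0 eA]; have e2 : 0 < e / 2 by rewrite divr_gt0.
have [l le] : exists l : nat, l.+1%:R^-1 < e / 2.
  by have [l _ /(_ l (leqnn l))/= le] := near_infty_natSinv_lt (PosNum e2); exists l.
have l0 : 0 < l.+1%:R^-1 :> R by rewrite invr_gt0.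
exists (\row_j sval (cid (rational_approx (w 0 j) l0))), l.
have wa : ball (ratr_row (\row_j sval (cid (rational_approx (w 0 j) l0)))) l.+1%:R^-1 w.
  split=> // i j; rewrite ord1 !mxE; case: cid => a /= wa.
  by rewrite /ball/= distrC.
split=> // v va; apply: eA; apply: (@le_ball _ _ _ (l.+1%:R^-1 + l.+1%:R^-1)).
  by rewrite ltW// [ltRHS]splitr ltrD.
exact: ball_triangle (ball_sym wa) va.
Qed.

(** Each step moves within a plaque, to the point with the given coordinates. *)
Fixpoint rational_walk (code : seq (nat * 'rV[rat]_r)) : N :=
  if code is (n, a) :: code' then
    plaque_point (K n) (transverse (K n) (rational_walk code')) (ratr_row a)
  else p0.

(** A chain of plaques can be followed through points with rational leaf
    coordinates, since consecutive plaques meet in a set that is open in both.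
    Hence countably many plaques cover a leaf. *)
Lemma rational_walk_plaque p : linked K p0 p ->
  exists code n, same_plaque (K n) (rational_walk code) p.
Proof.
elim=> [|p' p'' m _ [code [n np]] mp].
  by have [n np] := Kcover p0; exists [::], n.
have [_ np' tp] := np; have [mp' mp'' tp'] := mp.
have [d d0 dP] := ploc np' mp'.
have [_ wb] := cube_coordinates (Kwf n) np'.
have nb : nbhs (along (K n) p') (ball (along (K n) p') d `&` plaque_ball (K n)).
  apply: filterI; first exact: nbhsx_ballx.
  by apply: open_nbhs_nbhs; split=> //; exact: open_plaque_ball (Kwf n).
have [a [l [_ /(_ _ (ballxx _ _))]]] := rational_ball_basis nb.
rewrite invr_gt0 => /(_ (ltr0Sn _ _))[ad ab].
have sp := same_plaque_point (Kwf n) np' ab.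
have [tb _] := cube_coordinates (Kwf n) np'.
have [_ _ aw] := plaque_pointP (Kwf n) tb ab.
exists ((n, a) :: code), m; rewrite /= tp.
have [_ h1 h2] := dP _ sp (eq_ind_r (fun v => ball (along (K n) p') d v) ad aw).
by split=> //; rewrite -h2.
Qed.

Lemma leaf_second_countable : @second_countable S.
Proof.
pose I := (seq (nat * 'rV[rat]_r) * nat * 'rV[rat]_r * nat)%type.
pose bset (i : I) : set S := [set s : S | [/\ cube_set (K i.1.1.2) (sval s),
  transverse (K i.1.1.2) (sval s) = transverse (K i.1.1.2) (rational_walk i.1.1.1) &
  ball (ratr_row i.1.2) i.2.+1%:R^-1 (along (K i.1.1.2) (sval s))]].
exists (range bset).
  exact: card_le_trans (card_image_le _ _) (countableP _).
split=> [_ [i _ <-]|s A]; first by apply: open_plaque; exact: ball_open.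
rewrite nbhsE; case=> O [oO Os] OA.
have [code [n [kw ks tw]]] := rational_walk_plaque (svalP s).
have [d d0 dP] := oO s n Os ks.
have [a [l [wa aA]]] := rational_ball_basis (nbhsx_ballx (along (K n) (sval s)) _ d0).
exists (bset (code, n, a, l)); first by split=> //; exists (code, n, a, l).
move=> s' [/= ks' tw' wa']; apply: OA; apply: dP; last exact: aA.
by split=> //; rewrite tw' tw.
Qed.

Lemma ball_segment (E : normedModType R) (u y z : E) e t : 0 <= t <= 1 ->
  ball u e y -> ball u e z -> ball u e (y + t *: (z - y)).
Proof.
rewrite -!ball_normE/= => /andP[t0 t1] uy uz.
have -> : u - (y + t *: (z - y)) = (1 - t) *: (u - y) + t *: (u - z).
  have E1 : (u - z) - (u - y) = - (z - y) by rewrite opprB addrC subrKA opprB.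
  rewrite scalerBl scale1r -addrA [- (t *: _) + _]addrC -scalerBr E1 scalerN.
  by rewrite opprD addrA.
have M : Num.max `|u - y| `|u - z| < e by rewrite gt_max uy uz.
apply: le_lt_trans M; rewrite (le_trans (ler_normD _ _))// !normrZ !ger0_norm ?subr_ge0//.
set M' := Num.max _ _; rewrite [leRHS](_ : _ = (1 - t) * M' + t * M'); last first.
  by rewrite -mulrDl subrK mul1r.
rewrite lerD// ler_wpM2l ?subr_ge0 /M'//.
  by rewrite le_max lexx.
by rewrite le_max lexx orbT.
Qed.

(** A subset that is open and closed contains, with a point, its plaque, since the
    charts map segments of the plaque ball continuously to the leaf. *)
Lemma leaf_connected : connected [set: S].
Proof.
move=> B [s0 Bs0] [C oC BC] [C' cC' BC'].
have oB : open B by rewrite BC setTI.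
have oNB : open (~` B) by rewrite BC' setTI; exact: closed_openC.
suff H p : linked K (sval s0) p -> forall s : S, sval s = p -> B s.
  apply/seteqP; split=> // s _; apply: (H (sval s)) => //.
  exact: linked_trans (linked_sym (svalP s0)) (svalP s).
elim=> [s ss0|p' p'' n lp' IH pp s sp''].
  by rewrite (leaf_space_inj ss0).
have lp0 : linked K p0 p' by exact: linked_trans (svalP s0) lp'.
pose s' := leaf_point p'; have s'E : sval s' = p' by rewrite /s' leaf_pointE.
have Bs' : B s' by exact: IH.
have ks' : cube_set (K n) (sval s') by rewrite s'E; case: pp.
have ss' : same_plaque (K n) (sval s') (sval s) by rewrite s'E sp''.
have bc := plaque_chart_is_chart ks'.
pose b := plaque_chart n s'.
pose w := along (K n) (sval s'); pose w' := along (K n) (sval s).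
pose sig (t : R) := w + t *: (w' - w).
have [_ wb] := cube_coordinates (Kwf n) ks'.
have [_ wb'] := cube_coordinates (Kwf n) (let: And3 _ h _ := ss' in h).
have E0 : cinv b (sig 0) = s'.
  rewrite /sig scale0r addr0; apply: (plaque_chart_cinvK (n := n) (s0 := s')).
  by split.
have E1 : cinv b (sig 1) = s.
  rewrite /sig scale1r addrC subrK.
  exact: (plaque_chart_cinvK (n := n) (s0 := s') ss').
rewrite -E1; apply: (@segment_locally_constant R (fun t => B (cinv b (sig t)))); last first.
  by rewrite E0.
move=> t t01.
have wt : plaque_ball (K n) (sig t) by exact: ball_segment.
have cs : {for t, continuous sig}.
  apply: cvgD; first exact: cvg_cst.
  by apply: cvgZr_tmp; exact: cvg_id.
have cb : {for sig t, continuous (cinv b)}.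
  by case: bc => _ _ _ _ ci; apply: ci; rewrite plaque_chart_cimg.
have cc := continuous_comp cs cb.
have [Bt|nBt] := pselect (B (cinv b (sig t))).
  have : nbhs t ((cinv b \o sig) @^-1` B) by apply: cc; exact: open_nbhs_nbhs.
  by apply: filterS => t' /= Bt' _; tauto.
have : nbhs t ((cinv b \o sig) @^-1` (~` B)) by apply: cc; exact: open_nbhs_nbhs.
by apply: filterS => t' /= Bt' _; tauto.
Qed.

End leaf_manifold.

(** One cube is chosen for each set of a countable basis that lies in a cube; these
    basis sets cover [N]. *)
Lemma countable_cube_cover (R : realType) q r (N : smooth_manifold R (q + r))
    (V : chart_field N) (p0 : N) : foliation V ->
  exists K : nat -> flat_cube R (q + r) N, (forall n, flat_cube_wf V (K n)) /\
    forall p, exists n, cube_set (K n) p.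
Proof.
move=> [_ flat]; have [B cB [oB bB]] := @manifold_second_countable _ _ N.
have cube_at p : exists k, flat_cube_wf V k /\ cube_set k p.
  have [c [ac cp fc]] := flat p; have [_ oi _ _ _] := atlas_chart ac.
  have : nbhs (cmap c p) (cimg c).
    by apply: open_nbhs_nbhs; split=> //; exists p.
  move=> /nbhs_ballP[e/= e0 eP]; exists (FlatCube c (cmap c p) e).
  by split=> //; split=> //=; exact: ballxx.
have /countable_injP[f f_inj] := cB.
pose P n k := flat_cube_wf V k /\
  exists U, [/\ B U, f U = n & U `<=` cube_set k].
(* The point [p0] only provides a default cube [k0]. *)
have [k0 [k0wf _]] := cube_at p0.
pose K n := if pselect (exists k, P n k) is left h then sval (cid h) else k0.
exists K; split=> [n|p].
  by rewrite /K; case: pselect => // h; case: cid => k [].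
have [k [kwf kp]] := cube_at p.
have [U [BU Up] Uk] := bB p _ (open_nbhs_nbhs (conj (open_cube_set kwf) kp)).
exists (f U); rewrite /K; case: pselect => [h|[]]; last first.
  by exists k; split=> //; exists U.
case: cid => k' [_ [U' [BU' fU' U'k']]] /=; apply: U'k'.
by rewrite (f_inj _ _ _ _ fU')// inE.
Qed.

(** * Leaves *)

Section leaves.
Context {R : realType} {q r : nat} {N : smooth_manifold R (q + r)}.
Variables (V : chart_field N) (K : nat -> flat_cube R (q + r) N).
Hypotheses (V_dist : Defs.distribution V) (Kwf : forall n, flat_cube_wf V (K n))
  (Kcover : forall p, exists n, cube_set (K n) p).

Section leaf_through.
Variable p0 : N.

Definition leaf_manifold : smooth_manifold R r :=
  @generated_manifold R (leaf_space K p0) r (@plaque_charts R q r N K p0)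
    (plaque_charts_chart V_dist Kwf) (plaque_charts_cover Kcover)
    (plaque_charts_compat V_dist Kwf) (leaf_hausdorff Kwf)
    (leaf_second_countable p0 V_dist Kwf Kcover).

Local Notation S := leaf_manifold.
Definition leaf_inclusion (s : S) : N := sval (s : leaf_space K p0).
Local Notation inc := leaf_inclusion.

Lemma plaque_chart_at (s : S) : exists n, cube_set (K n) (inc s) /\
  atlas (plaque_chart n s : chart R S r) /\ cdom (plaque_chart n s : chart R S r) s.
Proof.
have [n ks] := Kcover (inc s); exists n; split; first exact: ks.
split; last by split.
apply: (base_generated (plaque_charts_chart V_dist Kwf) (plaque_charts_compat V_dist Kwf)).
by exists n, s.
Qed.

Section in_chart.
Variables (a : chart R S r) (c : chart R N (q + r)) (n : nat) (s : S).
Hypotheses (aa : atlas a) (ac : atlas c) (ks : cube_set (K n) (inc s))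
  (ab : atlas (plaque_chart n s : chart R S r)).
Local Notation b := (plaque_chart n s : chart R S r).
Local Notation t := (transverse (K n) (inc s)).

(** In plaque coordinates the inclusion is [plaque_point], whose smoothness and
    differential are known. *)
Lemma inclusion_through_plaque u : overlap a b u ->
  inc (cinv a u) = plaque_point (K n) t (transition a b u) /\
  plaque_ball (K n) (transition a b u).
Proof.
move=> [_ bu]; have {}bu : same_plaque (K n) (inc s) (inc (cinv a u)) by [].
split; first by rewrite (plaque_pointE (Kwf n) bu).
by case: bu => _ ku _; have [] := cube_coordinates (Kwf n) ku.
Qed.

Lemma open_inclusion_domain :
  open (overlap a b `&` (inc \o cinv a) @^-1` cdom c).
Proof.
have cha := atlas_chart aa; have chb := atlas_chart ab.
have [oc _ _ _ _] := atlas_chart ac.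
rewrite openE => u [ou cu]; apply: filterI.
  by apply: open_nbhs_nbhs; split=> //; exact: open_overlap.
have ca : {for u, continuous (cinv a)} by case: cha => _ _ _ _; apply; case: ou.
have ci : {for cinv a u, continuous inc} by exact: (inclusion_continuous Kwf).
by apply: (continuous_comp ca ci); exact: open_nbhs_nbhs.
Qed.

Lemma inclusion_smooth_on :
  smooth_on (overlap a b `&` (inc \o cinv a) @^-1` cdom c) (cmap c \o inc \o cinv a).
Proof.
move=> j; have [tb _] := cube_coordinates (Kwf n) ks.
have oD := open_inclusion_domain.
have oc : open (cdom c) by case: (atlas_chart ac).
have oW := open_plaque_preimage (Kwf n) tb oc.
apply: (@ndiff_ext _ _ _ _ _ ((cmap c \o plaque_point (K n) t) \o transition a b)) => //.
  move=> u; rewrite inE => -[ou _].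
  by rewrite [RHS]/(cmap c (inc (cinv a u))) (inclusion_through_plaque ou).1.
apply: (ndiff_comp_mx oD oW _ _ (plaque_point_smooth (Kwf n) tb ac j)).
  move=> u [ou cu]; have [E wb] := inclusion_through_plaque ou.
  by split=> //; rewrite /= -E.
by apply: ndiff_sub ((atlas_compatible aa ab).1 j) => u [].
Qed.

End in_chart.

Lemma leaf_inclusion_smooth : smooth_map inc.
Proof.
move=> a aa; split.
  move=> u ua; have [_ _ _ _ ca] := atlas_chart aa.
  apply: (@continuous_comp _ _ _ (cinv a) inc); first exact: ca.
  exact: (inclusion_continuous Kwf).
move=> c ac j; apply: ndiff_local => u [ua cu].
have [n [ks [ab bs]]] := plaque_chart_at (cinv a u).
exists (overlap a (plaque_chart n (cinv a u) : chart R S r) `&`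
  (inc \o cinv a) @^-1` cdom c); first by [].
exact: inclusion_smooth_on.
Qed.

Lemma jacobian_inverse (a b : chart R S r) s : atlas a -> atlas b ->
  cdom a s -> cdom b s ->
  'J (transition a b) (cmap a s) *m 'J (transition b a) (cmap b s) = 1%:M.
Proof.
move=> aa ab sa sb.
have cha := atlas_chart aa; have chb := atlas_chart ab.
have Ka : cinv a (cmap a s) = s by case: cha => _ _ + _ _; exact.
have Kb : cinv b (cmap b s) = s by case: chb => _ _ + _ _; exact.
have oab : overlap a b (cmap a s) by split; [exists s|rewrite /= Ka].
have oba : overlap b a (cmap b s) by split; [exists s|rewrite /= Kb].
have E : transition a b (cmap a s) = cmap b s by rewrite /transition/= Ka.
have d1 : differentiable (transition a b) (cmap a s).
  exact: (proj1 ((atlas_compatible aa ab).1 1)).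
have d2 : differentiable (transition b a) (transition a b (cmap a s)).
  by rewrite E; exact: (proj1 ((atlas_compatible aa ab).2 1)).
apply/row_matrixP => i; rewrite !rowE mulmxA -(deriveEjacobian _ d1) -E.
rewrite -(deriveEjacobian _ d2) mulmx1 -(derive_comp _ d1 d2).
rewrite -[RHS](derive_id (cmap a s)); apply: near_eq_derive; near=> u.
have [ua bu] : overlap a b u.
  by near: u; apply: open_nbhs_nbhs; split=> //; exact: open_overlap.
rewrite /transition/=.
have -> : cinv b (cmap b (cinv a u)) = cinv a u by have [_ _ + _ _] := chb; exact.
by have [] := cinvK cha ua.
Unshelve. all: by end_near. Qed.

Lemma leaf_inclusion_tangent s (a : chart R S r) (c : chart R N (q + r)) :
  atlas a -> cdom a s -> atlas c -> cdom c (inc s) ->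
  let J := 'J (cmap c \o inc \o cinv a) (cmap a s) in
  row_free J /\ (J == V c (cmap c (inc s)))%MS.
Proof.
move=> aa sa ac cs J.
have [n [ks [ab bs]]] := plaque_chart_at s.
pose b := plaque_chart n s : chart R S r.
have [tb wb] := cube_coordinates (Kwf n) ks.
have cha := atlas_chart aa.
have Ka : cinv a (cmap a s) = s by case: cha => _ _ + _ _; exact.
have E := plaque_point_along (Kwf n) ks.
have cE : cdom c (plaque_point (K n) (transverse (K n) (inc s)) (along (K n) (inc s))).
  by rewrite E.
have oab : overlap a b (cmap a s) by split; [exists s|rewrite /= Ka].
have dab : differentiable (transition a b) (cmap a s).
  exact: (proj1 ((atlas_compatible aa ab).1 1)).
have tE : transition a b (cmap a s) = along (K n) (inc s).
  by rewrite /transition/= Ka.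
have dp : differentiable (cmap c \o plaque_point (K n) (transverse (K n) (inc s)))
    (transition a b (cmap a s)).
  by rewrite tE; exact: (proj1 (plaque_point_smooth (Kwf n) tb ac 1)).
have JE : J = 'J (transition a b) (cmap a s) *m (row_mx 0 1%:M *m
    'J (transition (cube_chart (K n)) c)
      (row_mx (transverse (K n) (inc s)) (along (K n) (inc s)))).
  apply/row_matrixP => i; rewrite !rowE /J mulmxA.
  have dJ : differentiable (cmap c \o inc \o cinv a) (cmap a s).
    apply: (proj1 (inclusion_smooth_on aa ac ks ab 1)); split=> //.
    by rewrite /= Ka.
  rewrite -(deriveEjacobian _ dJ) -(deriveEjacobian _ dab) mulmxA.
  rewrite -(derive_plaque_point (Kwf n))// -tE -(derive_comp _ dab dp).
  apply: near_eq_derive; near=> u.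
  have ou : overlap a b u.
    near: u; apply: open_nbhs_nbhs; split=> //.
    exact: open_overlap cha (atlas_chart ab).
  by rewrite [LHS]/(cmap c (inc (cinv a u))) (inclusion_through_plaque ou).1.
have JV : (J == V c (cmap c (inc s)))%MS.
  have /andP[h1 h2] := plaque_tangent (Kwf n) V_dist tb wb ac cE.
  rewrite E in h1 h2; rewrite JE; apply/andP; split.
    exact: submx_trans (submxMl _ _) h1.
  apply: (submx_trans h2).
  have J1 := jacobian_inverse ab aa bs sa.
  set M := (row_mx 0 1%:M *m _); rewrite -[X in (X <= _)%MS]mul1mx -J1 -mulmxA.
  exact: submxMl.
split=> //; rewrite /row_free (eqmxP JV).
by apply/eqP/V_dist.1 => //; exists (inc s).
Unshelve. all: by end_near. Qed.

Lemma linked_integral_submanifold :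
  connected_integral_submanifold V (linked K p0).
Proof.
exists S, inc; split.
- exact: leaf_connected V_dist Kwf.
- exact: leaf_inclusion_smooth.
- by move=> s s'; exact: leaf_space_inj.
- apply/seteqP; split=> [_ [s _ <-]|p lp]; first exact: svalP s.
  by exists (exist _ p lp : leaf_space K p0).
- by move=> s a c aa sa ac cs; exact: leaf_inclusion_tangent.
Qed.

End leaf_through.

(** By [tangent_map_local] a neighbourhood of each point of an integral submanifold
    lies in a plaque, so the points linked to a given one form an open and closed
    subset.  This gives the maximality of leaves. *)
Lemma integral_submanifold_linked (L : set N) p p' :
  connected_integral_submanifold V L -> L p -> L p' -> linked K p p'.
Proof.
move=> [S [i [cS si _ rangeL tan]]].
rewrite -rangeL => -[s _ <-] [s' _ <-].
apply: (@connected_locally_constant S setT (fun s' => linked K (i s) (i s')) s) => //;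
  last exact: linked_refl.
move=> {}s' _; have [a [aa sa]] := atlas_cover s'.
have [n kn] := Kcover (i s').
have cha := atlas_chart aa; have [od oi Ka cm ci] := cha.
have ak : atlas (cube_chart (K n)) by case: (Kwf n).
have [ci' sm] := si a aa.
have ua : cimg a (cmap a s') by exists s'.
have E : cinv a (cmap a s') = s' by exact: Ka.
have loc := @tangent_map_local R q r N _ (i \o cinv a) (cimg a) (cmap a s')
  (cube_chart (K n)) (cube_set (K n)) oi ua (open_cube_set (Kwf n)) _ (ci' _ ua).
rewrite /= E in loc.
have {}loc := loc kn.
have : \forall y \near cmap a s', [/\ cimg a y, cube_set (K n) (i (cinv a y)) &
    lsubmx (cmap (cube_chart (K n)) (i (cinv a y))) =
    lsubmx (cmap (cube_chart (K n)) (i s'))].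
  apply: loc => y.
    by move=> ya ky; apply: (proj1 (sm _ ak 1)); split=> //; case: ky.
  move=> v ya ky; have dy : differentiable (cmap (cube_chart (K n)) \o (i \o cinv a)) y.
    by apply: (proj1 (sm _ ak 1)); split=> //; case: ky.
  have [Ey dy'] := cinvK cha ya.
  have [_ /andP[Jy _]] := tan (cinv a y) a (cube_chart (K n)) aa dy' ak ky.1.
  apply: (tangent_lsubmx (V := V) (Kwf n) (u := cmap (cube_chart (K n)) (i (cinv a y)))).
    by exists (i (cinv a y)) => //; case: ky.
  apply: submx_trans Jy; rewrite Ey (deriveEjacobian _ dy); exact: submxMl.
move=> near_u.
have : nbhs s' (cdom a `&` cmap a @^-1` [set y | [/\ cimg a y,
    cube_set (K n) (i (cinv a y)) &
    lsubmx (cmap (cube_chart (K n)) (i (cinv a y))) =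
    lsubmx (cmap (cube_chart (K n)) (i s'))]]).
  by apply: filterI; [exact: open_nbhs_nbhs|exact: cm].
apply: filterS => s'' [as'' /= [_ ks'' ts'']] _.
rewrite Ka// in ks'' ts''.
have sp : same_plaque (K n) (i s') (i s'') by split.
split=> h; first exact: linked_step h sp.
exact: linked_step h (same_plaque_sym sp).
Qed.

Lemma linked_leaf p0 : leaf V (linked K p0).
Proof.
split; first exact: linked_integral_submanifold.
move=> L' L'int sub; apply/seteqP; split=> // p L'p.
by apply: integral_submanifold_linked L'int _ L'p; apply: sub; exact: linked_refl.
Qed.

End leaves.

(** * Horizontal slices *)

Section horizontal_slice.
Context {R : realType} {m k q r : nat} {N : smooth_manifold R (q + r)}.
Variables (g V : chart_field N) (f : 'rV[R]_m * 'rV[R]_k -> N).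
Variables (K : nat -> flat_cube R (q + r) N).
Hypotheses (g_metric : riemannian_metric g)
  (f_smooth : smooth_to [set: 'rV[R]_m * 'rV[R]_k] f)
  (df0 : dHH_eq0 g V f) (Kwf : forall n, flat_cube_wf V (K n))
  (Kcover : forall p, exists n, cube_set (K n) p).

Lemma horizontal_derive_tangent z (x : 'rV[R]_m) c : atlas c -> cdom c (f z) ->
  ('D_(x, 0) (cmap c \o f) z <= V c (cmap c (f z)))%MS.
Proof.
move=> ac cz; have zu : cimg c (cmap c (f z)) by exists (f z).
have Gpos v : v != 0 -> 0 < ip (g c) (cmap c (f z)) v v.
  exact: (metric_pos g_metric).
apply/etrans; first exact/esym/projH_ker/Gpos.
exact/eqP/(df0 (x, 0) ac cz).
Qed.

(** With [dHH = 0] the derivative of [f] along [R^m] is tangent to the leaves, so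
    [f] stays locally in a plaque along the segment from [(0, p)] to [(x, p)]. *)
Lemma horizontal_slice_linked x p : linked K (f (0, p)) (f (x, p)).
Proof.
pose gam (t : R) : N := f (t *: x, p).
suff : linked K (gam 0) (gam 1) by rewrite /gam scale0r scale1r.
apply: (segment_locally_constant (P := fun t => linked K (gam 0) (gam t))); last first.
  exact: linked_refl.
move=> t _; have [n kn] := Kcover (gam t).
have ak : atlas (cube_chart (K n)) by case: (Kwf n).
have aff (v s h : R) :
    ((h *: v + s) *: x, p) = h *: (v *: x, 0) + (s *: x, p) :> 'rV_m * 'rV_k.
  by congr pair; rewrite /= ?scaler0 ?add0r// scalerDl scalerA.
have slice (v s : R) := derive_comp_affine (E := R) (a := fun t : R => (t *: x, p))
  (cmap (cube_chart (K n)) \o f) (aff v s).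
have line_c : continuous (fun t : R => (t *: x, p)).
  move=> s; apply: (@cvg_pair _ _ _ _ (nbhs (s *: x)) (nbhs p)); last exact: cvg_cst.
  by apply: cvgZr_tmp; exact: cvg_id.
have dh s : cube_set (K n) (gam s) ->
    differentiable (cmap (cube_chart (K n)) \o f) (s *: x, p).
  by move=> [ks _]; apply: (proj1 (smooth_coordinates f_smooth ak 1)).
have := @tangent_map_local R q r N R gam setT t (cube_chart (K n)) (cube_set (K n))
  openT I (open_cube_set (Kwf n)) kn.
move=> /(_ _ _ _)-loc.
have {loc} : \forall s \near t, [/\ setT s, cube_set (K n) (gam s) &
    lsubmx (cmap (cube_chart (K n)) (gam s)) = lsubmx (cmap (cube_chart (K n)) (gam t))].
  apply: loc.
  - apply: (@continuous_comp _ _ _ (fun t : R => (t *: x, p)) f); first exact: line_c.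
    exact: f_smooth.1.
  - move=> s _ ks; apply/derivable1_diffP.
    by apply: (slice 1 s).2; exact/diff_derivable/dh.
  - move=> s v _ ks.
    have [E _] := slice v s.
    apply: (tangent_lsubmx (V := V) (Kwf n) (u := cmap (cube_chart (K n)) (gam s))).
      by exists (gam s) => //; case: ks.
    apply: etrans (horizontal_derive_tangent (v *: x) ak ks.1).
    exact: (congr1 (fun d => (d <= _)%MS) E).
apply: filterS => s [_ ks ts] _.
have sp : same_plaque (K n) (gam t) (gam s) by split.
split=> h; first exact: linked_step h sp.
exact: linked_step h (same_plaque_sym sp).
Qed.

End horizontal_slice.

Theorem theorem5p4 (R : realType) (m k q r : nat)
    (N : smooth_manifold R (q + r)) (g V : chart_field N)
    (f : 'rV[R]_m * 'rV[R]_k -> N) (x0 : 'rV[R]_m) (y0 : 'rV[R]_k)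
    (k_ge1 : (1 <= k)%N) (m_gt2 : (2 < m)%N)
    (g_metric : riemannian_metric g)
    (V_foliation : foliation V)
    (N_riemannian : riemannian_foliation g V)
    (f_smooth : smooth_to [set: 'rV[R]_m * 'rV[R]_k] f)
    (f_harmonic : horizontally_harmonic g V f)
    (f_growth : forall delta : R, 0 < delta ->
      (fun rho : R =>
         euclidean_integral (cylinder x0 y0 rho delta) (energy_density g V f))
      =o_ (FilterType (pinfty_nbhs R) _) (fun rho : R => rho ^+ (m - 2))) :
  dHH_eq0 g V f /\
  forall p : 'rV[R]_k, exists L : set N,
    leaf V L /\ forall x : 'rV[R]_m, L (f (x, p)).
Proof.
have energyE : energy_density g V f = trace (transverse_pullback g V f).
  by apply/funext => z; rewrite energy_densityE /trace fct_sumE.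
have df0 : dHH_eq0 g V f.
  apply: (dHH_eq0_of_energy g_metric V_foliation f_smooth) => z.
  rewrite energyE; apply: (energy_vanishes m_gt2 (x0 := x0) (y0 := y0)).
  - exact: transverse_pullback_smooth.
  - exact: transverse_pullback_ge0.
  - exact: transverse_pullback_conservation.
  - move=> delta delta0 eps eps0; have /eqoP/(_ eps eps0) := f_growth delta delta0.
    by rewrite energyE.
split=> // p; have [K [Kwf Kcover]] := countable_cube_cover (f (0, p)) V_foliation.
exists (linked K (f (0, p))); split; first exact: linked_leaf V_foliation.1 Kwf Kcover _.
by move=> x; exact: (horizontal_slice_linked g_metric f_smooth df0 Kwf Kcover).
Qed.
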